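(* Let $\mathcal U$ be a nonprincipal ultrafilter on a set $I$, let $(N_\iota)_{\iota\in I}$ be $\mathrm{II}_1$ factors, and let $M\subset\prod_{\iota\to\mathcal U}N_\iota$ be a subfactor with property (T) such that $M'\cap\prod_{\iota\to\mathcal U}N_\iota$ is a factor. Suppose that for each $\iota$, $\alpha_\iota\in\mathrm{Aut}(N_\iota)$ is in the connected component of the identity, and let $\alpha=(\alpha_\iota)^{\mathcal U}\in\mathrm{Aut}(\prod_{\iota\to\mathcal U}N_\iota)$. Then there exists a unitary $u\in\prod_{\iota\to\mathcal U}N_\iota$ such that $\alpha(x)=uxu^*$ for all $x\in M$.
   Context: $\prod_{\iota\to\mathcal U}N_\iota=\ell^\infty(N_\iota)/\{(a_\iota)_\iota:\lim_{\iota\to\mathcal U}\|a_\iota\|_2=0\}$ is the tracial ultraproduct and $(\alpha_\iota)^{\mathcal U}$ maps the class of $(a_\iota)_\iota$ to the class of $(\alpha_\iota(a_\iota))_\iota$. $\mathrm{Aut}(N_\iota)$ has the topology of pointwise $\|\cdot\|_2$-convergence. Subfactors are unital. A finite factor $M$ has property (T) if there are a finite set $S\subset M$ and $c>0$ such that for every normal Hilbert $M$-$M$ bimodule $\mathcal H$, with $P$ the orthogonal projection onto the closed subspace of $M$-central vectors, one has $\|\xi-P\xi\|\le c\,(\sum_{x\in S}\|x\xi-\xi x\|^2)^{1/2}$ for all $\xi\in\mathcal H$. *)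

(* Defs.v *)
From HB Require Import structures.
From mathcomp Require Import all_boot all_order all_algebra finmap.
From mathcomp Require Import all_classical all_reals all_analysis.
From mathcomp Require Import generic_quotient ring_quotient complex.
From mathcomp Require Import ring lra.

Set Implicit Arguments.
Unset Strict Implicit.
Unset Printing Implicit Defensive.

Import Order.TTheory GRing.Theory Num.Theory.
Import numFieldNormedType.Exports.

Local Open Scope classical_set_scope.
Local Open Scope ring_scope.

Section PsdForms.
Variables (R : realType) (V : lmodType R[i]) (B : V -> V -> R[i]).

Record psd_form : Prop := PsdForm {
  psd_linear : forall a x y z, B (a *: x + y) z = a * B x z + B y z;
  psd_conj : forall x y, B y x = (B x y)^*;
  psd_ge0 : forall x, 0 <= B x x }.

Definition form_norm (x : V) : R := Num.sqrt (complex.Re (B x x)).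

Hypothesis hB : psd_form.

Lemma psdDl x y z : B (x + y) z = B x z + B y z.
Proof. by rewrite -[x in LHS]scale1r (psd_linear hB) mul1r. Qed.

Lemma psd0l z : B 0 z = 0.
Proof. by apply: (addrI (B 0 z)); rewrite -psdDl !addr0. Qed.

Lemma psdZl a x z : B (a *: x) z = a * B x z.
Proof. by rewrite -[a *: x in LHS]addr0 (psd_linear hB) psd0l addr0. Qed.

Lemma psdNl x z : B (- x) z = - B x z.
Proof. by rewrite -scaleN1r psdZl mulN1r. Qed.

Lemma psdDr x y z : B z (x + y) = B z x + B z y.
Proof. by rewrite (psd_conj hB) psdDl rmorphD /= -!(psd_conj hB). Qed.

Lemma psdZr a x z : B z (a *: x) = a^* * B z x.
Proof. by rewrite (psd_conj hB) psdZl rmorphM /= -(psd_conj hB). Qed.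

Lemma psd_Re x : B x x = (complex.Re (B x x))%:C%C.
Proof. by rewrite RRe_real // ger0_real // psd_ge0. Qed.

Lemma psd_Re_ge0 x : 0 <= complex.Re (B x x).
Proof. by rewrite -ler0c -psd_Re psd_ge0. Qed.

Lemma form_norm_ge0 x : 0 <= form_norm x.
Proof. exact: sqrtr_ge0. Qed.

Lemma sqr_form_norm x : form_norm x ^+ 2 = complex.Re (B x x).
Proof. by rewrite sqr_sqrtr // psd_Re_ge0. Qed.

Lemma ReC (z : R[i]) : complex.Re (z^*) = complex.Re z.
Proof. by case: z. Qed.

Lemma ReD (z w : R[i]) : complex.Re (z + w) = complex.Re z + complex.Re w.
Proof. by case: z w => [? ?] []. Qed.

Lemma ReMr (t : R) (z : R[i]) : complex.Re (t%:C%C * z) = t * complex.Re z.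
Proof. by case: z => [? ?] /=; rewrite mul0r subr0. Qed.

Lemma psd_cauchy_schwarz x y :
  complex.Re (B x y) <= form_norm x * form_norm y.
Proof.
have pos t : 0 <= complex.Re (B x x) + 2 * t * complex.Re (B x y)
                  + t ^+ 2 * complex.Re (B y y).
  have := psd_Re_ge0 (x + t%:C%C *: y).
  have tr : (t%:C%C : R[i])^* = t%:C%C by exact: conjc_real.
  rewrite psdDl !psdDr !psdZl !psdZr tr !ReD !ReMr (psd_conj hB x y) ReC.
  by congr (0 <= _); ring.
move: pos; rewrite -!sqr_form_norm.
have := form_norm_ge0 x; have := form_norm_ge0 y.
move: (form_norm x) (form_norm y) (complex.Re _) => a b r b0 a0 pos.
have [b00|b1] := eqVneq b 0.
  subst b; rewrite mulr0 leNgt; apply/negP => r0.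
  have := pos (- ((a ^+ 2 + 1) / (2 * r))).
  have -> : 2 * - ((a ^+ 2 + 1) / (2 * r)) * r = - (a ^+ 2 + 1).
    by field; rewrite gt_eqF.
  by rewrite expr0n /= mulr0; lra.
have bp : 0 < b by rewrite lt_neqAle eq_sym b1.
have := pos (- (a / b)).
have -> : a ^+ 2 + 2 * - (a / b) * r + (- (a / b)) ^+ 2 * b ^+ 2 =
          (a / b) * (2 * (a * b - r)) by field; rewrite gt_eqF.
move=> h.
case: (ltrP (a * b) r) => // rlt.
have : a / b <= 0.
  by rewrite leNgt; apply/negP => ab; move: h; rewrite pmulr_rge0 //; lra.
rewrite pmulr_lle0 ?invr_gt0 // => a00.
have a_0 : a = 0 by lra.
subst a; have := pos (- (r / b ^+ 2)); have := rlt; rewrite mul0r => r0.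
have -> : 0 ^+ 2 + 2 * - (r / b ^+ 2) * r + (- (r / b ^+ 2)) ^+ 2 * b ^+ 2 =
          - (r / b) ^+ 2 by field; rewrite gt_eqF.
have : 0 < (r / b) ^+ 2 by rewrite exprn_gt0 // divr_gt0.
lra.
Qed.

Lemma form_normD x y : form_norm (x + y) <= form_norm x + form_norm y.
Proof.
have s0 : 0 <= form_norm x + form_norm y by rewrite addr_ge0 ?form_norm_ge0.
rewrite -(ler_pXn2r (n := 2)) ?nnegrE ?form_norm_ge0 // sqr_form_norm.
rewrite psdDl !psdDr !ReD (psd_conj hB x y) ReC -!sqr_form_norm.
by have := psd_cauchy_schwarz x y; lra.
Qed.

Lemma form_normZ a x :
  form_norm (a *: x) = Num.sqrt (complex.Re (a * a^*)) * form_norm x.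
Proof.
rewrite /form_norm psdZl psdZr mulrA psd_Re mulrC ReMr mulrC sqrtrM //.
by rewrite -ler0c RRe_real ?ger0_real -?normCK ?exprn_ge0.
Qed.

Lemma form_norm0 : form_norm 0 = 0.
Proof. by rewrite /form_norm psd0l sqrtr0. Qed.

End PsdForms.

Record hilbert (R : realType) := Hilbert {
  hspace :> lmodType R[i];
  inner : hspace -> hspace -> R[i];
  inner_psd : psd_form inner;
  inner_eq0 : forall x, inner x x = 0 -> x = 0;
  hilbert_complete : forall u : nat -> hspace,
    (forall e : R, 0 < e -> exists n, forall p q,
       (n <= p)%N -> (n <= q)%N -> form_norm inner (u p - u q) < e) ->
    exists l, forall e : R, 0 < e -> exists n, forall p,
       (n <= p)%N -> form_norm inner (u p - l) < e }.

Section Operators.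
Variables (R : realType) (H : hilbert R).
Implicit Types (S T : H -> H) (x y : H).

Definition hnorm (x : H) : R := form_norm (@inner R H) x.

Definition op_bound (c : R) T := forall x, hnorm (T x) <= c * hnorm x.

Definition bounded_op T := linear T /\ exists c, op_bound c T.

Definition adjoint_ops S T := forall x y, inner (S x) y = inner x (T y).

Definition commutant (A : set (H -> H)) : set (H -> H) :=
  [set T | bounded_op T /\ forall S, A S -> S \o T = T \o S].

Definition positive_op T := forall x, 0 <= inner (T x) x.

Definition orthogonal_projection (V : set H) (P : H -> H) :=
  forall x, V (P x) /\ forall v, V v -> inner (x - P x) v = 0.

Lemma hnorm_ge0 x : 0 <= hnorm x.
Proof. exact: form_norm_ge0. Qed.

Lemma hnorm_eq0 x : hnorm x = 0 -> x = 0.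
Proof.
move=> h; apply: inner_eq0; rewrite (psd_Re (inner_psd H)).
by rewrite -(sqr_form_norm (inner_psd H)) -/(hnorm x) h expr0n.
Qed.

Lemma inner_ext x y : (forall z, inner x z = inner y z) -> x = y.
Proof.
move=> h; apply/eqP; rewrite -subr_eq0; apply/eqP; apply: inner_eq0.
have hp := inner_psd H.
by rewrite psdDl // h -psdDl // subrr psd0l.
Qed.

Lemma op_boundW c d T : c <= d -> op_bound c T -> op_bound d T.
Proof.
by move=> cd h x; apply: le_trans (h x) _; rewrite ler_wpM2r ?hnorm_ge0.
Qed.

Lemma op_bound_ge0 c T : op_bound c T -> exists2 d, 0 <= d & op_bound d T.
Proof.
move=> h; exists `|c|; first exact: normr_ge0.
exact: op_boundW (ler_norm c) h.
Qed.

Lemma op_bound0 : op_bound 0 (0 : H -> H).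
Proof. by move=> x; rewrite mul0r /hnorm (form_norm0 (inner_psd H)). Qed.

Lemma op_bound1 : op_bound 1 (@idfun H).
Proof. by move=> x; rewrite mul1r. Qed.

Lemma op_boundD c d S T :
  op_bound c S -> op_bound d T -> op_bound (c + d) (S + T).
Proof.
move=> hS hT x; apply: le_trans (form_normD (inner_psd H) _ _) _.
by rewrite mulrDl lerD.
Qed.

Lemma op_boundZ a c T :
  op_bound c T -> op_bound (Num.sqrt (complex.Re (a * a^*)) * c) (a *: T).
Proof.
move=> hT x; rewrite /hnorm (form_normZ (inner_psd H)) -mulrA.
by rewrite ler_wpM2l ?sqrtr_ge0 //; exact: hT.
Qed.

Lemma op_boundM c d S T : 0 <= c ->
  op_bound c S -> op_bound d T -> op_bound (c * d) (S \o T).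
Proof.
move=> c0 hS hT x; apply: le_trans (hS _) _.
by rewrite -mulrA ler_wpM2l //; exact: hT.
Qed.

Lemma adjoint_sym S T : adjoint_ops S T -> adjoint_ops T S.
Proof.
have hp := inner_psd H.
by move=> h x y; rewrite (psd_conj hp) -h -(psd_conj hp).
Qed.

Lemma adjoint_unique S T T' : adjoint_ops S T -> adjoint_ops S T' -> T = T'.
Proof.
move=> /adjoint_sym h /adjoint_sym h'; apply/funext => x.
by apply: inner_ext => z; rewrite h h'.
Qed.

Lemma op_bound_adjoint c S T : 0 <= c ->
  adjoint_ops S T -> op_bound c S -> op_bound c T.
Proof.
move=> c0 adj hS x.
have [->|n0] := eqVneq (hnorm (T x)) 0; first by rewrite mulr_ge0 ?hnorm_ge0.
have np : 0 < hnorm (T x) by rewrite lt_neqAle eq_sym n0 hnorm_ge0.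
rewrite -(ler_pM2l np) -expr2 {1}/hnorm (sqr_form_norm (inner_psd H)).
rewrite -adj; apply: le_trans (psd_cauchy_schwarz (inner_psd H) _ _) _.
rewrite -/(hnorm _) -/(hnorm _) mulrA [hnorm (T x) * c]mulrC.
by rewrite ler_wpM2r ?hnorm_ge0.
Qed.

Lemma commutant_linear A T a x y :
  commutant A T -> T (a *: x + y) = a *: T x + T y.
Proof. by case=> -[+ _] _; apply. Qed.

Lemma commutant0 A : A `<=` bounded_op -> commutant A 0.
Proof.
move=> Ab; split=> [|S /Ab[Sl _]].
  split; last by exists 0; exact: op_bound0.
  by move=> a x y /=; rewrite scaler0 addr0.
apply/funext => x /=; rewrite -[0 x]/(0 : H) -[RHS]/(0 : H).
by have := Sl (-1) 0 0; rewrite scaler0 addr0 scaleN1r addNr.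
Qed.

Lemma commutant1 A : commutant A idfun.
Proof. by split=> //; split=> //; exists 1; exact: op_bound1. Qed.

Lemma commutantP A a T T' : A `<=` bounded_op ->
  commutant A T -> commutant A T' -> commutant A (a *: T + T').
Proof.
move=> Ab [[Tl [c Tc]] hT] [[Tl' [c' Tc']] hT']; split=> [|S AS].
  split; last by eexists; apply: op_boundD Tc'; exact: op_boundZ Tc.
  move=> b x y; rewrite -!/((a *: T + T') _) /= .
  rewrite -[LHS]/(a *: T (b *: x + y) + T' (b *: x + y)) Tl Tl'.
  rewrite -[(a *: T + T') x]/(a *: T x + T' x).
  rewrite -[(a *: T + T') y]/(a *: T y + T' y).
  by rewrite !scalerDr !scalerA [a * b]mulrC !addrA; congr (_ + _); rewrite addrAC.
have [Sl _] := Ab _ AS; have e := hT _ AS; have e' := hT' _ AS.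
apply/funext => x /=; rewrite -[(a *: T + T') x]/(a *: T x + T' x) Sl.
rewrite -[RHS]/(a *: T (S x) + T' (S x)).
by have /= -> := congr1 (@^~ x) e; have /= -> := congr1 (@^~ x) e'.
Qed.

Lemma commutantM A T T' :
  commutant A T -> commutant A T' -> commutant A (T \o T').
Proof.
move=> [[Tl [c Tc]] hT] [[Tl' [c' Tc']] hT']; split=> [|S AS].
  split; first by move=> a x y /=; rewrite Tl' Tl.
  have [d d0 Td] := op_bound_ge0 Tc.
  by exists (d * c'); exact: op_boundM.
by rewrite compA (hT _ AS) -compA (hT' _ AS) compA.
Qed.

End Operators.

HB.mixin Record isStarAlgebra (R : realType) A of GRing.Algebra R[i] A := {
  star : A -> A;
  starK : involutive star;
  starD : {morph star : x y / x + y};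
  starZ : forall (a : R[i]) (x : A), star (a *: x) = a^* *: star x;
  starM : forall x y : A, star (x * y) = star y * star x }.

#[short(type="starAlgType")]
HB.structure Definition StarAlgebra (R : realType) :=
  { A of isStarAlgebra R A & GRing.Algebra R[i] A }.

Section StarAlgebraTheory.
Variables (R : realType) (A : starAlgType R).

Definition unitary (u : A) := star u * u = 1 /\ u * star u = 1.

Definition rel_commutant (M : set A) : set A :=
  [set x | forall y, M y -> x * y = y * x].

Definition trivial_center (M : set A) :=
  forall z, M z -> rel_commutant M z -> exists a : R[i], z = a *: 1.

Lemma star0 : star (0 : A) = 0.
Proof. by apply: (addrI (star (0 : A))); rewrite -starD !addr0. Qed.

Lemma starN (x : A) : star (- x) = - star x.
Proof. by apply/eqP; rewrite -addr_eq0 -starD addNr star0. Qed.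

Lemma starB (x y : A) : star (x - y) = star x - star y.
Proof. by rewrite starD starN. Qed.

Lemma star1 : star (1 : A) = 1.
Proof. by rewrite -[LHS]mul1r -{1}[1]starK -starM mul1r starK. Qed.

End StarAlgebraTheory.

(* The zero algebra is excluded so that the elements form a (nontrivial)
   [algType]; it is neither a factor nor tracial. *)
Record vNalg (R : realType) (H : hilbert R) := VNAlg {
  vN_set : set (H -> H);
  vN_nontrivial : exists xi : H, xi != 0;
  vN_selfadjoint : forall S, vN_set S -> exists2 T, vN_set T & adjoint_ops S T;
  vN_bicommutant : commutant (commutant vN_set) = vN_set }.

Section VonNeumannElements.
Variables (R : realType) (H : hilbert R) (N : vNalg H).

Definition vN_pred : {pred H -> H} := fun T => `[< vN_set N T >].

Record vN_elt := VNElt { vN_op :> H -> H; _ : vN_pred vN_op }.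

HB.instance Definition _ := [isSub for vN_op].
HB.instance Definition _ := [Choice of vN_elt by <:].

Lemma vN_eltP (x : vN_elt) : vN_set N x.
Proof. by case: x => T /= /asboolP. Qed.

Lemma vN_bounded (x : vN_elt) : bounded_op x.
Proof. by have := vN_eltP x; rewrite -vN_bicommutant => -[]. Qed.

Let comm_bounded : commutant (vN_set N) `<=` @bounded_op R H.
Proof. by move=> T []. Qed.

Lemma vN_submod_closed : submod_closed vN_pred.
Proof.
split; first by apply/asboolP; rewrite -vN_bicommutant; exact: commutant0.
move=> a S T /asboolP + /asboolP.
rewrite -vN_bicommutant => hS hT; apply/asboolP; rewrite -vN_bicommutant.
exact: commutantP.
Qed.

HB.instance Definition _ :=
  GRing.isSubmodClosed.Build _ _ vN_pred vN_submod_closed.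
HB.instance Definition _ := [SubChoice_isSubLmodule of vN_elt by <:].

Lemma vN_one_subproof : vN_pred idfun.
Proof. by apply/asboolP; rewrite -vN_bicommutant; exact: commutant1. Qed.

Lemma vN_mul_subproof (x y : vN_elt) : vN_pred (x \o y).
Proof.
apply/asboolP; have := vN_eltP x; have := vN_eltP y.
rewrite -vN_bicommutant => hy hx; exact: commutantM.
Qed.

Definition vN_one := VNElt vN_one_subproof.
Definition vN_mul (x y : vN_elt) := VNElt (vN_mul_subproof x y).

Lemma vN_ext (x y : vN_elt) : (forall xi, x xi = y xi) -> x = y.
Proof. by move=> h; apply: val_inj; apply/funext. Qed.

Lemma vN_linear (x : vN_elt) a xi eta : x (a *: xi + eta) = a *: x xi + x eta.
Proof. by have [+ _] := vN_bounded x; apply. Qed.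

Lemma vN_mulA : associative vN_mul. Proof. by move=> *; exact: vN_ext. Qed.
Lemma vN_mul1 : left_id vN_one vN_mul. Proof. by move=> *; exact: vN_ext. Qed.
Lemma vN_mulr1 : right_id vN_one vN_mul. Proof. by move=> *; exact: vN_ext. Qed.
Lemma vN_mulDl : left_distributive vN_mul +%R.
Proof. by move=> *; exact: vN_ext. Qed.
Lemma vN_mulDr : right_distributive vN_mul +%R.
Proof.
move=> x y z; apply: vN_ext => xi; rewrite -[LHS]/(x (y xi + z xi)).
by have := vN_linear x 1 (y xi) (z xi); rewrite !scale1r.
Qed.

Lemma vN_oner_neq0 : vN_one != 0.
Proof.
have [xi /eqP xi0] := vN_nontrivial N.
by apply/eqP => /(congr1 (fun x : vN_elt => x xi)).
Qed.

HB.instance Definition _ := GRing.Zmodule_isNzRing.Build vN_elt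
  vN_mulA vN_mul1 vN_mulr1 vN_mulDl vN_mulDr vN_oner_neq0.

Lemma vN_scaleAl (a : R[i]) (x y : vN_elt) : a *: (x * y) = a *: x * y.
Proof. exact: vN_ext. Qed.

HB.instance Definition _ :=
  GRing.Lmodule_isLalgebra.Build R[i] vN_elt vN_scaleAl.

Lemma vN_scaleAr (a : R[i]) (x y : vN_elt) : a *: (x * y) = x * (a *: y).
Proof.
apply: vN_ext => xi; rewrite -[RHS]/(x (a *: y xi)).
have x0 : x 0 = 0.
  by have := vN_linear x (-1) 0 0; rewrite scaler0 addr0 scaleN1r addNr.
by have := vN_linear x a (y xi) 0; rewrite x0 !addr0 => ->.
Qed.

HB.instance Definition _ :=
  GRing.Lalgebra_isAlgebra.Build R[i] vN_elt vN_scaleAr.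

Lemma vN_star_subproof (x : vN_elt) : exists y : vN_elt, adjoint_ops x y.
Proof.
have [T NT adj] := vN_selfadjoint (vN_eltP x).
by have PT : vN_pred T by [apply/asboolP]; exists (VNElt PT).
Qed.

Definition vN_star (x : vN_elt) : vN_elt := projT1 (cid (vN_star_subproof x)).

Lemma vN_starP (x : vN_elt) : adjoint_ops x (vN_star x).
Proof. exact: projT2 (cid (vN_star_subproof x)). Qed.

Lemma vN_star_eq (x y : vN_elt) : adjoint_ops x y -> vN_star x = y.
Proof. by move=> h; apply: val_inj; apply: adjoint_unique h; exact: vN_starP. Qed.

Lemma vN_starK : involutive vN_star.
Proof. by move=> x; apply: vN_star_eq; apply: adjoint_sym; exact: vN_starP. Qed.

Lemma vN_starD : {morph vN_star : x y / x + y}.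
Proof.
move=> x y; apply: vN_star_eq => xi eta.
have hp := inner_psd H.
rewrite -[LHS]/(inner (x xi + y xi) eta).
by rewrite -[RHS]/(inner xi (vN_star x eta + vN_star y eta))
  psdDl // psdDr // !vN_starP.
Qed.

Lemma vN_starZ (a : R[i]) (x : vN_elt) : vN_star (a *: x) = a^* *: vN_star x.
Proof.
apply: vN_star_eq => xi eta.
have hp := inner_psd H.
rewrite -[LHS]/(inner (a *: x xi) eta).
rewrite -[RHS]/(inner xi (a^* *: vN_star x eta)).
by rewrite psdZl // psdZr // conjCK vN_starP.
Qed.

Lemma vN_starM (x y : vN_elt) : vN_star (x * y) = vN_star y * vN_star x.
Proof.
by apply: vN_star_eq => xi eta; rewrite -[LHS]/(inner (x (y xi)) eta) !vN_starP.
Qed.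

HB.instance Definition _ :=
  isStarAlgebra.Build R vN_elt vN_starK vN_starD vN_starZ vN_starM.

Lemma vN_adjoint (x : vN_elt) : adjoint_ops x (star x).
Proof. exact: vN_starP. Qed.

End VonNeumannElements.

Coercion vN_elt : vNalg >-> Sortclass.

Section Normality.
Variables (R : realType) (H : hilbert R) (N : vNalg H).

Definition factor := trivial_center [set: N].

Definition infinite_dimensional := ~ exists s : seq N, forall x : N,
  exists c : nat -> R[i], x = \sum_(k < size s) c k *: s`_k.

(* Normal means ultraweakly continuous, i.e. in the predual of N. *)
Definition normal_functional (phi : N -> R[i]) :=
  exists xi eta : nat -> H,
    [/\ cvgn (series (fun n => hnorm (xi n) ^+ 2)),
        cvgn (series (fun n => hnorm (eta n) ^+ 2))
      & forall x : N, series (fun n => inner (x (xi n)) (eta n)) @ \oo -->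
          (phi x : R[i]^o)].

Record normal_tracial_state (tau : N -> R[i]) : Prop := NormalTracialState {
  tr_linear : forall a x y, tau (a *: x + y) = a * tau x + tau y;
  tr_ge0 : forall x : N, positive_op x -> 0 <= tau x;
  tr1 : tau 1 = 1;
  trC : forall x y, tau (x * y) = tau (y * x);
  tr_faithful : forall x, tau (star x * x) = 0 -> x = 0;
  tr_normal : normal_functional tau }.

End Normality.

Record tracialvN (R : realType) := TracialVN {
  tv_space : hilbert R;
  tv_alg :> vNalg tv_space;
  tr : tv_alg -> R[i];
  trP : normal_tracial_state tr }.

Section TracialVN.
Variables (R : realType) (N : tracialvN R).

Definition II1_factor := factor N /\ infinite_dimensional N.

Definition nrm2 (x : N) : R := Num.sqrt (complex.Re (tr (star x * x))).

Let B (x y : N) := tr (star y * x).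

Lemma trD (x y : N) : tr (x + y) = tr x + tr y.
Proof. by rewrite -[x in LHS]scale1r (tr_linear (trP N)) mul1r. Qed.

Lemma tr0 : tr (0 : N) = 0.
Proof. by apply: (addrI (tr (0 : N))); rewrite -trD !addr0. Qed.

Lemma trZ a (x : N) : tr (a *: x) = a * tr x.
Proof. by rewrite -[a *: x in LHS]addr0 (tr_linear (trP N)) tr0 addr0. Qed.

Lemma tr_sqr_ge0 (x : N) : 0 <= tr (star x * x).
Proof.
apply: (tr_ge0 (trP N)) => xi; rewrite -[X in inner X]/(star x (x xi)).
rewrite (vN_adjoint (star x)) starK; exact: psd_ge0 (inner_psd _) _.
Qed.

Lemma tr_star (z : N) : tr (star z) = (tr z)^*.
Proof.
have h1 := ger0_Im (tr_sqr_ge0 (1 + z)).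
have h2 := ger0_Im (tr_sqr_ge0 (1 + 'i *: z)).
have hz := ger0_Im (tr_sqr_ge0 z).
move: h1 h2.
rewrite !starD star1 starZ conjCi !mulrDl !mulrDr !mul1r !mulr1.
rewrite -scalerAl -scalerAr scalerA mulNr -expr2 sqrCi opprK scale1r.
rewrite !trD !trZ (tr1 (trP N)) -complexiE.
case: (tr (star z * z)) hz => p q /= ->.
case: (tr z) => a b; case: (tr (star z)) => c d /=.
by move=> e1 e2; rewrite -[RHS]/(a -i* b)%C; congr (_ +i* _)%C; lra.
Qed.

Lemma tr_form_psd : psd_form B.
Proof.
rewrite /B; split=> [a x y z|x y|x].
- by rewrite mulrDr -scalerAr trD trZ.
- by rewrite -tr_star starM starK.
- exact: tr_sqr_ge0.
Qed.

Lemma nrm2_ge0 (x : N) : 0 <= nrm2 x.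
Proof. exact: sqrtr_ge0. Qed.

Lemma nrm2_0 : nrm2 0 = 0.
Proof. exact: (form_norm0 tr_form_psd). Qed.

Lemma nrm2_1 : nrm2 1 = 1.
Proof. by rewrite /nrm2 mulr1 star1 (tr1 (trP N)) sqrtr1. Qed.

Lemma nrm2D (x y : N) : nrm2 (x + y) <= nrm2 x + nrm2 y.
Proof. exact: (form_normD tr_form_psd). Qed.

Lemma nrm2Z a (x : N) : nrm2 (a *: x) = Num.sqrt (complex.Re (a * a^*)) * nrm2 x.
Proof. exact: (form_normZ tr_form_psd). Qed.

Lemma nrm2N (x : N) : nrm2 (- x) = nrm2 x.
Proof. by rewrite /nrm2 starN mulrNN. Qed.

Lemma nrm2_star (x : N) : nrm2 (star x) = nrm2 x.
Proof. by rewrite /nrm2 starK (trC (trP N)). Qed.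

Lemma nrm2_mull c (b x : N) : 0 <= c -> op_bound c b ->
  nrm2 (b * x) <= c * nrm2 x.
Proof.
move=> c0 hb.
rewrite -(ler_pXn2r (n := 2)) ?nnegrE ?mulr_ge0 ?nrm2_ge0 //.
rewrite exprMn !(sqr_form_norm tr_form_psd) /B.
have : 0 <= tr (star x * ((c ^+ 2)%:C%C *: 1 - star b * b) * x).
  apply: (tr_ge0 (trP N)) => xi; set y := x xi.
  rewrite -[X in inner X]/(star x ((c ^+ 2)%:C%C *: y - star b (b y))).
  rewrite (vN_adjoint (star x)) starK -/y.
  have hp := inner_psd (tv_space N).
  rewrite psdDl // psdZl // psdNl //.
  rewrite (vN_adjoint (star b)) starK.
  rewrite (psd_Re hp y) (psd_Re hp (b y)) -!(sqr_form_norm hp).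
  rewrite -rmorphM -rmorphB /= ler0c subr_ge0 -exprMn.
  by rewrite ler_pXn2r ?nnegrE ?mulr_ge0 ?form_norm_ge0 //; exact: hb.
rewrite mulrBr mulrBl trD -scaleN1r trZ mulN1r -scalerAr mulr1 -scalerAl trZ.
rewrite starM !mulrA subr_ge0 lecE => /andP[_].
by rewrite ReMr.
Qed.

Lemma nrm2_mulr c (b x : N) : 0 <= c -> op_bound c b ->
  nrm2 (x * b) <= c * nrm2 x.
Proof.
move=> c0 hb; rewrite -nrm2_star starM -[nrm2 x]nrm2_star.
by apply: nrm2_mull => //; apply: op_bound_adjoint hb => //; exact: vN_adjoint.
Qed.

End TracialVN.

Section Automorphisms.
Variables (R : realType) (N : tracialvN R).

(* Aut(N) carries the topology of pointwise convergence in nrm2, defined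
   through its open sets. *)
Record aut := Aut {
  aut_fun :> N -> N;
  aut_linear : linear aut_fun;
  autM : forall x y, aut_fun (x * y) = aut_fun x * aut_fun y;
  aut_star : forall x, aut_fun (star x) = star (aut_fun x);
  aut_bij : bijective aut_fun }.

HB.instance Definition _ := gen_eqMixin aut.
HB.instance Definition _ := gen_choiceMixin aut.

Program Definition id_aut := @Aut idfun _ _ _ _.
Next Obligation. by []. Qed.
Next Obligation. by []. Qed.
Next Obligation. by []. Qed.
Next Obligation. by exists idfun. Qed.

Definition aut_basic_nbhs (f : aut) (s : seq N) (e : R) : set aut :=
  [set g | forall x, x \in s -> nrm2 (g x - f x) < e].

Definition aut_open : set_system aut :=
  [set W | forall f, W f -> exists s e, 0 < e /\ aut_basic_nbhs f s e `<=` W].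

Lemma aut_openT : aut_open setT.
Proof. by move=> f _; exists [::], 1. Qed.

Lemma aut_openI : setI_closed aut_open.
Proof.
move=> V W oV oW f [/oV[s [d [d0 sV]]] /oW[t [e [e0 tW]]]].
exists (s ++ t), (Num.min d e); split; first by rewrite lt_min d0.
move=> g h; split; [apply: sV|apply: tW] => x xs;
  have := h x; rewrite mem_cat xs ?orbT => /(_ isT); rewrite lt_min => /andP[].
- by [].
- by [].
Qed.

Lemma aut_open_bigU (J : Type) (W : J -> set aut) :
  (forall j, aut_open (W j)) -> aut_open (\bigcup_j W j).
Proof.
move=> oW f [j _ /oW[s [e [e0 h]]]]; exists s, e; split=> // g /h Wg.
by exists j.
Qed.

HB.instance Definition _ :=
  isOpenTopological.Build aut aut_openT aut_openI aut_open_bigU.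

End Automorphisms.

Section BoundedFamilies.
Variables (R : realType) (I : Type) (N : I -> tracialvN R).

Definition bounded_family (a : forall i, N i) :=
  exists c, forall i, op_bound c (a i).

Definition bounded_family_pred (a : forall i, N i) : bool :=
  `[< bounded_family a >].

Record linf := Linf {
  linf_fun :> forall i, N i;
  _ : bounded_family_pred linf_fun }.

HB.instance Definition _ := [isSub for linf_fun].
HB.instance Definition _ := [Choice of linf by <:].

Lemma linfP (a : linf) : exists2 c, 0 <= c & forall i, op_bound c (a i).
Proof.
case: a => a /= /asboolP[c h]; exists `|c|; first exact: normr_ge0.
by move=> i; exact: op_boundW (ler_norm c) (h i).
Qed.

Lemma linf_ext (a b : linf) : (forall i, a i = b i) -> a = b.
Proof. by move=> h; apply: val_inj; apply: functional_extensionality_dep. Qed.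

Lemma linf0_subproof : bounded_family_pred (fun i => 0 : N i).
Proof. by apply/asboolP; exists 0 => i; exact: op_bound0. Qed.
Lemma linf1_subproof : bounded_family_pred (fun i => 1 : N i).
Proof. by apply/asboolP; exists 1 => i; exact: op_bound1. Qed.
Lemma linfZ_subproof k (a : linf) : bounded_family_pred (fun i => k *: a i).
Proof.
have [c _ h] := linfP a.
by apply/asboolP; eexists => i; exact: op_boundZ (h i).
Qed.
Lemma linfD_subproof (a b : linf) : bounded_family_pred (fun i => a i + b i).
Proof.
have [c _ h] := linfP a; have [d _ k] := linfP b.
by apply/asboolP; eexists => i; exact: op_boundD (h i) (k i).
Qed.
Lemma linfM_subproof (a b : linf) : bounded_family_pred (fun i => a i * b i).
Proof.
have [c c0 h] := linfP a; have [d _ k] := linfP b.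
by apply/asboolP; eexists => i; exact: op_boundM c0 (h i) (k i).
Qed.
Lemma linfN_subproof (a : linf) : bounded_family_pred (fun i => - a i).
Proof.
have := linfZ_subproof (-1) a; congr bounded_family_pred.
by apply: functional_extensionality_dep => i; rewrite scaleN1r.
Qed.
Lemma linf_star_subproof (a : linf) : bounded_family_pred (fun i => star (a i)).
Proof.
have [c c0 h] := linfP a; apply/asboolP; exists c => i.
by apply: op_bound_adjoint (h i) => //; exact: vN_adjoint.
Qed.

Definition linf0 := Linf linf0_subproof.
Definition linf1 := Linf linf1_subproof.
Definition linf_scale k a := Linf (linfZ_subproof k a).
Definition linf_add a b := Linf (linfD_subproof a b).
Definition linf_mul a b := Linf (linfM_subproof a b).
Definition linf_opp a := Linf (linfN_subproof a).
Definition linf_star a := Linf (linf_star_subproof a).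

Lemma linf_addA : associative linf_add.
Proof. by move=> *; apply: linf_ext => i; exact: addrA. Qed.
Lemma linf_addC : commutative linf_add.
Proof. by move=> *; apply: linf_ext => i; exact: addrC. Qed.
Lemma linf_add0 : left_id linf0 linf_add.
Proof. by move=> *; apply: linf_ext => i; exact: add0r. Qed.
Lemma linf_addN : left_inverse linf0 linf_opp linf_add.
Proof. by move=> *; apply: linf_ext => i; exact: addNr. Qed.

HB.instance Definition _ :=
  GRing.isZmodule.Build linf linf_addA linf_addC linf_add0 linf_addN.

Lemma linf_mulA : associative linf_mul.
Proof. by move=> *; apply: linf_ext => i; exact: mulrA. Qed.
Lemma linf_mul1 : left_id linf1 linf_mul.
Proof. by move=> *; apply: linf_ext => i; exact: mul1r. Qed.
Lemma linf_mulr1 : right_id linf1 linf_mul.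
Proof. by move=> *; apply: linf_ext => i; exact: mulr1. Qed.
Lemma linf_mulDl : left_distributive linf_mul +%R.
Proof. by move=> *; apply: linf_ext => i; exact: mulrDl. Qed.
Lemma linf_mulDr : right_distributive linf_mul +%R.
Proof. by move=> *; apply: linf_ext => i; exact: mulrDr. Qed.

HB.instance Definition _ := GRing.Zmodule_isPzRing.Build linf
  linf_mulA linf_mul1 linf_mulr1 linf_mulDl linf_mulDr.

Lemma linf_scaleA (k l : R[i]) a :
  linf_scale k (linf_scale l a) = linf_scale (k * l) a.
Proof. by apply: linf_ext => i; exact: scalerA. Qed.
Lemma linf_scale1 : left_id 1 linf_scale.
Proof. by move=> *; apply: linf_ext => i; exact: scale1r. Qed.
Lemma linf_scaleDr : right_distributive linf_scale +%R.
Proof. by move=> *; apply: linf_ext => i; exact: scalerDr. Qed.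
Lemma linf_scaleDl a : {morph linf_scale^~ a : k l / k + l}.
Proof. by move=> *; apply: linf_ext => i; exact: scalerDl. Qed.

HB.instance Definition _ := GRing.Zmodule_isLmodule.Build R[i] linf
  linf_scaleA linf_scale1 linf_scaleDr linf_scaleDl.

End BoundedFamilies.

Section Ultraproduct.
Variables (R : realType) (I : Type) (U : set_system I).
Context {FU : ProperFilter U}.
Variable (N : I -> tracialvN R).

Definition null_ideal : {pred linf N} :=
  fun a => `[< nrm2 (a i) @[i --> U] --> (0 : R) >].

Lemma null_idealP (a : linf N) :
  reflect (forall e : R, 0 < e -> \forall i \near U, nrm2 (a i) < e)
          (a \in null_ideal).
Proof.
apply: (iffP (asboolP _)) => [/cvgrPdist_lt h e e0|h].
  by apply: filterS (h e e0) => i; rewrite sub0r normrN ger0_norm ?nrm2_ge0.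
apply/cvgrPdist_lt => e e0; apply: filterS (h e e0) => i.
by rewrite sub0r normrN ger0_norm ?nrm2_ge0.
Qed.

Lemma null_ideal_le (a b : linf N) c : 0 <= c ->
  (forall i, nrm2 (b i) <= c * nrm2 (a i)) ->
  a \in null_ideal -> b \in null_ideal.
Proof.
move=> c0 h /null_idealP ha; apply/null_idealP => e e0.
have c1 : 0 < c + 1 by lra.
apply: filterS (ha (e / (c + 1)) (divr_gt0 e0 c1)) => i.
rewrite ltr_pdivlMr // => hi; apply: le_lt_trans (h i) _; apply: le_lt_trans hi.
by rewrite mulrC ler_wpM2l ?nrm2_ge0 //; lra.
Qed.

Lemma null_ideal_zmod : zmod_closed null_ideal.
Proof.
split=> [|a b /null_idealP ha /null_idealP hb]; apply/null_idealP => e e0.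
  by near=> i; rewrite nrm2_0.
have e2 : 0 < e / 2 by lra.
near=> i; apply: le_lt_trans (nrm2D (a i) (- b i)) _; rewrite nrm2N.
have ha' : nrm2 (a i) < e / 2 by near: i; exact: ha.
have hb' : nrm2 (b i) < e / 2 by near: i; exact: hb.
lra.
Unshelve. all: by end_near. Qed.

HB.instance Definition _ :=
  GRing.isZmodClosed.Build (linf N) null_ideal null_ideal_zmod.

Lemma null_idealMl (a b : linf N) : b \in null_ideal -> a * b \in null_ideal.
Proof.
have [c c0 h] := linfP a.
by apply: (null_ideal_le c0) => i; exact: nrm2_mull (h i).
Qed.

Lemma null_idealMr (a b : linf N) : a \in null_ideal -> a * b \in null_ideal.
Proof.
have [c c0 h] := linfP b.
by apply: (null_ideal_le c0) => i; exact: nrm2_mulr (h i).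
Qed.

Lemma null_idealZ k (a : linf N) : a \in null_ideal -> k *: a \in null_ideal.
Proof.
apply: (null_ideal_le (sqrtr_ge0 (complex.Re (k * k^*)))) => i.
by rewrite -nrm2Z.
Qed.

Lemma null_ideal_star (a : linf N) :
  a \in null_ideal -> linf_star a \in null_ideal.
Proof.
by apply: (@null_ideal_le _ _ 1) => // i; rewrite mul1r nrm2_star.
Qed.

Lemma null_ideal1 : 1 \notin null_ideal.
Proof.
apply/negP => /null_idealP /(_ 1 ltr01) h.
have [j] := @filter_ex _ _ FU _ h.
by rewrite -[(1 : linf N) j]/(1 : N j) nrm2_1 ltxx.
Qed.

Definition uprod : Type := Quotient.quot null_ideal.

HB.instance Definition _ := GRing.Zmodule.on uprod.

Definition uclass (a : linf N) : uprod := \pi_(Quotient.quot null_ideal)%qT a.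

Definition urepr (x : uprod) : linf N :=
  repr (x : Quotient.quot null_ideal).

Lemma ureprK x : uclass (urepr x) = x.
Proof. exact: reprK. Qed.

Lemma uclass_eq (a b : linf N) : uclass a = uclass b <-> a - b \in null_ideal.
Proof. by rewrite Quotient.idealrBE; split=> [h|/eqP//]; apply/eqP. Qed.

Lemma uclassD a b : uclass (a + b) = uclass a + uclass b.
Proof. exact: Quotient.pi_add. Qed.

Definition umul (x y : uprod) := uclass (urepr x * urepr y).
Definition uscale (k : R[i]) (x : uprod) := uclass (k *: urepr x).
Definition ustar (x : uprod) := uclass (linf_star (urepr x)).

Let urepr_null a : urepr (uclass a) - a \in null_ideal.
Proof. by apply/uclass_eq; rewrite ureprK. Qed.

Lemma umulE a b : umul (uclass a) (uclass b) = uclass (a * b).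
Proof.
apply/uclass_eq; set a' := urepr _; set b' := urepr _.
have -> : a' * b' - a * b = a' * (b' - b) + (a' - a) * b.
  by rewrite mulrBr mulrBl addrA subrK.
apply: rpredD; first by apply: null_idealMl; exact: urepr_null.
by apply: null_idealMr; exact: urepr_null.
Qed.

Lemma uscaleE k a : uscale k (uclass a) = uclass (k *: a).
Proof.
by apply/uclass_eq; rewrite -scalerBr; apply: null_idealZ; exact: urepr_null.
Qed.

Lemma ustarE a : ustar (uclass a) = uclass (linf_star a).
Proof.
apply/uclass_eq; set a' := urepr _.
have -> : linf_star a' - linf_star a = linf_star (a' - a).
  by apply: linf_ext => j; rewrite -[RHS]/(star (a' j - a j)) starB.
by apply: null_ideal_star; exact: urepr_null.
Qed.

Lemma umulA : associative umul.
Proof.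
by move=> x y z; rewrite -(ureprK x) -(ureprK y) -(ureprK z) !umulE mulrA.
Qed.
Lemma umul1 : left_id (uclass 1) umul.
Proof. by move=> x; rewrite -(ureprK x) !umulE mul1r. Qed.
Lemma umulr1 : right_id (uclass 1) umul.
Proof. by move=> x; rewrite -(ureprK x) !umulE mulr1. Qed.
Lemma umulDl : left_distributive umul +%R.
Proof.
move=> x y z; rewrite -(ureprK x) -(ureprK y) -(ureprK z).
by rewrite -uclassD !umulE -uclassD mulrDl.
Qed.
Lemma umulDr : right_distributive umul +%R.
Proof.
move=> x y z; rewrite -(ureprK x) -(ureprK y) -(ureprK z).
by rewrite -uclassD !umulE -uclassD mulrDr.
Qed.
Lemma uone_neq0 : uclass 1 != 0.
Proof.
have -> : 0 = uclass 0 by apply: (addrI (uclass 0)); rewrite -uclassD !addr0.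
apply/eqP => /uclass_eq; rewrite subr0 => h1; move: null_ideal1.
by rewrite h1.
Qed.

HB.instance Definition _ := GRing.Zmodule_isNzRing.Build uprod
  umulA umul1 umulr1 umulDl umulDr uone_neq0.

Lemma uscaleA (k l : R[i]) x : uscale k (uscale l x) = uscale (k * l) x.
Proof. by rewrite -(ureprK x) !uscaleE scalerA. Qed.
Lemma uscale1 : left_id 1 uscale.
Proof. by move=> x; rewrite -(ureprK x) uscaleE scale1r. Qed.
Lemma uscaleDr : right_distributive uscale +%R.
Proof.
move=> k x y; rewrite -(ureprK x) -(ureprK y).
by rewrite -uclassD !uscaleE -uclassD scalerDr.
Qed.
Lemma uscaleDl x : {morph uscale^~ x : k l / k + l}.
Proof.
by move=> k l; rewrite -(ureprK x) !uscaleE -uclassD scalerDl.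
Qed.

HB.instance Definition _ := GRing.Zmodule_isLmodule.Build R[i] uprod
  uscaleA uscale1 uscaleDr uscaleDl.

Lemma uscaleAl (k : R[i]) (x y : uprod) : k *: (x * y) = k *: x * y.
Proof.
rewrite -(ureprK x) -(ureprK y) -[LHS]/(uscale k (umul _ _)).
rewrite -[RHS]/(umul (uscale k _) _) !(umulE, uscaleE); congr uclass.
by apply: linf_ext => j; exact: scalerAl.
Qed.

HB.instance Definition _ := GRing.Lmodule_isLalgebra.Build R[i] uprod uscaleAl.

Lemma uscaleAr (k : R[i]) (x y : uprod) : k *: (x * y) = x * (k *: y).
Proof.
rewrite -(ureprK x) -(ureprK y) -[LHS]/(uscale k (umul _ _)).
rewrite -[RHS]/(umul _ (uscale k _)) !(umulE, uscaleE); congr uclass.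
by apply: linf_ext => j; exact: scalerAr.
Qed.

HB.instance Definition _ := GRing.Lalgebra_isAlgebra.Build R[i] uprod uscaleAr.

Lemma ustarK : involutive ustar.
Proof.
move=> x; rewrite -(ureprK x) !ustarE; congr uclass.
by apply: linf_ext => j; exact: starK.
Qed.
Lemma ustarD : {morph ustar : x y / x + y}.
Proof.
move=> x y; rewrite -(ureprK x) -(ureprK y) -uclassD !ustarE -uclassD.
by congr uclass; apply: linf_ext => j; exact: starD.
Qed.
Lemma ustarZ (k : R[i]) (x : uprod) : ustar (k *: x) = k^* *: ustar x.
Proof.
rewrite -(ureprK x) -[k *: _]/(uscale k _) -[RHS]/(uscale _ _).
rewrite !(uscaleE, ustarE); congr uclass.
by apply: linf_ext => j; exact: starZ.
Qed.
Lemma ustarM (x y : uprod) : ustar (x * y) = ustar y * ustar x.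
Proof.
rewrite -(ureprK x) -(ureprK y) -[_ * _ in LHS]/(umul _ _).
rewrite -[RHS]/(umul _ _) !(umulE, ustarE); congr uclass.
by apply: linf_ext => j; exact: starM.
Qed.

HB.instance Definition _ :=
  isStarAlgebra.Build R uprod ustarK ustarD ustarZ ustarM.

(* A *-automorphism of N i is isometric, so for such f the family below is
   bounded and the default value 0 of insubd is not used. *)
Definition uprod_map (f : forall i, N i -> N i) (x : uprod) : uprod :=
  uclass (insubd (0 : linf N) (fun i => f i (urepr x i))).

End Ultraproduct.

Arguments uprod {R I} U {FU} N.

Section Representations.
Variables (R : realType) (A : starAlgType R) (E : hilbert R).

Record star_rep (pi : A -> E -> E) : Prop := StarRep {
  rep_bounded : forall x, bounded_op (pi x);
  rep_linear : forall a x y xi, pi (a *: x + y) xi = a *: pi x xi + pi y xi;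
  rep1 : forall xi, pi 1 xi = xi;
  repM : forall x y xi, pi (x * y) xi = pi x (pi y xi);
  rep_star : forall x, adjoint_ops (pi x) (pi (star x)) }.

Record star_antirep (pi : A -> E -> E) : Prop := StarAntirep {
  antirep_bounded : forall x, bounded_op (pi x);
  antirep_linear : forall a x y xi, pi (a *: x + y) xi = a *: pi x xi + pi y xi;
  antirep1 : forall xi, pi 1 xi = xi;
  antirepM : forall x y xi, pi (x * y) xi = pi y (pi x xi);
  antirep_star : forall x, adjoint_ops (pi x) (pi (star x)) }.

End Representations.

Section PropertyT.
Variables (R : realType) (H : hilbert R) (M : vNalg H).

Definition normal_action (E : hilbert R) (pi : M -> E -> E) :=
  forall xi eta, normal_functional (fun x => inner (pi x xi) eta).

Record bimodule := Bimodule {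
  bim_space :> hilbert R;
  lact : M -> bim_space -> bim_space;
  ract : M -> bim_space -> bim_space;
  lact_rep : star_rep lact;
  ract_rep : star_antirep ract;
  lact_ract : forall x y xi, lact x (ract y xi) = ract y (lact x xi);
  lact_normal : normal_action lact;
  ract_normal : normal_action ract }.

Definition central_vectors (E : bimodule) : set E :=
  [set xi | forall x : M, lact x xi = ract x xi].

Arguments central_vectors : clear implicits.

Definition property_T :=
  exists (S : {fset M}) (c : R), 0 < c /\
    forall (E : bimodule) (P : E -> E),
      orthogonal_projection (central_vectors E) P ->
      forall xi : E, hnorm (xi - P xi) <=
        c * Num.sqrt (\sum_(x <- S) hnorm (lact x xi - ract x xi) ^+ 2).

End PropertyT.

Section Subfactors.
Variables (R : realType) (I : Type) (U : set_system I).
Context {FU : ProperFilter U}.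
Variable (N : I -> tracialvN R).

(* The standard representation of the ultraproduct Q on L^2(Q), i.e. the GNS
   representation of the trace lim_U tr (a i); it is unique up to unitary
   equivalence. *)
Record L2_rep := L2Rep {
  L2_space :> hilbert R;
  L2_act : uprod U N -> L2_space -> L2_space;
  L2_vec : L2_space;
  L2_star_rep : star_rep L2_act;
  L2_trace : forall a : linf N, tr (a i) @[i --> U] -->
    (inner (L2_act (uclass a) L2_vec) L2_vec : R[i]^o);
  L2_cyclic : forall (xi : L2_space) (e : R), 0 < e ->
    exists x, hnorm (xi - L2_act x L2_vec) < e }.

(* Subfactors M of Q: M and Q are both viewed as acting on L^2(Q), on which M
   has to be a von Neumann algebra. *)
Record subfactor := Subfactor {
  sf_L2 : L2_rep;
  sf_alg :> vNalg sf_L2;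
  sf_sub : vN_set sf_alg `<=` range (@L2_act sf_L2);
  sf_factor : factor sf_alg }.

Definition sf_set (M : subfactor) : set (uprod U N) :=
  [set x | vN_set M (L2_act x)].

End Subfactors.

Arguments subfactor {R I} U {FU} N.

(* Main.v *)
(* Let Q be the ultraproduct, let (S, c) witness property (T) of M, and call a
   contraction w in N i an approximate intertwiner of b in Aut(N i) if w is not
   small in 2-norm and x w is close to w b(x) for x in the lift of S to N i.

   The heart of the proof is a gap phenomenon: approximate intertwiners of a family
   (b i) yield an exact unitary intertwiner in Q of M and its image under b = (b i)^U.
   Indeed L^2(Q) with right action twisted by b is a normal M-M bimodule, so by
   property (T) the class of (w i) is close to a central vector; averaging over
   unitaries shows that this vector is a bounded intertwiner z, which is nonzero.
   An extreme point w of the unit ball of intertwiners is a partial isometry with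
   (1 - w w* ) y (1 - w* w) = 0 for every intertwiner y; since M' in Q is a factor,
   this forces w to be unitary.

   Consequently, for U-many i, the automorphisms of N i having an approximate
   intertwiner with error d already have one with error d / 2, which makes the set
   of these automorphisms open and closed.  It contains the identity, hence also
   alpha i, and the gap phenomenon applies to alpha.

   That (b i)^U is well defined rests on the fact that automorphisms of a factor
   preserve the trace.  If the contractions y n minimise |y|_2^2 + |b y|_2^2 subject
   to tr y = tr x and tr (b y) = tr (b x), then their limits are invariant under
   unitary conjugation, so y n and b (y n) tend in 2-norm to the scalars tr x and
   tr (b x), which agree because b is closable for the 2-norm. *)

Require Import Defs.
From mathcomp Require Import all_boot all_order all_algebra finmap.
From mathcomp Require Import all_classical all_reals all_analysis.
From mathcomp Require Import complex.
From mathcomp Require Import ring lra.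

Set Implicit Arguments.
Unset Strict Implicit.
Unset Printing Implicit Defensive.

Import Order.TTheory GRing.Theory Num.Theory.
Import numFieldNormedType.Exports.

Local Open Scope classical_set_scope.
Local Open Scope ring_scope.

(** * Positive semidefinite forms *)

Section PsdFormTheory.
Variables (R : realType) (V : lmodType R[i]) (B : V -> V -> R[i]).
Hypothesis hB : psd_form B.
Local Notation nrm := (form_norm B).

Lemma psdNr x z : B z (- x) = - B z x.
Proof. by rewrite (psd_conj hB) psdNl // rmorphN /= -(psd_conj hB). Qed.

Lemma cReN (z : R[i]) : complex.Re (- z) = - complex.Re z.
Proof. by case: z. Qed.

Lemma cReB (z w : R[i]) : complex.Re (z - w) = complex.Re z - complex.Re w.
Proof. by rewrite Defs.ReD cReN. Qed.

Lemma psd_ReC x y : complex.Re (B x y) = complex.Re (B y x).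
Proof. by rewrite (psd_conj hB) Defs.ReC. Qed.

Lemma sqr_form_normD x y :
  nrm (x + y) ^+ 2 = nrm x ^+ 2 + nrm y ^+ 2 + 2 * complex.Re (B x y).
Proof.
rewrite !(sqr_form_norm hB) (psdDl hB) !(psdDr hB) !Defs.ReD [complex.Re (B y x)]psd_ReC.
by ring.
Qed.

Lemma form_normN x : nrm (- x) = nrm x.
Proof. by rewrite /form_norm psdNl // psdNr opprK. Qed.

Lemma form_normBC x y : nrm (x - y) = nrm (y - x).
Proof. by rewrite -form_normN opprB. Qed.

Lemma form_parallelogram x y :
  nrm (x + y) ^+ 2 + nrm (x - y) ^+ 2 = 2 * nrm x ^+ 2 + 2 * nrm y ^+ 2.
Proof. by rewrite !sqr_form_normD psdNr cReN form_normN; ring. Qed.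

Lemma form_normZr (t : R) x : nrm (t%:C%C *: x) = `|t| * nrm x.
Proof.
rewrite (form_normZ hB) -[X in Num.sqrt X]/(t * t - 0 * - 0).
by rewrite mul0r subr0 -expr2 sqrtr_sqr.
Qed.

Lemma form_norm_triangle x y z : nrm (x - z) <= nrm (x - y) + nrm (y - z).
Proof. by have := form_normD hB (x - y) (y - z); rewrite addrA subrK. Qed.

Lemma form_norm_dist x y : nrm x - nrm y <= nrm (x - y).
Proof. by have := form_normD hB (x - y) y; rewrite subrK; lra. Qed.

(** Smallness is assumed only for the steps below [n + k]: at a given index of the ultraproduct,
    only finitely many estimates on the lifts are available at once. *)
Lemma form_norm_telescope (u : nat -> V) (K : R) n k : 0 <= K ->
  (forall m, (m < n + k)%N -> nrm (u m.+1 - u m) <= K * 2^-1 ^+ m) ->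
  nrm (u (n + k)%N - u n) <= 2 * K * 2^-1 ^+ n.
Proof.
move=> K0 hu.
(* The induction needs the exact geometric sum; its factor [1 - 2^-1 ^+ k] is dropped only at the
   end. *)
suff far : nrm (u (n + k)%N - u n) <= 2 * K * 2^-1 ^+ n * (1 - 2^-1 ^+ k).
  have c0 : 0 <= 2 * K * 2^-1 ^+ n by rewrite !mulr_ge0 ?exprn_ge0 ?invr_ge0.
  by apply: le_trans far _; apply: ler_piMr => //; rewrite gerBl exprn_ge0.
elim: k hu => [|k IH] hu.
  by rewrite addn0 subrr (form_norm0 hB) expr0 subrr mulr0.
apply: le_trans (form_norm_triangle _ (u (n + k)%N) _) _.
rewrite addnS in hu *; apply: le_trans (lerD (hu _ (ltnSn _)) (IH _)) _.
  by move=> m mk; apply: hu; exact: ltnW.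
rewrite exprD exprS; move: (2^-1 ^+ n) (2^-1 ^+ k) => a b.
by rewrite le_eqVlt; apply/orP; left; apply/eqP; field.
Qed.

Definition chalf : R[i] := (2^-1 : R)%:C%C.

Definition midpoint_convex (C : set V) :=
  forall x y, C x -> C y -> C (chalf *: (x + y)).

(** The parallelogram law applied to [y] and [u p]. The form need not be complete, so no minimiser
    is produced. Taking for [y] another term gives the Cauchy property; taking the image of [u p]
    under a norm-nonincreasing map of [C] gives almost invariance of [u p]. *)
Lemma minimizing_sequence (C : set V) : C !=set0 -> midpoint_convex C ->
  exists u : nat -> V, (forall n, C (u n)) /\
    forall e : R, 0 < e -> exists n, forall p, (n <= p)%N ->
      forall y, C y -> nrm y <= nrm (u p) -> nrm (y - u p) < e.
Proof.
move=> [x0 Cx0] Cm.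
pose D : set R := [set nrm y ^+ 2 | y in C].
have Dinf : has_inf D.
  split; first by exists (nrm x0 ^+ 2), x0.
  by exists 0 => _ [y _ <-]; exact: sqr_ge0.
have lbD y : C y -> inf D <= nrm y ^+ 2.
  by move=> Cy; apply: ge_inf; [case: Dinf|exists y].
have ex n : exists y, C y /\ nrm y ^+ 2 < inf D + n.+1%:R^-1.
  have n0 : 0 < (n.+1%:R^-1 : R) by rewrite invr_gt0.
  by have [_ [y Cy <-] h] := inf_adherent n0 Dinf; exists y.
have [u hu] := choice ex.
exists u; split=> [n|e e0]; first by case: (hu n).
(* The midpoint has squared norm at least [inf D], so $|y-u_p|^2\le 4(|u_p|^2-\inf D)$. *)
have e4 : 0 < e ^+ 2 / 4 by apply: divr_gt0 => //; exact: exprn_gt0.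
have [n hn] : exists n, (n.+1%:R^-1 : R) < e ^+ 2 / 4.
  have [n _ hn] := near_infty_natSinv_lt (PosNum e4).
  by exists n; exact: (hn n (leqnn n)).
exists n => p np y Cy ley.
have [Cp hp] := hu p.
have hp' : nrm (u p) ^+ 2 < inf D + e ^+ 2 / 4.
  apply: lt_le_trans hp _; rewrite lerD2l; apply: le_trans (ltW hn).
  by rewrite lef_pV2 ?posrE // ler_nat ltnS.
have hm := lbD _ (Cm _ _ Cy Cp).
have h2 : (2^-1 : R) = 1 / 2 by rewrite div1r.
move: hm; rewrite /chalf form_normZr exprMn ger0_norm ?invr_ge0 // => hm.
rewrite -(ltr_pXn2r (n := 2)) ?nnegrE ?form_norm_ge0 ?(ltW e0) //.
have := form_parallelogram y (u p).
have : nrm y ^+ 2 <= nrm (u p) ^+ 2 by rewrite ler_pXn2r ?nnegrE ?form_norm_ge0.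
move: hm hp'; rewrite exprVn; set a := nrm (y + u p) ^+ 2.
set b := nrm (y - u p) ^+ 2; lra.
Qed.

End PsdFormTheory.

(** * Hilbert spaces *)

Lemma Rcvg_unique (R : realType) (T : Type) (F : set_system T)
    {FF : ProperFilter F} (f : T -> R) (a b : R) :
  f @ F --> a -> f @ F --> b -> a = b.
Proof. exact: norm_cvg_unique. Qed.

Lemma half_expr_gt0 (R : realType) n : 0 < (2^-1 ^+ n : R).
Proof. by rewrite exprn_gt0. Qed.

Lemma half_expr_cvg0 (R : realType) : (2^-1 ^+ n : R) @[n --> \oo] --> (0 : R).
Proof. by apply: cvg_expr; rewrite ger0_norm ?invr_ge0 // invf_lt1 ?ltr1n. Qed.

Lemma dist_le_cvg (R : realType) (T : Type) (F : set_system T) {FF : Filter F}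
    (a b : T -> R) (l K : R) :
  (forall t, `|a t - l| <= K * b t) -> b @ F --> (0 : R) -> a @ F --> l.
Proof.
move=> h b0; have : K * b t @[t --> F] --> K * 0 by exact: cvgMr.
rewrite mulr0 => Kb0; apply/cvgrPdist_lt => e e0.
move/cvgrPdist_lt: Kb0 => /(_ e e0); apply: filterS => t.
rewrite sub0r normrN distrC => ht; apply: le_lt_trans (h t) _.
by apply: le_lt_trans ht; exact: ler_norm.
Qed.

Section HilbertTheory.
Variables (R : realType) (H : hilbert R).
Implicit Types (x y z : H).
Let hp : psd_form (@inner R H) := inner_psd H.

Definition hcvg (T : Type) (F : set_system T) (u : T -> H) (l : H) :=
  hnorm (u t - l) @[t --> F] --> (0 : R).

Definition hclosed (C : set H) :=
  forall (u : nat -> H) l, (forall n, C (u n)) -> hcvg \oo u l -> C l.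

Definition hcauchy (u : nat -> H) := forall e : R, 0 < e -> exists n, forall p q,
  (n <= p)%N -> (n <= q)%N -> hnorm (u p - u q) < e.

Lemma hcvgP T (F : set_system T) {FF : Filter F} (u : T -> H) l :
  hcvg F u l <-> forall e : R, 0 < e -> \forall t \near F, hnorm (u t - l) < e.
Proof.
split=> [/cvgrPdist_lt h e e0|h].
  by apply: filterS (h e e0) => t; rewrite sub0r normrN ger0_norm ?hnorm_ge0.
apply/cvgrPdist_lt => e e0; apply: filterS (h e e0) => t.
by rewrite sub0r normrN ger0_norm ?hnorm_ge0.
Qed.

Lemma hcauchy_cvg (u : nat -> H) : hcauchy u -> exists l, hcvg \oo u l.
Proof.
move=> /(@hilbert_complete _ H)[l hl]; exists l; apply/hcvgP => e e0.
by have [n hn] := hl e e0; exists n => // p /= np; exact: hn.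
Qed.

Lemma hnormD x y : hnorm (x + y) <= hnorm x + hnorm y.
Proof. exact: form_normD. Qed.

Lemma hnorm0 : hnorm (0 : H) = 0.
Proof. exact: form_norm0. Qed.

Lemma hnormN x : hnorm (- x) = hnorm x.
Proof. exact: form_normN. Qed.

Lemma hnormBC x y : hnorm (x - y) = hnorm (y - x).
Proof. exact: form_normBC. Qed.

Lemma sqr_hnorm x : hnorm x ^+ 2 = complex.Re (inner x x).
Proof. exact: sqr_form_norm. Qed.

Lemma hnorm_dist_norm x y : `|hnorm x - hnorm y| <= hnorm (x - y).
Proof.
rewrite ler_norml; have := form_norm_dist hp x y; have := form_norm_dist hp y x.
by rewrite (form_normBC hp y x) -!/(hnorm _); lra.
Qed.

Lemma Re_inner_le x y : `|complex.Re (inner x y)| <= hnorm x * hnorm y.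
Proof.
rewrite ler_norml; have := psd_cauchy_schwarz hp x y.
have := psd_cauchy_schwarz hp (- x) y.
by rewrite psdNl // cReN form_normN // -!/(hnorm _); lra.
Qed.

Lemma hcvg_norm T (F : set_system T) {FF : Filter F} (u : T -> H) l :
  hcvg F u l -> hnorm (u t) @[t --> F] --> hnorm l.
Proof.
by apply: (@dist_le_cvg _ _ _ _ _ _ _ 1) => t; rewrite mul1r hnorm_dist_norm.
Qed.

Lemma hcvg_inner T (F : set_system T) {FF : Filter F} (u : T -> H) l y :
  hcvg F u l -> complex.Re (inner (u t) y) @[t --> F] --> complex.Re (inner l y).
Proof.
apply: (@dist_le_cvg _ _ _ _ _ _ _ (hnorm y)) => t.
by rewrite -cReB -(psdNl hp) -(psdDl hp) mulrC; exact: Re_inner_le.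
Qed.

Lemma hcvg_unique T (F : set_system T) {FF : ProperFilter F} (u : T -> H) l l' :
  hcvg F u l -> hcvg F u l' -> l = l'.
Proof.
move=> hl hl'; apply/eqP; rewrite -subr_eq0; apply/eqP/hnorm_eq0/eqP.
have h0 : hnorm (u t - l) + hnorm (u t - l') @[t --> F] --> (0 + 0 : R).
  exact: cvgD.
rewrite eq_le hnorm_ge0 andbT -[0]addr0.
apply: (cvgr_to_ge h0); apply: filterE => t.
by rewrite [hnorm (u t - l)]hnormBC; exact: form_norm_triangle.
Qed.

Lemma hcvgD T (F : set_system T) {FF : Filter F} (u v : T -> H) l m :
  hcvg F u l -> hcvg F v m -> hcvg F (fun t => u t + v t) (l + m).
Proof.
move=> /hcvgP hu /hcvgP hv; apply/hcvgP => e e0.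
have e2 : 0 < e / 2 by lra.
near=> t; have -> : u t + v t - (l + m) = (u t - l) + (v t - m).
  by rewrite opprD addrACA.
apply: le_lt_trans (hnormD _ _) _.
have : hnorm (u t - l) < e / 2 by near: t; exact: hu.
have : hnorm (v t - m) < e / 2 by near: t; exact: hv.
lra.
Unshelve. all: by end_near. Qed.

Lemma hcvgN T (F : set_system T) {FF : Filter F} (u : T -> H) l :
  hcvg F u l -> hcvg F (fun t => - u t) (- l).
Proof.
apply: (@dist_le_cvg _ _ _ _ _ _ _ 1) => t.
by rewrite subr0 mul1r -opprD hnormN ger0_norm ?hnorm_ge0.
Qed.

Lemma hcvg_cst T (F : set_system T) {FF : Filter F} l : hcvg F (fun=> l) l.
Proof.
by rewrite /hcvg; under eq_fun do rewrite subrr hnorm0; exact: cvg_cst.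
Qed.

Lemma hcvg_bounded T (F : set_system T) {FF : Filter F} (u : T -> H) l
    (A : H -> H) (c : R) :
  (forall x y, hnorm (A x - A y) <= c * hnorm (x - y)) ->
  hcvg F u l -> hcvg F (A \o u) (A l).
Proof.
move=> hA; apply: (@dist_le_cvg _ _ _ _ _ _ _ c) => t /=.
by rewrite subr0 ger0_norm ?hnorm_ge0.
Qed.

Lemma hilbert_min_norm (C : set H) : C !=set0 -> midpoint_convex C ->
  hclosed C -> exists l, [/\ C l, forall y, C y -> hnorm l <= hnorm y
    & forall y, C y -> hnorm y <= hnorm l -> y = l].
Proof.
move=> C0 Cm Cc; have [u [Cu hu]] := minimizing_sequence hp C0 Cm.
have [l ul] : exists l, hcvg \oo u l.
  apply: hcauchy_cvg => e e0; have [n hn] := hu e e0; exists n => p q np nq.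
  have [le|/ltW le] := leP (form_norm (@inner R H) (u p)) (form_norm (@inner R H) (u q)).
    exact: hn.
  by rewrite hnormBC; exact: hn.
have Cl := Cc _ _ Cu ul.
have lmin y : C y -> hnorm l <= hnorm y.
  (* A point [y] of [C] shorter than [l] would eventually be shorter than [u p], hence arbitrarily
     close to it, and [u] would converge to [y] as well. *)
  move=> Cy; rewrite leNgt; apply/negP => yl.
  suff uy : hcvg \oo u y by rewrite (hcvg_unique ul uy) ltxx in yl.
  apply/hcvgP => e e0; have [n hn] := hu e e0.
  have hl : \forall p \near \oo, hnorm y < hnorm (u p).
    exact: cvgr_gt (hcvg_norm ul) _ yl.
  near=> p; rewrite hnormBC; apply: hn => //; first by near: p; exact: nbhs_infty_ge.
  by apply: ltW; near: p.
exists l; split=> // y Cy yl.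
apply/eqP; rewrite -subr_eq0; apply/eqP/hnorm_eq0/eqP.
rewrite -sqrf_eq0 eq_le sqr_ge0 andbT.
have := form_parallelogram hp y l; rewrite -!/(hnorm _).
have := lmin _ (Cm _ _ Cy Cl).
rewrite /chalf /hnorm (form_normZr hp) -!/(hnorm _) ger0_norm ?invr_ge0 //.
have h2 : (2^-1 : R) = 1 / 2 by rewrite div1r.
have := hnorm_ge0 y; have := hnorm_ge0 l; have := hnorm_ge0 (y + l); nra.
Unshelve. all: by end_near. Qed.

Lemma min_norm_ortho x y :
  (forall t : R, hnorm x <= hnorm (x + t%:C%C *: y)) ->
  complex.Re (inner x y) = 0.
Proof.
move=> h; set r := complex.Re _; pose K := hnorm y ^+ 2.
have K0 : 0 <= K by exact: sqr_ge0.
have {h} h t : 0 <= t ^+ 2 * K + 2 * (t * r).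
  have := h t; rewrite -(ler_pXn2r (n := 2)) ?nnegrE ?hnorm_ge0 //.
  rewrite [X in _ <= X](sqr_form_normD hp) (form_normZr hp) -!/(hnorm _) exprMn.
  rewrite real_normK ?num_real // (psdZr hp).
  have -> : (t%:C%C : R[i])^* = t%:C%C by exact: conjc_real.
  by rewrite Defs.ReMr -/r /K; lra.
(* The quadratic in [t] is minimal at [- r / K]; the [+ 1] keeps the denominator positive when [y]
   is zero. *)
have := h (- (r / (K + 1))).
have -> : (- (r / (K + 1))) ^+ 2 * K + 2 * (- (r / (K + 1)) * r) =
    - ((r / (K + 1)) ^+ 2 * (K + 2)) by field; rewrite gt_eqF //; lra.
rewrite oppr_ge0 pmulr_lle0; last by lra.
move=> h0; have : (r / (K + 1)) ^+ 2 == 0 by rewrite eq_le h0 sqr_ge0.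
rewrite sqrf_eq0 mulf_eq0 invr_eq0 => /orP[/eqP//|/eqP]; lra.
Qed.

Lemma hnormZr (t : R) x : hnorm (t%:C%C *: x) = `|t| * hnorm x.
Proof. exact: form_normZr. Qed.

Lemma inner_eq0P x y : (forall a : R[i], complex.Re (inner x (a *: y)) = 0) ->
  inner x y = 0.
Proof.
move=> h; have := h 1; have := h ('i)%C; rewrite scale1r (psdZr hp).
case: (inner x y) => a b /=; rewrite !mul0r sub0r mulN1r opprK => -> ->.
by [].
Qed.

Definition hsubspace (V : set H) :=
  V 0 /\ forall a x y, V x -> V y -> V (a *: x + y).

Lemma hprojection (V : set H) : hsubspace V -> hclosed V ->
  exists P, orthogonal_projection V P.
Proof.
move=> [V0 Vl] Vc.
suff ex x : exists y, V y /\ forall v, V v -> inner (x - y) v = 0.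
  by have [P hP] := choice ex; exists P.
have VZ a v : V v -> V (a *: v) by move=> Vv; rewrite -[_ *: _]addr0; exact: Vl.
have VB v w : V v -> V w -> V (v - w).
  by move=> Vv Vw; rewrite addrC -scaleN1r; exact: Vl.
(* This is the coset of [x] modulo [V]; its shortest element is the component of [x] orthogonal to
   [V]. *)
pose C : set H := [set z | V (x - z)].
have [|||l [Cl lmin _]] := @hilbert_min_norm C.
- by exists x; rewrite /C /= subrr.
- move=> y z Cy Cz; rewrite /C /=.
  have -> : x - chalf R *: (y + z) = chalf R *: ((x - y) + (x - z)).
    rewrite addrACA -opprD scalerBr; congr (_ - _).
    rewrite -mulr2n -scaler_nat scalerA -[LHS]scale1r; congr (_ *: _).
    by rewrite /chalf -(rmorph_nat (real_complex R)) -rmorphM /= mulVf.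
  by apply: VZ; rewrite -[x - y]scale1r; exact: Vl.
- move=> u l Cu ul; apply: Vc Cu _.
  by apply: hcvgD; [exact: hcvg_cst|exact: hcvgN].
exists (x - l); split=> // v Vv; rewrite subKr.
apply: inner_eq0P => a; apply: min_norm_ortho => t; apply: lmin.
by rewrite /C /= opprD addrA; apply: VB => //; rewrite scalerA; exact: VZ.
Qed.

(** The shortest solution of [f x = 1] is orthogonal to the kernel of [f], and a multiple of it
    represents [f]. The real-linear form fits the weak limits below, which are taken for real parts
    of matrix coefficients. *)
Lemma hilbert_riesz (f : H -> R) (c : R) :
  {morph f : x y / x + y} -> (forall (t : R) x, f (t%:C%C *: x) = t * f x) ->
  (forall x, `|f x| <= c * hnorm x) ->
  exists z, forall x, f x = complex.Re (inner z x).
Proof.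
move=> fD fZ fc.
have [h0|] := pselect (forall x, f x = 0).
  by exists 0 => x; rewrite h0 (psd0l hp).
move=> /existsNP[x0 /eqP x00].
have fN x : f (- x) = - f x.
  have := fZ (-1) x; rewrite mulN1r => <-; congr f.
  by rewrite rmorphN1 scaleN1r.
pose C : set H := [set x | f x = 1].
have [|||l [Cl lmin _]] := @hilbert_min_norm C.
- by exists ((f x0)^-1%:C%C *: x0); rewrite /C /= fZ mulVf.
- move=> x y Cx Cy; rewrite /C /= /chalf fZ fD Cx Cy.
  by rewrite -[1 + 1]/(2%:R) mulVf.
- move=> u l Cu ul; rewrite /C /=.
  have : f (u t) @[t --> \oo] --> f l.
    apply: (dist_le_cvg _ ul) => t.
    by rewrite -fN -fD; exact: fc.
  under eq_fun do rewrite (Cu _).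
  by move=> h; rewrite -(norm_cvg_unique h (cvg_cst _)).
have orth k : f k = 0 -> complex.Re (inner l k) = 0.
  move=> fk; apply: min_norm_ortho => t; apply: lmin.
  by rewrite /C /= fD fZ fk mulr0 addr0.
have l0 : hnorm l ^+ 2 != 0.
  rewrite sqrf_eq0; apply/eqP => /hnorm_eq0 l0; move: Cl.
  rewrite /C /= l0; have := fZ 0 0; rewrite scaler0 mul0r => -> /esym/eqP.
  by rewrite oner_eq0.
exists ((hnorm l ^+ 2)^-1%:C%C *: l) => x; rewrite (psdZl hp) Defs.ReMr.
have := orth (x - (f x)%:C%C *: l).
rewrite fD fN fZ Cl mulr1 subrr => /(_ erefl).
rewrite (psdDr hp) (psdNr hp) (psdZr hp) cReB.
have -> : ((f x)%:C%C : R[i])^* = (f x)%:C%C by exact: conjc_real.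
rewrite Defs.ReMr -sqr_hnorm => /eqP; rewrite subr_eq0 => /eqP ->.
by rewrite mulrCA mulVf ?mulr1.
Qed.

End HilbertTheory.

Lemma hcvg_cauchy (R : realType) (H : hilbert R) (u : nat -> H) l :
  hcvg \oo u l -> hcauchy u.
Proof.
move=> /hcvgP h e e0; have e2 : 0 < e / 2 by rewrite divr_gt0.
have [n _ hn] := h _ e2; exists n => p q np nq.
apply: le_lt_trans (form_norm_triangle (inner_psd H) _ l _) _.
rewrite -!/(hnorm _) [hnorm (l - _)]hnormBC.
by have := hn p np; have := hn q nq => /=; lra.
Qed.

Lemma hcvgZ (R : realType) (H : hilbert R) T (F : set_system T) {FF : Filter F}
    (k : R[i]) (u : T -> H) l :
  hcvg F u l -> hcvg F (fun t => k *: u t) (k *: l).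
Proof.
apply: (hcvg_bounded (A := GRing.scale k)) => x y.
by rewrite -scalerBr /hnorm (form_normZ (inner_psd H)).
Qed.

Lemma inner_limit (R : realType) (H : hilbert R) (u : nat -> H) l c (w : H) :
  hcvg \oo u l -> (forall n, inner (u n) c = inner w c) -> inner l c = inner w c.
Proof.
have hp := inner_psd H; move=> ul uw.
suff : inner (l - w) c = 0.
  by rewrite (psdDl hp) (psdNl hp) => /eqP; rewrite subr_eq0 => /eqP.
apply: inner_eq0P => a.
have cv : complex.Re (inner (u n) (a *: c)) @[n --> \oo] -->
    complex.Re (inner l (a *: c)) by exact: hcvg_inner.
rewrite (psdDl hp) (psdNl hp) cReB.
suff -> : complex.Re (inner l (a *: c)) = complex.Re (inner w (a *: c)).
  by rewrite subrr.
apply: (Rcvg_unique cv); rewrite (_ : (fun n => _) = fun=> complex.Re (inner w (a *: c))).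
  exact: cvg_cst.
by apply/funext => n; rewrite !(psdZr hp) uw.
Qed.

Lemma ultra_cvg_bounded (R : realType) (T : Type) (F : set_system T)
    (UF : UltraFilter F) (f : T -> R) (c : R) :
  (forall t, `|f t| <= c) -> exists l : R, f @ F --> l.
Proof.
move=> fc; have PF : ProperFilter (f @ F) by exact: fmap_proper_filter.
have [|l [_ cl]] := @segment_compact R (- c) c (f @ F) PF.
  by apply: (@filterE _ F) => t /=; rewrite in_itv /= -ler_norml.
exists l => A Al; have [//|FA] := in_ultra_setVsetC (f @^-1` A) UF.
by have [x []] : (~` A `&` A) !=set0 by exact: cl FA Al.
Qed.

(** * Extreme points of bounded closed sets in a Hilbert space *)

Section ExtremePoints.
Variables (R : realType) (H : hilbert R).
Implicit Types (x y z : H).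
Let hp : psd_form (@inner R H) := inner_psd H.

Lemma geometric_hcauchy (u : nat -> H) (K : R) :
  (forall n, hnorm (u n.+1 - u n) <= K * 2^-1 ^+ n) -> hcauchy u.
Proof.
move=> hu.
have K0 : 0 <= K.
  by have := le_trans (hnorm_ge0 _) (hu 0%N); rewrite expr0 mulr1.
have bnd n k : hnorm (u (n + k)%N - u n) <= 2 * K * 2^-1 ^+ n.
  by apply: (form_norm_telescope hp) => // m _; exact: hu.
move=> e e0.
have cv : 4 * K * 2^-1 ^+ n @[n --> \oo] --> (4 * K * 0 : R).
  by apply: cvgMr; apply: cvg_expr; rewrite ger0_norm ?invr_ge0 // invf_lt1 ?ltr1n.
rewrite mulr0 in cv.
have [n _ hn] := cvgr_lt _ cv _ e0.
exists n => p q np nq.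
rewrite -(subnKC np) -(subnKC nq).
apply: le_lt_trans (form_norm_triangle hp _ (u n) _) _.
rewrite -!/(hnorm _) [hnorm (u n - _)]hnormBC.
apply: le_lt_trans (lerD (bnd _ _) (bnd _ _)) _.
by have := hn n (leqnn n) => /=; set a := _ ^+ n; lra.
Qed.

(* Farthest points are extreme.  Moving the centre away from a nearly farthest
   point makes that point the farthest one up to a controlled error, so the
   centres converge to a point for which the farthest point exists. *)
Lemma hilbert_extreme_point (C : set H) (K : R) :
  C !=set0 -> (forall x, C x -> hnorm x <= K) -> hclosed C ->
  exists2 w, C w & forall z, C (w + z) -> C (w - z) -> z = 0.
Proof.
move=> C0 CK Cc.
have near_farthest (p : H) (n : nat) : exists w, C w /\
    forall y, C y -> hnorm (y - p) ^+ 2 <= hnorm (w - p) ^+ 2 + 2^-1 ^+ (3 * n).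
  pose D : set R := [set hnorm (y - p) ^+ 2 | y in C].
  have Dsup : has_sup D.
    split; first by case: C0 => x Cx; exists (hnorm (x - p) ^+ 2), x.
    exists ((K + hnorm p) ^+ 2) => _ [y Cy <-].
    have K0 : 0 <= K by exact: le_trans (hnorm_ge0 _) (CK _ Cy).
    rewrite ler_pXn2r ?nnegrE ?addr_ge0 ?hnorm_ge0 //.
    by apply: le_trans (hnormD _ _) _; rewrite hnormN lerD ?CK.
  have e0 : 0 < (2^-1 ^+ (3 * n) : R) by rewrite exprn_gt0.
  have [_ [w Cw <-] hw] := sup_adherent e0 Dsup; exists w; split=> // y Cy.
  have : hnorm (y - p) ^+ 2 <= sup D by apply: sup_upper_bound => //; exists y.
  lra.
have [W hW] := choice (fun pn : H * nat => near_farthest pn.1 pn.2).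
(* The centre moves away from [W (p, n)] by the proportion [m n]. The tolerance $2^{-3n}$ is a
   multiple of [m n ^+ 3], and the comparison of two consecutive centres divides it by [m n]; so
   [w n.+1 - w n] has norm of order [m n], which is summable. *)
pose m n : R := 2^-1 ^+ n / 4.
pose step n p := p - (m n)%:C%C *: (W (p, n) - p).
pose p := fix p n := if n is k.+1 then step k (p k) else 0.
pose w n := W (p n, n).
have Cw n : C (w n) by case: (hW (p n, n)).
have far n y : C y ->
    hnorm (y - p n) ^+ 2 <= hnorm (w n - p n) ^+ 2 + 2^-1 ^+ (3 * n).
  by case: (hW (p n, n)) => _; apply.
have pS n : p n.+1 = p n - (m n)%:C%C *: (w n - p n) by [].
have m0 n : 0 < m n by rewrite divr_gt0 // exprn_gt0.
have K0 : 0 <= K by exact: le_trans (hnorm_ge0 _) (CK _ (Cw 0%N)).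
have h2 : (2^-1 : R) = 1 / 2 by rewrite div1r.
have mS n : m n.+1 = m n / 2 by rewrite /m exprS h2; field.
(* Equivalently $|p_n|\le K(1-4m_n)$: the total displacement of the centres stays bounded by [K]. *)
have pK n : hnorm (p n) + K <= 2 * K * (1 - 2 * m n).
  elim: n => [|n IH]; first by rewrite /= hnorm0 /m expr0; lra.
  rewrite pS mS; set a := m n in IH *.
  have a0 : 0 < a by exact: m0.
  have -> : p n - a%:C%C *: (w n - p n) = (1 + a)%:C%C *: p n - a%:C%C *: w n.
    by rewrite scalerBr opprB rmorphD /= scalerDl scale1r addrA.
  apply: le_trans (lerD (hnormD _ _) (lexx K)) _; rewrite hnormN !hnormZr.
  rewrite !gtr0_norm //; last by lra.
  have := CK _ (Cw n); have := hnorm_ge0 (p n); have := hnorm_ge0 (w n); nra.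
have rK n : hnorm (w n - p n) <= 2 * K.
  apply: le_trans (hnormD _ _) _; rewrite hnormN.
  have := CK _ (Cw n); have := pK n; have := m0 n; nra.
have wC n : hnorm (w n.+1 - w n) <= 4 * 2^-1 ^+ n.
  rewrite -(ler_pXn2r (n := 2)) ?nnegrE ?hnorm_ge0 ?mulr_ge0 ?exprn_ge0 //.
  have := far n.+1 _ (Cw n); have := far n _ (Cw n.+1); rewrite pS.
  set a := w n.+1 - p n; set b := w n - p n.
  have -> : w n.+1 - w n = a - b by rewrite /a /b opprB addrA subrK.
  have -> : w n - (p n - (m n)%:C%C *: b) = (1 + m n)%:C%C *: b.
    by rewrite opprB addrCA addrC rmorphD /= scalerDl scale1r.
  have -> : w n.+1 - (p n - (m n)%:C%C *: b) = a + (m n)%:C%C *: b.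
    by rewrite opprB addrCA addrC.
  rewrite [hnorm (a + _) ^+ 2](sqr_form_normD hp).
  rewrite [hnorm (a - _) ^+ 2](sqr_form_normD hp) -!/(hnorm _).
  rewrite hnormN !hnormZr (psdZr hp) (psdNr hp) cReN.
  have -> : ((m n)%:C%C : R[i])^* = (m n)%:C%C by exact: conjc_real.
  rewrite Defs.ReMr !gtr0_norm ?m0 //; last by have := m0 n; lra.
  have -> : (2^-1 ^+ (3 * n) : R) = 64 * m n ^+ 3.
    by rewrite mulnC exprM /m; move: (2^-1 ^+ n) => t; field.
  have -> : (2^-1 ^+ (3 * n.+1) : R) = 8 * m n ^+ 3.
    by rewrite mulnC exprM /m [2^-1 ^+ n.+1]exprS; move: (2^-1 ^+ n) => t; field.
  have -> : (2^-1 ^+ n : R) = 4 * m n by rewrite /m; field.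
  have := m0 n; have m1 : m n <= 1.
    rewrite /m ler_pdivrMr // mul1r; apply: (@le_trans _ _ 1); last by lra.
    by rewrite exprn_ile1 ?invr_ge0 // h2; lra.
  move: (hnorm a) (hnorm b) (complex.Re _) (m n) m1 => {}a {}b r t t1 t0 h h'.
  (* With $a$, $b$ as vectors, $t|a-b|^2=(1+t)(|a|^2-|b|^2)+|(1+t)b|^2-|a+tb|^2$. The first
     difference is controlled by the choice of [w n], the second by that of [w n.+1]. *)
  have : t * (a ^+ 2 + b ^+ 2 + 2 * - r) <= t * (256 * t ^+ 2).
    have h4 : (1 + t) * (a ^+ 2 - b ^+ 2) <= 2 * (64 * t ^+ 3).
      have t3 : 0 <= t ^+ 3 by rewrite exprn_ge0 // ltW.
      apply: (@le_trans _ _ ((1 + t) * (64 * t ^+ 3))); last by apply: ler_wpM2r; lra.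
      by apply: ler_wpM2l; lra.
    have t3 : 0 < t ^+ 3 by rewrite exprn_gt0.
    have -> : t * (256 * t ^+ 2) = 256 * t ^+ 3 by ring.
    suff -> : t * (a ^+ 2 + b ^+ 2 + 2 * - r) = (1 + t) * (a ^+ 2 - b ^+ 2) +
        (((1 + t) * b) ^+ 2 - (a ^+ 2 + (t * b) ^+ 2 + 2 * (t * r))) by lra.
    by ring.
  by rewrite ler_pM2l // !exprMn; lra.
have [l wl] : exists l, hcvg \oo w l.
  by apply: hcauchy_cvg; exact: geometric_hcauchy wC.
have [q pq] : exists q, hcvg \oo p q.
  apply: hcauchy_cvg; apply: (@geometric_hcauchy _ K) => n.
  rewrite pS addrC addKr hnormN hnormZr gtr0_norm //.
  rewrite [leRHS](_ : _ = m n * (4 * K)); last by rewrite /m; field.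
  by rewrite ler_pM2l //; apply: le_trans (rK n) _; lra.
have Cl : C l by exact: Cc Cw wl.
have sqr_cvg (u : nat -> H) k : hcvg \oo u k ->
    hnorm (u n - p n) ^+ 2 @[n --> \oo] --> hnorm (k - q) ^+ 2.
  move=> uk; have h : hnorm (u n - p n) @[n --> \oo] --> hnorm (k - q).
    exact: hcvg_norm (hcvgD uk (hcvgN pq)).
  by under eq_fun do rewrite expr2; rewrite expr2; exact: cvgM.
have lfar y : C y -> hnorm (y - q) ^+ 2 <= hnorm (l - q) ^+ 2.
  move=> Cy.
  have cv : hnorm (w n - p n) ^+ 2 + 2^-1 ^+ n - hnorm (y - p n) ^+ 2
      @[n --> \oo] --> hnorm (l - q) ^+ 2 + 0 - hnorm (y - q) ^+ 2.
    apply: cvgB; last by apply: sqr_cvg; exact: hcvg_cst.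
    apply: cvgD; first exact: sqr_cvg.
    by apply: cvg_expr; rewrite ger0_norm ?invr_ge0 // invf_lt1 ?ltr1n.
  suff : 0 <= hnorm (l - q) ^+ 2 + 0 - hnorm (y - q) ^+ 2 by lra.
  apply: (cvgr_to_ge cv); apply: nearW => n.
  have := far n _ Cy.
  have : (2^-1 ^+ (3 * n) : R) <= 2^-1 ^+ n.
    by apply: ler_wiXn2l; rewrite ?invr_ge0 ?leq_pmull // h2; lra.
  lra.
exists l => // z Cp Cm.
have := lfar _ Cp; have := lfar _ Cm; rewrite ![_ + _ - q]addrAC.
have := form_parallelogram hp (l - q) z; rewrite -!/(hnorm _) => e h1 h3.
apply/hnorm_eq0/eqP; rewrite -sqrf_eq0 eq_le sqr_ge0 andbT; lra.
Qed.

End ExtremePoints.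

(** * Von Neumann algebras *)

Lemma complex_cvg_Re (R : realType) (T : Type) (F : set_system T) {FF : Filter F}
    (f : T -> R[i]^o) (l : R[i]^o) :
  f @ F --> l -> complex.Re (f t) @[t --> F] --> complex.Re l.
Proof.
move=> /cvgrPdist_lt h; apply/cvgrPdist_lt => e e0.
have e0' : 0 < e%:C%C :> R[i] by rewrite ltcR.
apply: filterS (h _ e0') => t ht; rewrite -ltcR -cReB.
by apply: le_lt_trans ht; exact: normc_ge_Re.
Qed.

Section VonNeumannTheory.
Variables (R : realType) (H : hilbert R) (N : vNalg H).
Implicit Types (x y : N) (xi eta : H).
Let hp : psd_form (@inner R H) := inner_psd H.

Lemma vN_actD x xi eta : x (xi + eta) = x xi + x eta.
Proof. by have := vN_linear x 1 xi eta; rewrite !scale1r. Qed.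

Lemma vN_act0 x : x 0 = 0.
Proof. by apply: (addrI (x 0)); rewrite -vN_actD !addr0. Qed.

Lemma vN_actZ x a xi : x (a *: xi) = a *: x xi.
Proof. by have := vN_linear x a xi 0; rewrite vN_act0 !addr0. Qed.

Lemma vN_actN x xi : x (- xi) = - x xi.
Proof. by rewrite -scaleN1r vN_actZ scaleN1r. Qed.

Lemma vN_actB x xi eta : x (xi - eta) = x xi - x eta.
Proof. by rewrite vN_actD vN_actN. Qed.

Lemma vN_addE x y xi : (x + y) xi = x xi + y xi. Proof. by []. Qed.
Lemma vN_oppE x xi : (- x) xi = - x xi. Proof. by []. Qed.
Lemma vN_scaleE a x xi : (a *: x) xi = a *: x xi. Proof. by []. Qed.
Lemma vN_mulE x y xi : (x * y) xi = x (y xi). Proof. by []. Qed.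
Lemma vN_oneE xi : (1 : N) xi = xi. Proof. by []. Qed.
Definition vN_actE := (vN_addE, vN_oppE, vN_scaleE, vN_mulE, vN_oneE).

Lemma inner_starr x xi eta : inner xi (star x eta) = inner (x xi) eta.
Proof. by rewrite (vN_adjoint x). Qed.

Lemma inner_starl x xi eta : inner (star x xi) eta = inner xi (x eta).
Proof. by rewrite (vN_adjoint (star x)) starK. Qed.

Lemma vN_op_bound x : exists2 c : R, 0 <= c & op_bound c x.
Proof. by have [_ [c /op_bound_ge0]] := vN_bounded x. Qed.

Lemma op_bound_opp x c : op_bound c x -> op_bound c (- x).
Proof. by move=> h xi; rewrite vN_oppE hnormN. Qed.

Lemma op_bound_star x c : 0 <= c -> op_bound c x -> op_bound c (star x).
Proof. by move=> c0; apply: op_bound_adjoint => //; exact: vN_adjoint. Qed.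

Lemma inner_Re_ext xi eta :
  (forall z, complex.Re (inner xi z) = complex.Re (inner eta z)) -> xi = eta.
Proof.
move=> h; apply/eqP; rewrite -subr_eq0; apply/eqP/hnorm_eq0/eqP.
by rewrite -sqrf_eq0 sqr_hnorm (psdDl hp) (psdNl hp) cReB h subrr.
Qed.

Lemma vN_intro (T : H -> H) : bounded_op T ->
  (forall S, commutant (vN_set N) S -> S \o T = T \o S) ->
  exists x, vN_op x = T.
Proof.
move=> Tb Tc; have PT : vN_pred N T.
  by apply/asboolP; rewrite -vN_bicommutant; split.
by exists (VNElt PT).
Qed.

(** Coercivity bounds [x] from below, so its range is closed, and a vector orthogonal to the range
    vanishes. The inverse commutes with the commutant of [N], hence lies in [N]. This is the source
    of all the resolvents and Cayley transforms below. *)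
Lemma coercive_inverse x (k : R) : 0 < k ->
  (forall xi, k * hnorm xi ^+ 2 <= complex.Re (inner (x xi) xi)) ->
  exists y, [/\ x * y = 1, y * x = 1 & op_bound k^-1 y].
Proof.
move=> k0 hx.
have low xi : k * hnorm xi <= hnorm (x xi).
  have [->|n0] := eqVneq (hnorm xi) 0; first by rewrite mulr0 hnorm_ge0.
  have np : 0 < hnorm xi by rewrite lt_neqAle eq_sym n0 hnorm_ge0.
  rewrite -(ler_pM2r np) -mulrA -expr2; apply: le_trans (hx xi) _.
  exact: psd_cauchy_schwarz.
have inj xi eta : x xi = x eta -> xi = eta.
  move=> e; apply/eqP; rewrite -subr_eq0; apply/eqP/hnorm_eq0/eqP.
  have := low (xi - eta); rewrite vN_actB e subrr hnorm0 pmulr_rle0 // => h.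
  by rewrite eq_le h hnorm_ge0.
have [c c0 xc] := vN_op_bound x.
have [||P hP] := @hprojection R H (range x).
- split; first by exists 0; rewrite ?vN_act0.
  by move=> a _ _ [s _ <-] [t _ <-]; exists (a *: s + t); rewrite ?vN_linear.
- move=> u l Vu ul; have ex n : exists v, x v = u n.
    by have [v _ <-] := Vu n; exists v.
  have [v hv] := choice ex.
  have [l' vl] : exists l', hcvg \oo v l'.
    apply: hcauchy_cvg => e e0.
    have e1 : 0 < k * e / 2 by rewrite divr_gt0 // mulr_gt0.
    have /hcvgP/(_ _ e1)[n _ hn] := ul.
    exists n => p q np nq; rewrite -(ltr_pM2l k0).
    apply: le_lt_trans (low _) _; rewrite vN_actB !hv.
    apply: le_lt_trans (form_norm_triangle hp _ l _) _; rewrite -!/(hnorm _).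
    by rewrite [hnorm (l - _)]hnormBC; have := hn p np; have := hn q nq => /=; lra.
  exists l' => //; suff h : hcvg \oo u (x l') by exact: hcvg_unique h ul.
  rewrite (_ : u = x \o v); last by apply/funext => n /=.
  by apply: hcvg_bounded vl => a b; rewrite -vN_actB; exact: xc.
have surj eta : exists xi, x xi = eta.
  have [[xi _ xiE] orth] := hP eta; exists xi; rewrite xiE.
  apply/esym/eqP; rewrite -subr_eq0; apply/eqP/hnorm_eq0/eqP.
  have := orth (x (eta - P eta)) (imageT _ _).
  rewrite (psd_conj hp) => /(congr1 (@complex.Re R)); rewrite Defs.ReC /= => h0.
  have := hx (eta - P eta); rewrite h0 pmulr_rle0 // => h1.
  by rewrite -sqrf_eq0 eq_le h1 sqr_ge0.
have [y0 hy0] := choice surj.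
have y0b : op_bound k^-1 y0.
  by move=> xi; rewrite ler_pdivlMl // -{2}[xi]hy0; exact: low.
have [||y yE] := @vN_intro y0.
- split; last by exists k^-1.
  by move=> a s t; apply: inj; rewrite vN_linear !hy0.
- move=> S [_ hS]; apply/funext => xi /=; apply: inj; rewrite hy0.
  have := congr1 (@^~ (y0 xi)) (hS _ (vN_eltP x)) => /= ->.
  by rewrite hy0.
exists y; split.
- by apply: vN_ext => xi; rewrite vN_mulE yE hy0.
- by apply: vN_ext => xi; apply: inj; rewrite vN_mulE yE hy0.
- by rewrite yE.
Qed.

(** * Weak limits of bounded families and normal functionals *)

Section WeakLimits.
Variables (T : Type) (F : set_system T).

Definition weak_cvg {FF : Filter F} (x : T -> N) (x0 : N) := forall xi eta,
  complex.Re (inner (x t xi) eta) @[t --> F] --> complex.Re (inner (x0 xi) eta).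

(** Weak compactness of balls of [N]: the ultralimits of the real parts of the matrix coefficients
    are bounded real-linear in the second vector, so the Riesz theorem represents them by an
    operator, which commutes with the commutant of [N]. *)
Lemma weak_ultralimit (UF : UltraFilter F) (x : T -> N) (c : R) : 0 <= c ->
  (forall t, op_bound c (x t)) -> exists2 x0 : N, op_bound c x0 & weak_cvg x x0.
Proof.
move=> c0 xc.
have lim xi eta : exists l : R, complex.Re (inner (x t xi) eta) @[t --> F] --> l.
  apply: (@ultra_cvg_bounded _ _ _ _ _ (c * hnorm xi * hnorm eta)) => t.
  apply: le_trans (Re_inner_le _ _) _.
  by rewrite ler_wpM2r ?hnorm_ge0 //; exact: xc.
have [f hf] := choice (fun a : H * H => lim a.1 a.2).
have {}hf xi eta : complex.Re (inner (x t xi) eta) @[t --> F] --> f (xi, eta).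
  exact: (hf (xi, eta)).
have [T0 hT0] : exists T0 : H -> H, forall xi eta,
    f (xi, eta) = complex.Re (inner (T0 xi) eta).
  suff ex xi : exists z, forall eta, f (xi, eta) = complex.Re (inner z eta).
    by have [T0 hT0] := choice ex; exists T0.
  apply: (@hilbert_riesz _ _ _ (c * hnorm xi)) => [a b|r a|a].
  - suff cv : complex.Re (inner (x t xi) (a + b)) @[t --> F] -->
        f (xi, a) + f (xi, b) by exact: norm_cvg_unique (hf _ _) cv.
    under eq_fun do rewrite (psdDr hp) Defs.ReD.
    by apply: cvgD; exact: hf.
  - suff cv : complex.Re (inner (x t xi) (r%:C%C *: a)) @[t --> F] -->
        r * f (xi, a) by exact: norm_cvg_unique (hf _ _) cv.
    have rr : (r%:C%C : R[i])^* = r%:C%C by exact: conjc_real.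
    under eq_fun do rewrite (psdZr hp) rr Defs.ReMr.
    by apply: cvgMr; exact: hf.
  - have cv : `|complex.Re (inner (x t xi) a)| @[t --> F] --> `|f (xi, a)|.
      by apply: cvg_norm; exact: hf.
    apply: (cvgr_to_le cv); apply: nearW => t.
    apply: le_trans (Re_inner_le _ _) _.
    by rewrite ler_wpM2r ?hnorm_ge0 //; exact: xc.
have wk xi eta : complex.Re (inner (x t xi) eta) @[t --> F] -->
    complex.Re (inner (T0 xi) eta) by rewrite -hT0.
have T0b : op_bound c T0.
  move=> xi; have [->|n0] := eqVneq (hnorm (T0 xi)) 0.
    by rewrite mulr_ge0 ?hnorm_ge0.
  have np : 0 < hnorm (T0 xi) by rewrite lt_neqAle eq_sym n0 hnorm_ge0.
  rewrite -(ler_pM2r np) -expr2 sqr_hnorm.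
  apply: (cvgr_to_le (wk _ _)); apply: nearW => t.
  apply: le_trans (ler_norm _) _; apply: le_trans (Re_inner_le _ _) _.
  by rewrite ler_wpM2r ?hnorm_ge0 //; exact: xc.
have [||x0 x0E] := @vN_intro T0.
- split; last by exists c.
  move=> a s t; apply: inner_Re_ext => z.
  suff cv : complex.Re (inner (x k (a *: s + t)) z) @[k --> F] -->
      complex.Re (inner (a *: T0 s + T0 t) z) by exact: norm_cvg_unique (wk _ _) cv.
  have ZE (v : H) : inner (a *: v) z = inner v (a^* *: z).
    by rewrite (psdZr hp) conjCK (psdZl hp).
  rewrite (psdDl hp) ZE Defs.ReD.
  under eq_fun do rewrite vN_linear (psdDl hp) ZE Defs.ReD.
  by apply: cvgD; exact: wk.
- move=> S [[Sl [d Sd]] hS]; apply/funext => xi /=; apply: inner_Re_ext => eta.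
  have SD a b : S (a + b) = S a + S b by have := Sl 1 a b; rewrite !scale1r.
  have S0 : S 0 = 0 by apply: (addrI (S 0)); rewrite -SD !addr0.
  (* The vector [eta'] is the adjoint of [S] applied to [eta], obtained from the Riesz theorem. *)
  have [eta' hS'] : exists eta', forall z,
      complex.Re (inner (S z) eta) = complex.Re (inner eta' z).
    apply: (@hilbert_riesz _ _ _ (d * hnorm eta)) => [a b|r a|a].
    - by rewrite SD (psdDl hp) Defs.ReD.
    - by have := Sl r%:C%C a 0; rewrite S0 !addr0 => ->; rewrite (psdZl hp) Defs.ReMr.
    - apply: le_trans (Re_inner_le _ _) _; rewrite mulrAC.
      by rewrite ler_wpM2r ?hnorm_ge0 //; exact: Sd.
  rewrite hS' (psd_ReC hp).
  suff cv : complex.Re (inner (x t xi) eta') @[t --> F] -->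
      complex.Re (inner (T0 (S xi)) eta) by exact: norm_cvg_unique (wk _ _) cv.
  rewrite (_ : (fun t => _) = fun t => complex.Re (inner (x t (S xi)) eta)).
    exact: wk.
  apply/funext => t; rewrite (psd_ReC hp) -hS'.
  by have /= -> := congr1 (@^~ xi) (hS _ (vN_eltP (x t))).
by exists x0; rewrite ?x0E // => xi eta; rewrite x0E.
Qed.

(** A normal functional is a series of matrix coefficients whose tails are, uniformly on the ball of
    radius [c], at most [c] times the tails of the convergent series [a]. Finite partial sums
    converge by weak convergence. *)
Lemma weak_cvg_normal {FF : Filter F} (phi : N -> R[i]) (x : T -> N) (x0 : N) (c : R) :
  normal_functional phi -> 0 <= c -> (forall t, op_bound c (x t)) ->
  op_bound c x0 -> weak_cvg x x0 ->
  complex.Re (phi (x t)) @[t --> F] --> complex.Re (phi x0).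
Proof.
move=> [xi [eta [cxi ceta hphi]]] c0 xc x0c wk.
pose a n : R := hnorm (xi n) ^+ 2 + hnorm (eta n) ^+ 2.
have ca : cvgn (series a).
  rewrite (_ : series a = series (fun n => hnorm (xi n) ^+ 2)
    \+ series (fun n => hnorm (eta n) ^+ 2)); first exact: is_cvgD.
  by apply/funext => n; rewrite /series /= -big_split.
have a0 n : 0 <= a n by rewrite addr_ge0 ?sqr_ge0.
pose S y n : R := \sum_(0 <= k < n) complex.Re (inner (vN_op y (xi k)) (eta k)).
have SE (y : N) : S y @ \oo --> complex.Re (phi y).
  rewrite (_ : S y = fun n => complex.Re
      (series (fun k => inner (y (xi k)) (eta k)) n)).
    exact: complex_cvg_Re (hphi y).
  apply/funext => n; rewrite /series /S /=.
  by elim/big_ind2 : _ => // ? ? ? ? -> ->; rewrite Defs.ReD.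
have tail (y : N) n : op_bound c y ->
    `|complex.Re (phi y) - S y n| <= c * (limn (series a) - series a n).
  move=> yc; have cv : `|S y k - S y n| @[k --> \oo] -->
      `|complex.Re (phi y) - S y n|.
    by apply: cvg_norm; apply: cvgB; [exact: SE|exact: cvg_cst].
  apply: (cvgr_to_le cv); exists n => // k /= nk.
  rewrite /S (big_cat_nat (n := n)) //= addrAC subrr add0r.
  apply: le_trans (ler_norm_sum _ _ _) _.
  apply: (@le_trans _ _ (\sum_(n <= j < k) c * a j)).
    apply: ler_sum => j _; apply: le_trans (Re_inner_le _ _) _.
    apply: le_trans (ler_wpM2r (hnorm_ge0 _) (yc _)) _.
    rewrite -mulrA ler_wpM2l // /a.
    have := sqr_ge0 (hnorm (xi j) - hnorm (eta j)); have := hnorm_ge0 (xi j).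
    have := hnorm_ge0 (eta j); nra.
  rewrite -mulr_sumr ler_wpM2l //.
  rewrite -sub_series_geq // lerD2r.
  by apply: nondecreasing_cvgn_le => //; exact: nondecreasing_series.
have Scvg n : S (x t) n @[t --> F] --> S x0 n.
  by apply: (cvg_big (op := +%R) (P := xpredT)) => [|k _]; [exact: add_continuous|exact: wk].
apply/cvgrPdist_lt => e e0.
have [n hn] : exists n, c * (limn (series a) - series a n) < e / 3.
  have cv : c * (limn (series a) - series a n) @[n --> \oo] -->
      c * (limn (series a) - limn (series a)).
    by apply: cvgMr; apply: cvgB; [exact: cvg_cst|exact: ca].
  rewrite subrr mulr0 in cv.
  have e3 : 0 < e / 3 by rewrite divr_gt0.
  by have [n _ hn] := cvgr_lt _ cv _ e3; exists n; exact: (hn n (leqnn n)).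
have e3 : 0 < e / 3 by rewrite divr_gt0.
have /cvgrPdist_lt/(_ _ e3) := Scvg n; apply: filterS => t.
have := tail _ n x0c; have := tail _ n (xc t).
rewrite !ltr_norml !ler_norml; lra.
Qed.

End WeakLimits.

End VonNeumannTheory.

(** * Tracial von Neumann algebras *)

Section CayleyTransform.
Variables (R : realType) (A : starAlgType R).
Implicit Types (h s x z : A).

(** When [s] is the inverse of [1 - 'i *: h], this is $(1+ih)(1-ih)^{-1}$. Such elements are the
    supply of unitaries for all averaging arguments. *)
Definition cayley s : A := 2 *: s - 1.

Definition cayley_inverse h s :=
  (1 - 'i *: h) * s = 1 /\ s * (1 - 'i *: h) = 1.

Lemma star_cayley_den h : star h = h -> star (1 - 'i *: h) = 1 + 'i *: h.
Proof. by move=> hh; rewrite starB star1 starZ conjCi hh scaleNr opprK. Qed.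

Lemma cayley_unitary h s : star h = h -> cayley_inverse h s ->
  unitary (cayley s).
Proof.
move=> hh [gs sg]; set g := 1 - 'i *: h in gs sg.
have gg : star g + g = 2 *: 1.
  rewrite star_cayley_den // addrACA subrr addr0.
  by rewrite scaler_nat mulr2n.
have ss : star s * star g = 1 by rewrite -starM gs star1.
have ss' : star g * star s = 1 by rewrite -starM sg star1.
have e1 : star s + s = 2 *: (star s * s).
  have -> : 2 *: (star s * s) = star s * (star g + g) * s.
    by rewrite gg -scalerAr mulr1 scalerAl.
  by rewrite mulrDr mulrDl ss mul1r -[star s * g * s]mulrA gs mulr1 addrC.
have e2 : s + star s = 2 *: (s * star s).
  have -> : 2 *: (s * star s) = s * (star g + g) * star s.
    by rewrite gg -scalerAr mulr1 scalerAl.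
  by rewrite mulrDr mulrDl sg mul1r -[s * star g * star s]mulrA ss' mulr1.
have st : star (cayley s) = 2 *: star s - 1.
  by rewrite /cayley starB star1 starZ conjC_nat.
split; rewrite st /cayley mulrBr mulrBl mulr1 mul1r -scalerAl -scalerAr.
- by rewrite -e1 scalerDr addrK opprB addrC subrK.
- by rewrite -e2 scalerDr addrK opprB addrC subrK.
Qed.

(** A self-adjoint element is recovered algebraically from its Cayley transform, so relations tested
    on these unitaries pass to self-adjoint elements, and through [re_im_partE] to all elements. *)
Lemma cayley_intertwine h h' s s' z :
  cayley_inverse h s -> cayley_inverse h' s' ->
  cayley s * z = z * cayley s' -> h * z = z * h'.
Proof.
move=> [gs _] [_ sg'] e.
have sz : s * z = z * s'.
  move: e; rewrite /cayley mulrBl mulrBr mul1r mulr1 => /addIr.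
  rewrite -scalerAl -scalerAr => /(congr1 (GRing.scale 2^-1)).
  by rewrite !scalerA mulVf ?pnatr_eq0 // !scale1r.
have : z * (1 - 'i *: h') = (1 - 'i *: h) * z.
  set g := 1 - 'i *: h in gs *; set g' := 1 - 'i *: h' in sg' *.
  have {1}-> : z = g * (z * s') by rewrite -sz mulrA gs mul1r.
  by rewrite -!mulrA sg' mulr1.
rewrite mulrBl mulrBr mulr1 mul1r => /addrI/oppr_inj.
rewrite -scalerAl -scalerAr => /(congr1 (GRing.scale ('i)^-1)).
by rewrite !scalerA mulVf ?neq0Ci // !scale1r.
Qed.

Definition re_part x := 2^-1 *: (x + star x).
Definition im_part x := ('i * 2^-1) *: (star x - x).

Lemma star_re_part x : star (re_part x) = re_part x.
Proof. by rewrite /re_part starZ starD starK fmorphV /= conjC_nat addrC. Qed.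

Lemma star_im_part x : star (im_part x) = im_part x.
Proof.
rewrite /im_part starZ starB starK rmorphM /= conjCi fmorphV /= conjC_nat.
by rewrite mulNr scaleNr -scalerN opprB.
Qed.

Lemma re_im_partE x : x = re_part x + 'i *: im_part x.
Proof.
rewrite /re_part /im_part scalerA mulrA -expr2 sqrCi mulN1r scaleNr -scalerN.
rewrite opprB -scalerDr addrACA subrr addr0 -mulr2n -[x *+ 2]scaler_nat scalerA.
by rewrite mulVf ?pnatr_eq0 // scale1r.
Qed.

End CayleyTransform.

(** * Completeness of operator-norm balls for the 2-norm *)

Section TracialTheory.
Variables (R : realType) (N : tracialvN R).
Implicit Types (x y : N).
Let hp : psd_form (@inner R (tv_space N)) := inner_psd _.

Lemma nrm2_eq0 x : nrm2 x = 0 -> x = 0.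
Proof.
move=> h; apply: (tr_faithful (trP N)); rewrite (psd_Re (tr_form_psd N)).
by rewrite -(sqr_form_norm (tr_form_psd N)) -[form_norm _ _]/(nrm2 x) h expr0n.
Qed.

Lemma Re_tr_le x y : complex.Re (tr (star y * x)) <= nrm2 x * nrm2 y.
Proof. exact: psd_cauchy_schwarz (tr_form_psd N) x y. Qed.

Lemma nrm2_op_bound x (c : R) : 0 <= c -> op_bound c x -> nrm2 x <= c.
Proof. by move=> c0 /(nrm2_mull 1 c0); rewrite mulr1 nrm2_1 mulr1. Qed.

Lemma nrm2BC x y : nrm2 (x - y) = nrm2 (y - x).
Proof. by rewrite -nrm2N opprB. Qed.

Lemma nrm2_triangle x y z : nrm2 (x - z) <= nrm2 (x - y) + nrm2 (y - z).
Proof. exact: form_norm_triangle (tr_form_psd N) x y z. Qed.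

Lemma op_boundB x y c d : op_bound c x -> op_bound d y -> op_bound (c + d) (x - y).
Proof. by move=> xc yd; apply: op_boundD => //; exact: op_bound_opp. Qed.

(** The limit is a weak ultralimit. With [y = x p - x0], normality of the trace makes $|y|_2^2$ the
    limit of the real parts of the traces of [star y * (x p - x q)], to which Cauchy-Schwarz and the
    Cauchy estimate apply. *)
Lemma tracial_ball_complete (x : nat -> N) (c : R) : 0 <= c ->
  (forall n, op_bound c (x n)) ->
  (forall e : R, 0 < e -> exists n, forall p q,
     (n <= p)%N -> (n <= q)%N -> nrm2 (x p - x q) < e) ->
  exists2 x0 : N, op_bound c x0 & nrm2 (x n - x0) @[n --> \oo] --> (0 : R).
Proof.
move=> c0 xc xC.
have [F [UF ooF]] := ultraFilterLemma (F := \oo) _.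
have [x0 x0c wk] := weak_ultralimit UF c0 xc.
exists x0 => //; apply/cvgrPdist_lt => e e0.
have e2 : 0 < e / 2 by rewrite divr_gt0.
have [n hn] := xC _ e2; exists n => // p /= np.
rewrite sub0r normrN ger0_norm ?nrm2_ge0 //.
set y := x p - x0.
have yb : op_bound (c + c) y by exact: op_boundB.
suff h : nrm2 y ^+ 2 <= e / 2 * nrm2 y.
  have [->//|n0] := eqVneq (nrm2 y) 0.
  have np0 : 0 < nrm2 y by rewrite lt_neqAle eq_sym n0 nrm2_ge0.
  by move: h; rewrite expr2 ler_pM2r //; lra.
rewrite [leLHS](sqr_form_norm (tr_form_psd N)).
have cc0 : 0 <= c + c by rewrite addr_ge0.
have cv : complex.Re (tr (star y * (x p - x q))) @[q --> F] -->
    complex.Re (tr (star y * y)).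
  apply: (weak_cvg_normal (tr_normal (trP N)) (c := (c + c) * (c + c))).
  - by rewrite mulr_ge0.
  - move=> q; apply: op_boundM => //; first exact: op_bound_star.
    exact: op_boundB.
  - by apply: op_boundM => //; exact: op_bound_star.
  - move=> xi eta; rewrite !vN_actE inner_starl.
    rewrite /y !vN_actE (psdDl hp) (psdNl hp) cReB.
    rewrite (_ : (fun q => _) = fun q => complex.Re (inner (x p xi) (y eta)) -
      complex.Re (inner (x q xi) (y eta))).
      by apply: cvgB; [exact: cvg_cst|exact: wk].
    apply/funext => q; rewrite !vN_actE inner_starl.
    by rewrite !vN_actE (psdDl hp) (psdNl hp) cReB.
apply: (cvgr_to_le cv).
have : F [set q | (n <= q)%N] by apply: ooF; exact: nbhs_infty_ge.
apply: filterS => q nq; apply: le_trans (Re_tr_le _ _) _.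
by rewrite ler_wpM2r ?nrm2_ge0 // ltW // hn.
Qed.

Lemma vN_cayley (x : N) : star x = x ->
  exists s : N, [/\ cayley_inverse x s, op_bound 1 (cayley s)
    & op_bound 1 (star (cayley s))].
Proof.
move=> hx.
have [|xi|s [gs sg _]] := @coercive_inverse _ _ N (1 - 'i *: x) 1.
- exact: ltr01.
- rewrite mul1r sqr_hnorm !vN_actE (psdDl hp) (psdNl hp) (psdZl hp) cReB.
  (* For self-adjoint [x] the number [inner (x xi) xi] is real, so [1 - 'i *: x] is coercive with
     constant 1. *)
  suff -> : complex.Re ('i * inner (x xi) xi) = 0 by rewrite subr0.
  have : inner (x xi) xi = (inner (x xi) xi)^*.
    by rewrite -(psd_conj hp) -{1}hx inner_starl.
  rewrite -complexiE; case: (inner _ _) => a b /=.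
  move=> [/eqP]; rewrite mul0r mul1r sub0r -addr_eq0 -mulr2n mulrn_eq0 /=.
  by move=> /eqP ->; rewrite oppr0.
have [u1 u2] := cayley_unitary hx (conj gs sg).
have iso (v : N) : star v * v = 1 -> op_bound 1 v.
  move=> e xi; rewrite mul1r le_eqVlt; apply/orP; left.
  rewrite -(eqrXn2 (n := 2)) ?hnorm_ge0 // !sqr_hnorm.
  by rewrite -inner_starl -vN_mulE e.
by exists s; split=> //; apply: iso => //; rewrite starK.
Qed.

End TracialTheory.

(** * Automorphisms *)

Section AutomorphismTheory.
Variables (R : realType) (N : tracialvN R) (f : aut N).
Implicit Types (x y : N).
Let hp : psd_form (@inner R (tv_space N)) := inner_psd _.

Lemma autD x y : f (x + y) = f x + f y.
Proof. by have := aut_linear f 1 x y; rewrite !scale1r. Qed.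

Lemma aut0 : f 0 = 0.
Proof. by apply: (addrI (f 0)); rewrite -autD !addr0. Qed.

Lemma autZ a x : f (a *: x) = a *: f x.
Proof. by have := aut_linear f a x 0; rewrite aut0 !addr0. Qed.

Lemma autN x : f (- x) = - f x.
Proof. by rewrite -scaleN1r autZ scaleN1r. Qed.

Lemma autB x y : f (x - y) = f x - f y.
Proof. by rewrite autD autN. Qed.

Lemma aut1 : f 1 = 1.
Proof.
have [g _ gK] := aut_bij f.
by rewrite -[f 1]mulr1 -[1 in X in _ * X]gK -autM mul1r gK.
Qed.

Lemma aut_inj : injective f.
Proof. by case: (aut_bij f) => g fK _; exact: can_inj fK. Qed.

(* The spectrum of [star x * x] is preserved, and its supremum is the square of
   the operator norm of [x]. *)
Lemma aut_op_bound x (c : R) : 0 <= c -> op_bound c x -> op_bound c (f x).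
Proof.
move=> c0 xc; set a := f x.
have [b b0 ab] := vN_op_bound a.
pose D : set R := [set t | forall xi, hnorm (a xi) ^+ 2 <= t * hnorm xi ^+ 2].
have Dlb : lbound D 0.
  move=> t Dt; have [xi xi0] := vN_nontrivial N.
  have xip : 0 < hnorm xi ^+ 2.
    rewrite exprn_gt0 // lt_neqAle hnorm_ge0 andbT eq_sym.
    by apply/eqP => /hnorm_eq0/eqP; rewrite (negbTE xi0).
  by rewrite -(pmulr_lge0 _ xip); apply: le_trans (Dt xi); exact: sqr_ge0.
have Dinf : has_inf D.
  split; last by exists 0.
  exists (b ^+ 2) => xi; rewrite -exprMn ler_pXn2r ?nnegrE ?mulr_ge0 ?hnorm_ge0 //.
set s := inf D; have s0 : 0 <= s by exact: lb_le_inf Dinf.1 Dlb.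
have Ds xi : hnorm (a xi) ^+ 2 <= s * hnorm xi ^+ 2.
  apply/ler_addgt0Pr => e e0.
  have p1 : 0 < hnorm xi ^+ 2 + 1 by have := sqr_ge0 (hnorm xi); lra.
  have [t Dt ts] := inf_adherent (divr_gt0 e0 p1) Dinf.
  apply: le_trans (Dt xi) _.
  have : t * hnorm xi ^+ 2 <= (s + e / (hnorm xi ^+ 2 + 1)) * hnorm xi ^+ 2.
    by rewrite ler_wpM2r ?sqr_ge0 // ltW.
  move=> h; apply: le_trans h _; rewrite mulrDl lerD2l.
  rewrite -mulrA -[leRHS]mulr1 ler_wpM2l ?(ltW e0) //.
  by rewrite mulrC ler_pdivrMr //; lra.
have [sc|cs] := leP s (c ^+ 2).
  move=> xi; rewrite -(ler_pXn2r (n := 2)) ?nnegrE ?mulr_ge0 ?hnorm_ge0 //.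
  by apply: le_trans (Ds xi) _; rewrite exprMn ler_wpM2r ?sqr_ge0.
(* If [c ^+ 2 < s], then [s - star x * x] is invertible, hence so is its image [s - star a * a]. The
   bound [d] of this inverse pushes the quadratic form of [star a * a] below [s] by
   [(d ^+ 2 * s)^-1], against the minimality of [s]. *)
exfalso; have sp : 0 < s by apply: le_lt_trans cs; exact: sqr_ge0.
have k0 : 0 < s - c ^+ 2 by lra.
have [|y [_ yx _]] := @coercive_inverse _ _ N (s%:C%C *: 1 - star x * x) _ k0.
  move=> xi; rewrite !vN_actE (psdDl hp) (psdNl hp) (psdZl hp) cReB Defs.ReMr.
  rewrite inner_starl -!sqr_hnorm mulrBl lerD2l lerN2 -exprMn.
  by rewrite ler_pXn2r ?nnegrE ?mulr_ge0 ?hnorm_ge0 //; exact: xc.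
have {}yx : f y * (s%:C%C *: 1 - star a * a) = 1.
  by have := congr1 f yx; rewrite autM autB autZ autM aut_star aut1.
have [d d0 yd] := vN_op_bound (f y).
have abs : op_bound (Num.sqrt s) a.
  move=> xi; rewrite -(ler_pXn2r (n := 2)) ?nnegrE ?mulr_ge0 ?hnorm_ge0 ?sqrtr_ge0 //.
  by rewrite exprMn (sqr_sqrtr s0); exact: Ds.
have asbs : op_bound (Num.sqrt s) (star a).
  by apply: op_bound_star => //; exact: sqrtr_ge0.
have key xi : hnorm xi ^+ 2 <= d ^+ 2 * s * (s * hnorm xi ^+ 2 - hnorm (a xi) ^+ 2).
  have h1 : hnorm xi ^+ 2 <= d ^+ 2 * hnorm ((s%:C%C *: 1 - star a * a) xi) ^+ 2.
    have {1}-> : xi = f y ((s%:C%C *: 1 - star a * a) xi) by rewrite -vN_mulE yx.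
    by rewrite -exprMn ler_pXn2r ?nnegrE ?mulr_ge0 ?hnorm_ge0 //; exact: yd.
  apply: le_trans h1 _; rewrite -mulrA ler_wpM2l ?sqr_ge0 // !vN_actE.
  rewrite [leLHS](sqr_form_normD hp) -!/(hnorm _) hnormN hnormZr exprMn.
  rewrite (psdZl hp) (psdNr hp) inner_starr mulrN cReN Defs.ReMr -sqr_hnorm.
  rewrite real_normK ?num_real //.
  have : hnorm (star a (a xi)) ^+ 2 <= s * hnorm (a xi) ^+ 2.
    rewrite -{1}(sqr_sqrtr s0) -exprMn ler_pXn2r ?nnegrE ?mulr_ge0 ?hnorm_ge0 ?sqrtr_ge0 //;
    exact: asbs.
  by nra.
have dp : 0 < d ^+ 2 * s.
  rewrite lt_neqAle mulr_ge0 ?sqr_ge0 // andbT eq_sym; apply/eqP => e.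
  have [xi xi0] := vN_nontrivial N; have := key xi; rewrite e mul0r => h.
  have : hnorm xi ^+ 2 == 0 by rewrite eq_le h sqr_ge0.
  by rewrite sqrf_eq0 => /eqP/hnorm_eq0/eqP; rewrite (negbTE xi0).
have : D (s - (d ^+ 2 * s)^-1).
  move=> xi; have := key xi; rewrite mulrBl lerBrDr -lerBrDl.
  by rewrite -ler_pdivrMl // mulrC.
move=> /(ge_inf Dinf.2); rewrite -/s => h.
have : 0 < (d ^+ 2 * s)^-1 by rewrite invr_gt0.
lra.
Qed.

End AutomorphismTheory.

(** * Closability of automorphisms for the 2-norm *)

Section Closability.
Variables (R : realType) (N : tracialvN R) (f : aut N).
Implicit Types (x y : N).
Let hp : psd_form (@inner R (tv_space N)) := inner_psd _.

(* The resolvents of the sums of 4^n |w n|^2 converge weakly to an operator which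
   truncates all the [w n] at once. *)
Lemma small_multiplier (w : nat -> N) :
  (forall n, nrm2 (w n) <= 4^-1 ^+ n.+1) ->
  exists2 y : N, y != 0 & forall n, op_bound (2^-1 ^+ n) (w n * y).
Proof.
move=> wn.
pose T := fix T k : N := if k is j.+1
  then T j + (4 ^+ j : R)%:C%C *: (star (w j) * w j) else 1.
have TE k : T k.+1 = T k + (4 ^+ k : R)%:C%C *: (star (w k) * w k) by [].
have TS k xi : complex.Re (inner (T k.+1 xi) xi) =
    complex.Re (inner (T k xi) xi) + 4 ^+ k * hnorm (w k xi) ^+ 2.
  rewrite TE !vN_actE (psdDl hp) (psdZl hp) Defs.ReD Defs.ReMr inner_starl.
  by rewrite sqr_hnorm.
have p4 k : 0 < 4 ^+ k :> R by rewrite exprn_gt0.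
have Tge k xi : hnorm xi ^+ 2 <= complex.Re (inner (T k xi) xi).
  elim: k => [|k IH]; first by rewrite [T 0%N]/(1 : N) vN_actE sqr_hnorm.
  rewrite TS; apply: le_trans IH _; rewrite lerDl.
  by rewrite mulr_ge0 ?sqr_ge0 // ltW.
have Tgew k n xi : (n < k)%N ->
    4 ^+ n * hnorm (w n xi) ^+ 2 <= complex.Re (inner (T k xi) xi).
  elim: k => // k IH; rewrite ltnS leq_eqVlt => /orP[/eqP ->|nk].
    by rewrite TS lerDr; apply: le_trans (Tge _ _); exact: sqr_ge0.
  rewrite TS; apply: le_trans (IH nk) _; rewrite lerDl.
  by rewrite mulr_ge0 ?sqr_ge0 // ltW.
have ex k : exists y : N, T k * y = 1 /\ op_bound 1 y.
  have [|xi|y [Ty _ yb]] := @coercive_inverse _ _ N (T k) 1.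
  - exact: ltr01.
  - by rewrite mul1r.
  - by exists y; split=> //; rewrite invr1 in yb.
have [Y hY] := choice ex.
have wY n k : (n < k)%N -> op_bound (2^-1 ^+ n) (w n * Y k).
  move=> nk xi; have [TY Yb] := hY k.
  have h := Tgew k n (Y k xi) nk; rewrite -[T k (Y k xi)]vN_mulE TY vN_oneE in h.
  have := le_trans h (le_trans (ler_norm _) (Re_inner_le _ _)).
  move=> {}h; have e0 := ltW (half_expr_gt0 R n).
  rewrite -(ler_pXn2r (n := 2)) ?nnegrE ?mulr_ge0 ?hnorm_ge0 //.
  rewrite vN_mulE -(ler_pM2l (p4 n)); apply: le_trans h _.
  rewrite exprMn mulrA -exprM mulnC exprM -exprMn.
  have -> : 4 * 2^-1 ^+ 2 = 1 :> R by field.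
  rewrite expr1n mul1r expr2 ler_wpM2l ?hnorm_ge0 //.
  by have := Yb xi; rewrite mul1r.
have trT k y : (forall n, (n < k)%N -> op_bound (2^-1 ^+ n) (w n * y)) ->
    complex.Re (tr (T k * y)) <= complex.Re (tr y) + 2^-1 * (1 - 2^-1 ^+ k).
  elim: k => [|k IH] h; first by rewrite [T 0%N]/(1 : N) mul1r expr0 subrr mulr0 addr0.
  rewrite TE mulrDl trD -scalerAl trZ Defs.ReD Defs.ReMr.
  have := IH (fun n nk => h n (ltnW nk)).
  have : 4 ^+ k * complex.Re (tr (star (w k) * w k * y)) <= 2^-1 ^+ k / 4.
    rewrite -mulrA; apply: (@le_trans _ _ (4 ^+ k * (2^-1 ^+ k * 4^-1 ^+ k.+1))).
      rewrite ler_wpM2l ?(ltW (p4 k)) //; apply: le_trans (Re_tr_le _ _) _.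
      apply: ler_pM; rewrite ?nrm2_ge0 //.
      by apply: nrm2_op_bound; [rewrite ltW ?half_expr_gt0|exact: h].
    rewrite [4^-1 ^+ _]exprS [4^-1 ^+ k]exprVn.
    rewrite [leLHS](_ : _ = 2^-1 ^+ k / 4) //.
    move: (4 ^+ k) (2^-1 ^+ k) (p4 k) => a b a0; field.
    by rewrite gt_eqF.
  have -> : (2^-1 ^+ k.+1 : R) = 2^-1 ^+ k / 2 by rewrite exprS mulrC.
  set e := 2^-1 ^+ k; have h2 : (2^-1 : R) = 1 / 2 by rewrite div1r.
  rewrite h2; lra.
(* The trace of [T k * Y k] is 1, and the summands of [T k] other than the identity contribute at
   most 1/2 to it. So the traces of the [Y k] stay at least 1/2, and their weak limit is nonzero. *)
have trY k : 2^-1 <= complex.Re (tr (Y k)).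
  have [TY Yb] := hY k; have := trT k (Y k) (fun n nk => wY n k nk).
  rewrite TY (tr1 (trP N)) /=.
  move: (half_expr_gt0 R k); move: (2^-1 ^+ k) => e.
  have h2 : (2^-1 : R) = 1 / 2 by rewrite div1r.
  by rewrite h2; lra.
have [F [UF ooF]] := ultraFilterLemma (F := \oo) _.
have [y yb wk] := weak_ultralimit UF ler01 (fun k => (hY k).2).
exists y.
  apply/eqP => y0.
  have cv : complex.Re (tr (Y k)) @[k --> F] --> complex.Re (tr y).
    exact: (weak_cvg_normal (tr_normal (trP N)) ler01 (fun k => (hY k).2)).
  have : 2^-1 <= complex.Re (tr y) by apply: (cvgr_to_ge cv); exact: nearW.
  by rewrite y0 tr0 /= leNgt invr_gt0 ltr0n.
move=> n xi; rewrite vN_mulE; set eta := w n (y xi).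
have e0 := ltW (half_expr_gt0 R n).
have [->|n0] := eqVneq (hnorm eta) 0; first by rewrite mulr_ge0 ?hnorm_ge0.
have np : 0 < hnorm eta by rewrite lt_neqAle eq_sym n0 hnorm_ge0.
rewrite -(ler_pM2r np) -expr2 sqr_hnorm -inner_starr.
apply: (cvgr_to_le (wk _ _)).
have : F [set k | (n < k)%N] by apply: ooF; exact: nbhs_infty_gt.
apply: filterS => k nk; rewrite inner_starr.
apply: le_trans (ler_norm _) _; apply: le_trans (Re_inner_le _ _) _.
by rewrite ler_wpM2r ?hnorm_ge0 //; exact: (wY n k nk xi).
Qed.

(** No 2-norm continuity of [f] is available yet, only preservation of operator bounds. Along a
    subsequence, the multiplier [y] makes [z (g n) * y] tend to 0 in operator norm, so
    [f (z (g n)) * f y] tends to 0; its 2-norm limit is also [c *: f y], and [f y] is nonzero. *)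
Lemma aut_closable (z : nat -> N) (c : R[i]) :
  nrm2 (z n) @[n --> \oo] --> (0 : R) ->
  nrm2 (f (z n) - c *: 1) @[n --> \oo] --> (0 : R) -> c = 0.
Proof.
move=> z0 fz.
have ex n : exists m, nrm2 (z m) <= 4^-1 ^+ n.+1 /\
    nrm2 (f (z m) - c *: 1) <= 2^-1 ^+ n.
  have a0 : 0 < 4^-1 ^+ n.+1 :> R by rewrite exprn_gt0.
  have [m1 _ h1] := cvgr_le _ z0 _ a0.
  have [m2 _ h2] := cvgr_le _ fz _ (half_expr_gt0 R n).
  exists (maxn m1 m2); split; [apply: h1|apply: h2] => /=.
    exact: leq_maxl.
  exact: leq_maxr.
have [g hg] := choice ex.
have [y y0 wy] := small_multiplier (fun n => (hg n).1).
have [b b0 yb] := vN_op_bound (f y).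
have bnd n : nrm2 (c *: f y) <= (1 + b) * 2^-1 ^+ n.
  have -> : c *: f y = f (z (g n) * y) - (f (z (g n)) - c *: 1) * f y.
    by rewrite mulrBl -autM mulr_algl subKr.
  apply: le_trans (nrm2D _ _) _; rewrite nrm2N [leRHS]mulrDl mul1r; apply: lerD.
    apply: nrm2_op_bound; first by rewrite ltW ?half_expr_gt0.
    by apply: aut_op_bound (wy n); rewrite ltW ?half_expr_gt0.
  apply: le_trans (nrm2_mulr _ b0 yb) _.
  by rewrite ler_wpM2l //; case: (hg n).
have /nrm2_eq0/eqP : nrm2 (c *: f y) = 0.
  apply/eqP; rewrite eq_le nrm2_ge0 andbT.
  have cv : (1 + b) * 2^-1 ^+ n @[n --> \oo] --> ((1 + b) * 0 : R).
    by apply: cvgMr; apply: cvg_expr; rewrite ger0_norm ?invr_ge0 // invf_lt1 ?ltr1n.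
  rewrite mulr0 in cv.
  by apply: (cvgr_to_ge cv); exact: nearW.
rewrite scaler_eq0 => /orP[/eqP//|/eqP fy0]; move: y0.
by rewrite (_ : y = 0) ?eqxx //; apply: (@aut_inj _ _ f); rewrite fy0 aut0.
Qed.

End Closability.

Lemma chalf_double (R : realType) (V : lmodType R[i]) (x : V) :
  chalf R *: (x + x) = x.
Proof.
rewrite -mulr2n -scaler_nat scalerA -[RHS]scale1r; congr (_ *: _).
by rewrite /chalf -(rmorph_nat (real_complex R)) -rmorphM /= mulVf.
Qed.

Lemma op_bound_midpoint (R : realType) (H : hilbert R) (N : vNalg H) (x y : N)
    (c : R) : op_bound c x -> op_bound c y -> op_bound c (chalf R *: (x + y)).
Proof.
move=> xc yc xi; rewrite !vN_actE hnormZr ger0_norm ?invr_ge0 //.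
rewrite mulrC ler_pdivrMr //; apply: le_trans (hnormD _ _) _.
by have := xc xi; have := yc xi; lra.
Qed.

Section UniqueTrace.

(** * Invariance of the trace under automorphisms of a factor *)

Variables (R : realType) (N : tracialvN R).
Implicit Types (x y : N).

Lemma tr_limit (u : nat -> N) x t : (forall n, tr (u n) = t) ->
  nrm2 (u n - x) @[n --> \oo] --> (0 : R) -> tr x = t.
Proof.
move=> ut ux; apply/eqP; rewrite -subr_eq0; apply/eqP; set d := tr x - t.
have h n : complex.Re (d^* * d) <= Num.sqrt (complex.Re (d^* * (d^*)^*)) *
    nrm2 (u n - x).
  have -> : d^* * d = tr (star 1 * (d^* *: (x - u n))).
    by rewrite star1 mul1r trZ trD -scaleN1r trZ mulN1r ut.
  apply: le_trans (Re_tr_le _ _) _.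
  by rewrite nrm2_1 mulr1 nrm2Z nrm2BC.
have : complex.Re (d^* * d) <= 0.
  set K := Num.sqrt _ in h.
  have cv : K * nrm2 (u n - x) @[n --> \oo] --> K * 0 by exact: cvgMr.
  by rewrite mulr0 in cv; apply: (cvgr_to_ge cv); exact: nearW.
case: d {h} => a b; rewrite -[_^*]/(a -i* b)%C /= mulNr opprK => h.
have a0 : a ^+ 2 = 0 by have := sqr_ge0 a; have := sqr_ge0 b; nra.
have b0 : b ^+ 2 = 0 by have := sqr_ge0 a; have := sqr_ge0 b; nra.
by move/eqP: a0; move/eqP: b0; rewrite !sqrf_eq0 => /eqP -> /eqP ->.
Qed.

Lemma limit_commute (u : nat -> N) x (v : N) :
  unitary v -> op_bound 1 v -> op_bound 1 (star v) ->
  nrm2 (u n - x) @[n --> \oo] --> (0 : R) ->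
  nrm2 (v * u n * star v - u n) @[n --> \oo] --> (0 : R) ->
  v * x = x * v.
Proof.
move=> [vv _] v1 vs1 ux uv.
suff /nrm2_eq0/eqP : nrm2 (v * x * star v - x) = 0.
  rewrite subr_eq0 => /eqP e; rewrite -{2}e.
  by rewrite -mulrA vv mulr1.
apply/eqP; rewrite eq_le nrm2_ge0 andbT.
have cv : nrm2 (u n - x) + nrm2 (v * u n * star v - u n) + nrm2 (u n - x)
    @[n --> \oo] --> (0 + 0 + 0 : R) by apply: cvgD => //; apply: cvgD.
rewrite !addr0 in cv; apply: (cvgr_to_ge cv); apply: nearW => n.
apply: le_trans (nrm2_triangle _ (u n) _) _; rewrite lerD2r.
apply: le_trans (nrm2_triangle _ (v * u n * star v) _) _; rewrite lerD2r.
rewrite -mulrBl -mulrBr nrm2BC.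
apply: le_trans (nrm2_mulr _ ler01 vs1) _; rewrite mul1r.
by rewrite -[leRHS]mul1r; exact: nrm2_mull.
Qed.

Lemma factor_scalar x : Defs.factor N ->
  (forall h : N, star h = h -> h * x = x * h) -> x = tr x *: 1.
Proof.
move=> Nf hx.
have [//|y _|a e] := Nf x.
  rewrite (re_im_partE y); move: (re_part y) (im_part y) (star_re_part y)
    (star_im_part y) => a b ha hb; rewrite mulrDl mulrDr -scalerAl -scalerAr.
  by rewrite (hx _ ha) (hx _ hb).
by rewrite {2}e trZ (tr1 (trP N)) mulr1.
Qed.

Theorem aut_tr (f : aut N) x : Defs.factor N -> tr (f x) = tr x.
Proof.
move=> Nf.
wlog x1 : x / op_bound 1 x => [hw|].
  have [c c0 xc] := vN_op_bound x.
  pose k : R[i] := ((c + 1)^-1 : R)%:C%C.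
  have k0 : k != 0.
    apply/eqP => /(congr1 (@complex.Re R)) /= /eqP.
    by rewrite invr_eq0 gt_eqF //; lra.
  suff : k * tr (f x) = k * tr x by move/(mulfI k0).
  rewrite -!trZ -autZ; apply: hw => xi; rewrite vN_scaleE hnormZr.
  have c1 : 0 < c + 1 by lra.
  rewrite ger0_norm ?invr_ge0 ?(ltW c1) // ler_pdivrMl // mul1r.
  by apply: le_trans (xc xi) _; rewrite ler_wpM2r ?hnorm_ge0 //; lra.
(* The form of the graph of [f]: a Cauchy sequence for [B] is one for which both [u n] and [f (u n)]
   are 2-norm Cauchy. *)
pose B x y : R[i] := tr (star y * x) + tr (star (f y) * f x).
have BP : psd_form B.
  have P := tr_form_psd N; split=> [a s t z|s t|s]; rewrite /B.
  - rewrite aut_linear (psd_linear P) (psd_linear P (a) (f s) (f t)).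
    by rewrite mulrDr addrACA.
  - by rewrite (psd_conj P) (psd_conj P (f s)) rmorphD.
  - by rewrite addr_ge0 ?tr_sqr_ge0.
have Bsq y : form_norm B y ^+ 2 = nrm2 y ^+ 2 + nrm2 (f y) ^+ 2.
  rewrite (sqr_form_norm BP) /B Defs.ReD.
  by rewrite -!(sqr_form_norm (tr_form_psd N)).
have B1 y : nrm2 y <= form_norm B y.
  rewrite -(ler_pXn2r (n := 2)) ?nnegrE ?nrm2_ge0 ?form_norm_ge0 // Bsq.
  by rewrite lerDl sqr_ge0.
have B2 y : nrm2 (f y) <= form_norm B y.
  rewrite -(ler_pXn2r (n := 2)) ?nnegrE ?nrm2_ge0 ?form_norm_ge0 // Bsq.
  by rewrite lerDr sqr_ge0.
pose C : set N := [set y : N | [/\ op_bound 1 y, tr y = tr x & tr (f y) = tr (f x)]].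
have [||u [Cu hu]] := @minimizing_sequence _ _ _ BP C.
- by exists x; split.
- move=> y z [y1 yt yft] [z1 zt zft]; split; first exact: op_bound_midpoint.
    rewrite trZ trD yt zt; exact: (@chalf_double _ R[i]^o).
  rewrite autZ autD trZ trD yft zft; exact: (@chalf_double _ R[i]^o).
have uC e : 0 < e -> exists n, forall p q, (n <= p)%N -> (n <= q)%N ->
    form_norm B (u p - u q) < e.
  move=> e0; have [n hn] := hu e e0; exists n => p q np nq.
  have [le|/ltW le] := leP (form_norm B (u p)) (form_norm B (u q)).
    exact: hn.
  by rewrite (form_normBC BP); exact: hn.
have [|e e0|z _ uz] := @tracial_ball_complete _ N u 1 ler01.
- by move=> n; case: (Cu n).
- have [n hn] := uC e e0; exists n => p q np nq.
  exact: le_lt_trans (B1 _) (hn p q np nq).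
have [|e e0|z' _ uz'] := @tracial_ball_complete _ N (f \o u) 1 ler01.
- by move=> n; apply: aut_op_bound => //; case: (Cu n).
- have [n hn] := uC e e0; exists n => p q np nq /=; rewrite -autB.
  exact: le_lt_trans (B2 _) (hn p q np nq).
(* Conjugation by [v] preserves [C] and does not increase the graph norm, so minimality of [u] makes
   the conjugate of [u n] asymptotic to [u n]. *)
have vu (v : N) : unitary v -> op_bound 1 v -> op_bound 1 (star v) ->
    form_norm B (v * u n * star v - u n) @[n --> \oo] --> (0 : R).
  move=> [vv vv'] v1 vs1; apply/cvgrPdist_lt => e e0.
  have [n hn] := hu e e0; exists n => // p /= np.
  rewrite sub0r normrN ger0_norm ?form_norm_ge0 //; apply: hn => //.
    have [p1 pt pft] := Cu p; split.
    - rewrite -[1]mulr1; apply: op_boundM vs1 => //.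
      by rewrite -[1]mulr1; exact: op_boundM.
    - by rewrite (trC (trP N)) mulrA vv mul1r.
    - by rewrite !autM (trC (trP N)) mulrA -autM vv aut1 mul1r.
  rewrite -(ler_pXn2r (n := 2)) ?nnegrE ?form_norm_ge0 // !Bsq.
  have le1 (a b : N) : op_bound 1 a -> op_bound 1 (star a) ->
      nrm2 (a * b * star a) ^+ 2 <= nrm2 b ^+ 2.
    move=> a1 as1; rewrite ler_pXn2r ?nnegrE ?nrm2_ge0 //.
    apply: le_trans (nrm2_mulr _ ler01 as1) _; rewrite mul1r.
    by apply: le_trans (nrm2_mull _ ler01 a1) _; rewrite mul1r.
  apply: lerD; first exact: le1.
  rewrite !autM aut_star; apply: le1; first exact: aut_op_bound.
  by rewrite -aut_star; exact: aut_op_bound.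
have sq0 (a b : nat -> R) : (forall n, 0 <= a n <= b n) ->
    b @ \oo --> (0 : R) -> a @ \oo --> (0 : R).
  move=> ab; apply: (@dist_le_cvg _ _ _ _ _ _ _ 1) => n.
  by have /andP[a0 abn] := ab n; rewrite subr0 mul1r ger0_norm.
have ze : z = tr x *: 1.
  rewrite -(@tr_limit u z (tr x)) //; last by move=> n; case: (Cu n).
  apply: factor_scalar => // h hh.
  have [s [hs v1 vs1]] := vN_cayley hh.
  have V := cayley_unitary hh hs.
  apply: (cayley_intertwine hs hs).
  apply: (limit_commute V v1 vs1 uz); apply: sq0 (vu _ V v1 vs1) => n.
  by rewrite nrm2_ge0 B1.
(* Surjectivity of [f] writes every self-adjoint element as the image of one, so conjugations by
   images of Cayley transforms suffice to make the second limit [z'] central. *)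
have [g _ gK] := aut_bij f.
have ze' : z' = tr (f x) *: 1.
  rewrite -(@tr_limit (f \o u) z' (tr (f x))) //; last by move=> n; case: (Cu n).
  apply: factor_scalar => // h; rewrite -[h]gK -aut_star => /aut_inj hh.
  have [s [hs v1 vs1]] := vN_cayley hh.
  have [V V'] := cayley_unitary hh hs.
  have fc : f (cayley s) = cayley (f s) by rewrite /cayley autB autZ aut1.
  have hs' : cayley_inverse (f (g h)) (f s).
    by case: hs => a b; split; rewrite -(aut1 f) -autZ -autB -autM ?a ?b.
  apply: (cayley_intertwine hs' hs').
  rewrite -fc; apply: (limit_commute _ _ _ uz').
  - by split; rewrite -aut_star -autM ?V ?V' aut1.
  - exact: aut_op_bound.
  - by rewrite -aut_star; exact: aut_op_bound.
  - apply: sq0 (vu _ (conj V V') v1 vs1) => n /=.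
    by rewrite -aut_star -!autM -autB nrm2_ge0 B2.
(* The sequence [u n - tr x *: 1] tends to 0 while its image tends to the scalar
   [tr (f x) - tr x]. *)
apply/eqP; rewrite -subr_eq0; apply/eqP.
apply: (@aut_closable _ _ f (fun n => u n - tr x *: 1)).
  by rewrite -ze.
rewrite (_ : (fun n => _) = fun n => nrm2 ((f \o u) n - z')) //.
apply/funext => n; rewrite ze' autB autZ aut1 scalerBl opprB /=.
by rewrite addrA subrK.
Qed.

End UniqueTrace.

(** * The tracial ultraproduct *)

(** A single [b] serves all [n]. If every step is small, it is the 2-norm limit; otherwise it is
    [a k] for the first step [k] that is not small, and an [n] whose steps are all small is at most
    [k]. *)
Lemma tracial_telescope (R : realType) (N : tracialvN R) (a : nat -> N) :
  (forall n, op_bound 1 (a n)) ->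
  exists2 b : N, op_bound 1 b & forall n,
    (forall m, (m < n)%N -> nrm2 (a m.+1 - a m) <= 2^-1 ^+ m) ->
    nrm2 (a n - b) <= 2 * 2^-1 ^+ n.
Proof.
move=> a1; have P := tr_form_psd N.
have tele n k : (forall m, (m < n + k)%N -> nrm2 (a m.+1 - a m) <= 2^-1 ^+ m) ->
    nrm2 (a (n + k)%N - a n) <= 2 * 2^-1 ^+ n.
  move=> h; have := @form_norm_telescope _ _ _ P a 1 n k ler01.
  by rewrite mulr1; apply => m /h; rewrite mul1r.
have [good|] := pselect (forall m, nrm2 (a m.+1 - a m) <= 2^-1 ^+ m).
  have [e e0|b b1 ab] := tracial_ball_complete ler01 a1.
    have cv : 4 * 2^-1 ^+ n @[n --> \oo] --> (4 * 0 : R).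
      by apply: cvgMr; exact: half_expr_cvg0.
    rewrite mulr0 in cv; have [n _ hn] := cvgr_lt _ cv _ e0.
    exists n => p q np nq; rewrite -(subnKC np) -(subnKC nq).
    apply: le_lt_trans (nrm2_triangle _ (a n) _) _.
    rewrite [nrm2 (a n - _)]nrm2BC.
    apply: le_lt_trans (lerD (tele _ _ _) (tele _ _ _)) _ => //.
    by have := hn n (leqnn n) => /=; set r := _ ^+ n; lra.
  exists b => // n _.
  have cv : 2 * 2^-1 ^+ n + nrm2 (a k - b) @[k --> \oo] --> 2 * 2^-1 ^+ n + (0 : R).
    by apply: cvgD => //; exact: cvg_cst.
  rewrite addr0 in cv; apply: (cvgr_to_ge cv); exists n => // k /= nk.
  apply: le_trans (nrm2_triangle _ (a k) _) _; rewrite lerD2r nrm2BC.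
  by rewrite -(subnKC nk); exact: tele.
move=> /existsNP[m0 bad0].
have bad : exists m, ~~ (nrm2 (a m.+1 - a m) <= 2^-1 ^+ m).
  by exists m0; apply/negP.
case: (ex_minnP bad) => k kbad kmin; exists (a k) => // n good.
have nk : (n <= k)%N.
  by rewrite leqNgt; apply/negP => kn; move: kbad; rewrite good.
rewrite nrm2BC -(subnKC nk); apply: tele => m; rewrite subnKC // => mk.
by apply: contraLR mk => /kmin; rewrite -leqNgt.
Qed.

Section UltraproductTheory.
Variables (R : realType) (I : Type) (U : set_system I).
Context {FU : ProperFilter U}.
Variable (N : I -> tracialvN R).
Implicit Types (a b : linf N) (x y : uprod U N).

Lemma uclass0 : uclass (0 : linf N) = 0 :> uprod U N.
Proof. by apply: (addrI (uclass 0)); rewrite -uclassD !addr0. Qed.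

Lemma uclassN a : uclass (- a) = - uclass a :> uprod U N.
Proof. by apply/eqP; rewrite -addr_eq0 -uclassD addNr uclass0. Qed.

Lemma uclassB a b : uclass (a - b) = uclass a - uclass b :> uprod U N.
Proof. by rewrite uclassD uclassN. Qed.

Lemma uclassM a b : uclass (a * b) = uclass a * uclass b :> uprod U N.
Proof. by rewrite -umulE. Qed.

Lemma uclassZ k a : uclass (k *: a) = k *: uclass a :> uprod U N.
Proof. by rewrite -uscaleE. Qed.

Lemma uclass_star a : uclass (linf_star a) = star (uclass a) :> uprod U N.
Proof. by rewrite -ustarE. Qed.

Lemma uclass1 : uclass (1 : linf N) = 1 :> uprod U N.
Proof. by []. Qed.

Lemma uclass_ex x : exists a, x = uclass a.
Proof. by exists (urepr x); rewrite ureprK. Qed.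

Definition linf_mk (a : forall i, N i) (h : bounded_family a) : linf N :=
  Linf (introT (asboolP _) h).

(** The operator unit ball of the ultraproduct, described by contractive lifts instead of a norm on
    the quotient. *)
Definition uball : set (uprod U N) :=
  [set x | exists2 a : linf N, (forall i, op_bound 1 (a i)) & x = uclass a].

Lemma uballM x y : uball x -> uball y -> uball (x * y).
Proof.
move=> [a a1 ->] [b b1 ->]; exists (a * b); last by rewrite uclassM.
by move=> i; have := op_boundM ler01 (a1 i) (b1 i); rewrite mulr1.
Qed.

Lemma uball_star x : uball x -> uball (star x).
Proof.
move=> [a a1 ->]; exists (linf_star a); last by rewrite uclass_star.
by move=> i; exact: op_bound_star.
Qed.

Lemma uball_midpoint : midpoint_convex uball.
Proof.
move=> _ _ [a a1 ->] [b b1 ->]; exists (chalf R *: (a + b)).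
  by move=> i; exact: op_bound_midpoint.
by rewrite uclassZ uclassD.
Qed.

Lemma uball_absorb x : exists2 k : R, 0 < k & uball (k%:C%C *: x).
Proof.
have [a ->] := uclass_ex x; have [c c0 ac] := linfP a.
have c1 : 0 < c + 1 by lra.
exists (c + 1)^-1; first by rewrite invr_gt0.
exists ((c + 1)^-1%:C%C *: a); last by rewrite uclassZ.
move=> i xi; rewrite -[(_ *: a) i]/((c + 1)^-1%:C%C *: a i) vN_scaleE hnormZr.
rewrite ger0_norm ?invr_ge0 ?(ltW c1) // ler_pdivrMl // mul1r.
by apply: le_trans (ac i xi) _; rewrite ler_wpM2r ?hnorm_ge0 //; lra.
Qed.

(** * The standard representation and completeness of the unit ball *)

Section L2.
Variable L : L2_rep (U := U) N.
Let hp : psd_form (@inner R L) := inner_psd L.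
Let rP := L2_star_rep L.
Local Notation Omega := (L2_vec L).

Definition uvec x : L := L2_act x Omega.

Lemma L2_actD x y (xi : L) : L2_act (x + y) xi = L2_act x xi + L2_act y xi.
Proof. by have := rep_linear rP 1 x y xi; rewrite !scale1r. Qed.

Lemma L2_act0 (xi : L) : L2_act 0 xi = 0.
Proof. by apply: (addrI (L2_act 0 xi)); rewrite -L2_actD !addr0. Qed.

Lemma L2_actZ k x (xi : L) : L2_act (k *: x) xi = k *: L2_act x xi.
Proof. by have := rep_linear rP k x 0 xi; rewrite L2_act0 !addr0. Qed.

Lemma L2_actN x (xi : L) : L2_act (- x) xi = - L2_act x xi.
Proof. by rewrite -[- x]scaleN1r L2_actZ scaleN1r. Qed.

Lemma uvecD x y : uvec (x + y) = uvec x + uvec y.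
Proof. exact: L2_actD. Qed.

Lemma uvecB x y : uvec (x - y) = uvec x - uvec y.
Proof. by rewrite uvecD /uvec L2_actN. Qed.

Lemma uvecZ k x : uvec (k *: x) = k *: uvec x.
Proof. exact: L2_actZ. Qed.

Lemma uvecM x y : uvec (x * y) = L2_act x (uvec y).
Proof. exact: repM rP _ _ _. Qed.

Lemma uvec1 : uvec 1 = Omega.
Proof. exact: rep1 rP _. Qed.

Lemma L2_act_star x (xi eta : L) :
  inner (L2_act (star x) xi) eta = inner xi (L2_act x eta).
Proof. by rewrite (rep_star rP (star x)) starK. Qed.

Lemma inner_uvec x y : inner (uvec x) (uvec y) = inner (uvec (star y * x)) Omega.
Proof. by rewrite uvecM L2_act_star. Qed.

Lemma uvec_trC x y : inner (uvec (x * y)) Omega = inner (uvec (y * x)) Omega.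
Proof.
have [a ->] := uclass_ex x; have [b ->] := uclass_ex y.
rewrite -!uclassM.
have h1 := @L2_trace _ _ _ _ _ L (a * b); have h2 := @L2_trace _ _ _ _ _ L (b * a).
apply: (norm_cvg_unique (V := R[i]^o) h1).
rewrite (_ : (fun i => _) = fun i => tr ((b * a) i)) //.
by apply/funext => i; exact: (trC (trP (N i))).
Qed.

Lemma cvg_nrm2_uvec a : nrm2 (a i) @[i --> U] --> hnorm (uvec (uclass a)).
Proof.
have h : complex.Re (tr (star (a i) * a i)) @[i --> U] -->
    complex.Re (inner (uvec (uclass a)) (uvec (uclass a))).
  rewrite inner_uvec -uclass_star -uclassM; apply: complex_cvg_Re.
  exact: (@L2_trace _ _ _ _ _ L (linf_star a * a)).
exact: (cvg_comp _ _ h (@sqrt_continuous R _)).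
Qed.

Arguments cvg_nrm2_uvec : clear implicits.

Lemma uvec_inj : injective uvec.
Proof.
move=> x y e; apply/eqP; rewrite -subr_eq0; apply/eqP.
have : hnorm (uvec (x - y)) = 0 by rewrite uvecB e subrr hnorm0.
have [a ->] := uclass_ex (x - y) => a0.
rewrite -uclass0; apply/uclass_eq; rewrite subr0; apply/asboolP.
by rewrite -a0; exact: (cvg_nrm2_uvec _).
Qed.

Lemma hnorm_uvec_star x : hnorm (uvec (star x)) = hnorm (uvec x).
Proof.
have [a ->] := uclass_ex x; rewrite -uclass_star.
suff cv : nrm2 (linf_star a i) @[i --> U] --> hnorm (uvec (uclass a)).
  exact: Rcvg_unique (cvg_nrm2_uvec (linf_star a)) cv.
rewrite (_ : (fun i => _) = fun i => nrm2 (a i)); first exact: (cvg_nrm2_uvec _).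
by apply/funext => i; exact: nrm2_star.
Qed.

Lemma uvec_ball_le x y : uball x -> hnorm (uvec (x * y)) <= hnorm (uvec y).
Proof.
move=> [a a1 ->]; have [b ->] := uclass_ex y; rewrite -uclassM.
have h : nrm2 (b i) - nrm2 ((a * b) i) @[i --> U] -->
    hnorm (uvec (uclass b)) - hnorm (uvec (uclass (a * b))).
  by apply: cvgB; exact: (cvg_nrm2_uvec _).
rewrite -subr_ge0; apply: (cvgr_to_ge h); apply: nearW => i.
by rewrite subr_ge0 -[leRHS]mul1r; exact: nrm2_mull.
Qed.

Lemma uvec_ball_ler x y : uball y -> hnorm (uvec (x * y)) <= hnorm (uvec x).
Proof.
move=> y1; rewrite -hnorm_uvec_star starM -[leRHS]hnorm_uvec_star.
by apply: uvec_ball_le; exact: uball_star.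
Qed.

Lemma hnorm_Omega : hnorm Omega = 1.
Proof.
rewrite -uvec1 -uclass1.
suff cv : nrm2 ((1 : linf N) i) @[i --> U] --> (1 : R).
  exact: Rcvg_unique (cvg_nrm2_uvec 1) cv.
rewrite (_ : (fun i => _) = fun=> 1); first exact: cvg_cst.
by apply/funext => i; exact: nrm2_1.
Qed.

Lemma hnorm_uball x : uball x -> hnorm (uvec x) <= 1.
Proof. by move=> /(uvec_ball_le 1); rewrite mulr1 uvec1 hnorm_Omega. Qed.

(** Contractive lifts of a fast subsequence are treated index by index with [tracial_telescope]. For
    each [n], the first [n] step estimates hold at U-many indices, and there the limit is within
    $2\cdot 2^{-n}$ of the lift. *)
Lemma uball_complete (x : nat -> uprod U N) :
  (forall n, uball (x n)) -> hcauchy (uvec \o x) ->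
  exists2 x0, uball x0 & hcvg \oo (uvec \o x) (uvec x0).
Proof.
move=> xb xC.
have ex n : exists t, forall p q, (t <= p)%N -> (t <= q)%N ->
    hnorm (uvec (x p) - uvec (x q)) < 2^-1 ^+ n by exact/xC/half_expr_gt0.
have [t ht] := choice ex.
(* Taking the maximum makes [g n] dominate [t m] for every [m <= n], so both [g m] and [g m.+1] lie
   in the range where terms differ by less than $2^{-m}$. *)
pose g n := (\max_(m < n.+1) t m)%N.
have tg n m : (m <= n)%N -> (t m <= g n)%N.
  by move=> mn; have := @leq_bigmax _ (fun m : 'I_n.+1 => t m) (Ordinal (mn : m < n.+1)%N).
have lift n : exists a : linf N, (forall i, op_bound 1 (a i)) /\ x (g n) = uclass a.
  by have [a a1 e] := xb (g n); exists a.
have [a ha] := choice lift.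
have a1 n i : op_bound 1 (a n i) by have [h _] := ha n.
have lim i : exists b : N i, op_bound 1 b /\ forall n,
    (forall m, (m < n)%N -> nrm2 (a m.+1 i - a m i) <= 2^-1 ^+ m) ->
    nrm2 (a n i - b) <= 2 * 2^-1 ^+ n.
  have [b b1 hb] := @tracial_telescope _ (N i) (fun n => a n i) (fun n => a1 n i).
  by exists b.
pose b i := projT1 (cid (lim i)).
have hb i := projT2 (cid (lim i)).
have bb : bounded_family b by exists 1 => i; have [h _] := hb i.
exists (uclass (linf_mk bb)).
  by exists (linf_mk bb) => // i; have [h _] := hb i.
have step m : \forall i \near U, nrm2 (a m.+1 i - a m i) <= 2^-1 ^+ m.
  have cv := cvg_nrm2_uvec (a m.+1 - a m).
  apply: filterS (cvgr_lt _ cv (2^-1 ^+ m) _) => [i /ltW //|].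
  rewrite uclassB uvecB -!(ha _).2; apply: ht; exact: tg.
have close n : hnorm (uvec (x (g n)) - uvec (uclass (linf_mk bb))) <= 2 * 2^-1 ^+ n.
  rewrite (ha n).2 -uvecB -uclassB.
  apply: (cvgr_to_le (cvg_nrm2_uvec _)).
  have : \forall i \near U, forall m, (m < n)%N ->
      nrm2 (a m.+1 i - a m i) <= 2^-1 ^+ m.
    elim: n => [|n IH]; first by apply: nearW.
    near=> i => m; rewrite ltnS leq_eqVlt => /orP[/eqP ->|mn].
      by near: i; exact: step.
    by move: m mn; near: i; exact: IH.
  by apply: filterS => i hi; have [_ h] := hb i; exact: h.
apply/hcvgP => e e0.
have cv : 3 * 2^-1 ^+ n @[n --> \oo] --> (3 * 0 : R).
  by apply: cvgMr; exact: half_expr_cvg0.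
rewrite mulr0 in cv; have [n _ hn] := cvgr_lt _ cv _ e0.
exists (g n) => // p /= gp.
apply: le_lt_trans (form_norm_triangle hp _ (uvec (x (g n))) _) _.
have := ht n p (g n) (leq_trans (tg n n (leqnn n)) gp) (tg n n (leqnn n)).
by have := close n; have := hn n (leqnn n) => /=; rewrite -!/(hnorm _); lra.
Unshelve. all: by end_near. Qed.

End L2.

End UltraproductTheory.

Arguments cvg_nrm2_uvec {R I U FU N} L a.

Section InverseAutomorphism.
Variables (R : realType) (N : tracialvN R) (f : aut N).

Lemma aut_inverse : exists g : aut N, cancel f g /\ cancel g f.
Proof.
have [g fK gK] := aut_bij f.
have gl : linear g.
  by move=> a x y; apply: (can_inj fK); rewrite aut_linear !gK.
have gM x y : g (x * y) = g x * g y.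
  by apply: (can_inj fK); rewrite autM !gK.
have gs x : g (star x) = star (g x).
  by apply: (can_inj fK); rewrite aut_star !gK.
have gb : bijective g by exists f.
by exists (Aut gl gM gs gb); split.
Qed.

Lemma aut_nrm2 (x : N) : Defs.factor N -> nrm2 (f x) = nrm2 x.
Proof. by move=> Nf; rewrite /nrm2 -aut_star -autM aut_tr. Qed.

End InverseAutomorphism.

(** * Automorphisms of the ultraproduct *)

Section UltraproductAutomorphism.
Variables (R : realType) (I : Type) (U : set_system I).
Context {FU : ProperFilter U}.
Variable (N : I -> tracialvN R).
Hypothesis Nf : forall i, Defs.factor (N i).
Implicit Types (a b : linf N) (x y : uprod U N).

Definition uaut (f : forall i, aut (N i)) : uprod U N -> uprod U N :=
  uprod_map (fun i => f i).

Section OneFamily.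
Variable f : forall i, aut (N i).

Lemma linf_aut_subproof a : bounded_family (fun i => f i (a i)).
Proof.
have [c c0 h] := linfP a; exists c => i; exact: aut_op_bound.
Qed.

Definition linf_aut a : linf N := linf_mk (linf_aut_subproof a).

(** Each [f i] preserves the trace and hence the 2-norm, so the null ideal is preserved and the
    class does not depend on the lift. *)
Lemma uautE a : uaut f (uclass a) = uclass (linf_aut a).
Proof.
rewrite /uaut /uprod_map; set b := urepr (uclass a).
have -> : insubd (0 : linf N) (fun i => f i (b i)) = linf_aut b.
  by apply: val_inj; rewrite /= insubdK //; apply/asboolP; exact: linf_aut_subproof.
apply/uclass_eq.
have : b - a \in @null_ideal R I U N by apply/uclass_eq; rewrite ureprK.
apply: (@null_ideal_le _ _ _ _ _ _ _ 1) => // i; rewrite mul1r.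
rewrite -[(linf_aut b - linf_aut a) i]/(f i (b i) - f i (a i)) -autB.
by rewrite aut_nrm2.
Qed.

Lemma uaut_linear k x y : uaut f (k *: x + y) = k *: uaut f x + uaut f y.
Proof.
have [a ->] := uclass_ex x; have [b ->] := uclass_ex y.
rewrite -uclassZ -uclassD !uautE -uclassZ -uclassD; congr uclass.
by apply: linf_ext => i; exact: (aut_linear (f i)).
Qed.

Lemma uautM x y : uaut f (x * y) = uaut f x * uaut f y.
Proof.
have [a ->] := uclass_ex x; have [b ->] := uclass_ex y.
rewrite -uclassM !uautE -uclassM; congr uclass.
by apply: linf_ext => i; exact: (autM (f i)).
Qed.

Lemma uaut_star x : uaut f (star x) = star (uaut f x).
Proof.
have [a ->] := uclass_ex x; rewrite -uclass_star !uautE -uclass_star; congr uclass.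
by apply: linf_ext => i; exact: (aut_star (f i)).
Qed.

Lemma uaut1 : uaut f 1 = 1.
Proof.
rewrite -uclass1 uautE; congr uclass.
by apply: linf_ext => i; exact: (aut1 (f i)).
Qed.

Lemma uautD x y : uaut f (x + y) = uaut f x + uaut f y.
Proof. by have := uaut_linear 1 x y; rewrite !scale1r. Qed.

Lemma uaut0 : uaut f 0 = 0.
Proof. by apply: (addrI (uaut f 0)); rewrite -uautD !addr0. Qed.

Lemma uautZ k x : uaut f (k *: x) = k *: uaut f x.
Proof. by have := uaut_linear k x 0; rewrite uaut0 !addr0. Qed.

Lemma uautB x y : uaut f (x - y) = uaut f x - uaut f y.
Proof. by rewrite uautD -[- y]scaleN1r uautZ scaleN1r. Qed.

Lemma uaut_uball x : uball x -> uball (uaut f x).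
Proof.
move=> [a a1 ->]; exists (linf_aut a); last exact: uautE.
by move=> i; exact: aut_op_bound.
Qed.

Variable L : L2_rep (U := U) N.

Lemma hnorm_uvec_uaut x : hnorm (uvec L (uaut f x)) = hnorm (uvec L x).
Proof.
have [a ->] := uclass_ex x; rewrite uautE.
suff cv : nrm2 (linf_aut a i) @[i --> U] --> hnorm (uvec L (uclass a)).
  exact: Rcvg_unique (cvg_nrm2_uvec L (linf_aut a)) cv.
rewrite (_ : (fun i => _) = fun i => nrm2 (a i)); first exact: (cvg_nrm2_uvec _ _).
by apply/funext => i; exact: aut_nrm2.
Qed.

End OneFamily.

Lemma uaut_inverse (f : forall i, aut (N i)) :
  exists g : forall i, aut (N i), cancel (uaut f) (uaut g) /\ cancel (uaut g) (uaut f).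
Proof.
pose g i := projT1 (cid (aut_inverse (f i))).
have hg i : cancel (f i) (g i) /\ cancel (g i) (f i).
  exact: projT2 (cid (aut_inverse (f i))).
exists g; split=> x; have [a ->] := uclass_ex x; rewrite !uautE; congr uclass;
  apply: linf_ext => i; [exact: (hg i).1|exact: (hg i).2].
Qed.

Lemma uclass_re_part a :
  exists2 b : linf N, (forall i, star (b i) = b i)
    & uclass b = re_part (uclass a) :> uprod U N.
Proof.
exists (2^-1 *: (a + linf_star a)); first by move=> i; exact: star_re_part.
by rewrite uclassZ uclassD uclass_star.
Qed.

(** The real part of any lift of [x] is a self-adjoint lift, so the Cayley transform can be formed
    at each index. *)
Lemma uprod_cayley x : star x = x ->
  exists2 s, cayley_inverse x s & uball (cayley s).
Proof.
move=> hx; have [a0 xa] := uclass_ex x; have [a ha ae] := uclass_re_part a0.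
have {a0 xa ae}xa : x = uclass a.
  rewrite ae -xa /re_part hx -mulr2n -[x *+ 2]scaler_nat scalerA.
  by rewrite mulVf ?pnatr_eq0 // scale1r.
have ex i := vN_cayley (ha i).
pose s i := projT1 (cid (ex i)).
have hs i : [/\ cayley_inverse (a i) (s i), op_bound 1 (cayley (s i))
    & op_bound 1 (star (cayley (s i)))] by exact: projT2 (cid (ex i)).
have sb : bounded_family s.
  exists 1 => i; have [_ h _] := hs i.
  have -> : s i = chalf R *: (cayley (s i) + 1).
    by rewrite /cayley subrK scaler_nat mulr2n chalf_double.
  by apply: op_bound_midpoint => //; exact: op_bound1.
pose t := linf_mk sb.
exists (uclass t).
  rewrite xa /cayley_inverse -uclass1 -uclassZ -uclassB -!uclassM.
  by split; congr uclass; apply: linf_ext => i; have [[]] := hs i.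
exists (2 *: t - 1); first by move=> i; have [] := hs i.
by rewrite uclassB uclassZ.
Qed.

End UltraproductAutomorphism.

(** * Averaging over unitaries *)

Section InverseClosed.
Variables (R : realType) (A : starAlgType R).

(** These closure properties keep real parts, imaginary parts and Cayley transforms of elements of
    [B] inside [B]. They hold for the subfactor and for relative commutants of self-adjoint sets. *)
Definition inverse_closed_star (B : set A) := [/\ B 1,
  forall k x y, B x -> B y -> B (k *: x + y),
  forall x, B x -> B (star x) &
  forall x s, B x -> x * s = 1 -> s * x = 1 -> B s].

Lemma rel_commutant_inverse_closed (S : set A) :
  (forall x, S x -> S (star x)) -> inverse_closed_star (rel_commutant S).
Proof.
move=> Ss; split=> [y _|k x y hx hy z Sz|x hx y Sy|x s hx xs sx y Sy].
- by rewrite mul1r mulr1.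
- by rewrite mulrDl mulrDr -scalerAl -scalerAr hx // hy.
- by rewrite -{1}[y]starK -starM -hx ?starM ?starK //; exact: Ss.
- by rewrite -[s * y]mulr1 -xs mulrA -[s * y * x]mulrA -hx // mulrA sx mul1r.
Qed.

End InverseClosed.

Section Averaging.
Variables (R : realType) (I : Type) (U : set_system I).
Context {FU : ProperFilter U}.
Variable (N : I -> tracialvN R).
Hypothesis Nf : forall i, Defs.factor (N i).
Variable L : L2_rep (U := U) N.
Variable f : forall i, aut (N i).
Local Notation Q := (uprod U N).
Local Notation beta := (uaut f).
Implicit Types (x y z v : Q) (C B : set Q).

(** Sequential 2-norm closedness tested on limits inside the ball; for subsets of the ball,
    [uball_complete] turns it into closedness in the Hilbert space. *)
Definition uclosed C := forall (u : nat -> Q) x, (forall n, C (u n)) ->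
  uball x -> hcvg \oo (uvec L \o u) (uvec L x) -> C x.

Lemma uclosed_hclosed C : C `<=` @uball _ _ U _ N -> uclosed C -> hclosed (uvec L @` C).
Proof.
move=> Cb Cc u l Cu ul.
have ex n : exists x, C x /\ uvec L x = u n by have [x Cx <-] := Cu n; exists x.
have [x hx] := choice ex.
have {}ul : hcvg \oo (uvec L \o x) l.
  by rewrite (_ : _ \o _ = u) //; apply/funext => n; exact: (hx n).2.
have [n|x0 x0b xx0] := uball_complete _ (hcvg_cauchy ul).
  by apply: Cb; exact: (hx n).1.
exists x0; last exact: hcvg_unique xx0 ul.
by apply: Cc x0b xx0 => n; exact: (hx n).1.
Qed.

Lemma uvec_midpoint C : midpoint_convex C -> midpoint_convex (uvec L @` C).
Proof.
move=> Cm _ _ [x Cx <-] [y Cy <-]; exists (chalf R *: (x + y)); first exact: Cm.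
by rewrite uvecZ uvecD.
Qed.

(* The element of minimal 2-norm of an invariant convex set is invariant, and a
   vector fixed by all Cayley transforms is an intertwiner. *)
Lemma uaverage B C : inverse_closed_star B -> C !=set0 ->
  C `<=` @uball _ _ U _ N -> midpoint_convex C -> uclosed C ->
  (forall v y, B v -> unitary v -> uball v -> C y -> C (v * y * star (beta v))) ->
  exists2 z, C z & forall x, B x -> x * z = z * beta x.
Proof.
move=> [B1 Bl Bs BV] [x0 Cx0] Cb Cm Cc Cinv.
have [|||_ [[z Cz <-] zmin zuniq]] := @hilbert_min_norm _ L (uvec L @` C).
- by exists (uvec L x0), x0.
- exact: uvec_midpoint.
- exact: uclosed_hclosed.
have BZ k x : B x -> B (k *: x).
  move=> Bx; have B0 : B 0 by have := Bl (-1) 1 1 B1 B1; rewrite scaleN1r addNr.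
  by have := Bl k x 0 Bx B0; rewrite addr0.
have BD x y : B x -> B y -> B (x + y).
  by move=> Bx By; have := Bl 1 x y Bx By; rewrite scale1r.
exists z => //.
suff sa h : B h -> star h = h -> h * z = z * beta h.
  move=> x Bx.
  have Bre : B (re_part x) by apply/BZ/BD => //; exact: Bs.
  have Bim : B (im_part x).
    by apply: BZ; rewrite addrC -scaleN1r; apply: Bl => //; exact: Bs.
  rewrite (re_im_partE x).
  have := sa _ Bre (star_re_part x); have := sa _ Bim (star_im_part x).
  move: (re_part x) (im_part x) => a b hb ha.
  by rewrite uautD // uautZ // mulrDl mulrDr -scalerAl -scalerAr ha hb.
move=> Bh hh; have [s hs vb] := uprod_cayley hh.
have Bden : B (1 - 'i *: h).
  by rewrite addrC -scaleNr; exact: Bl.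
have B_s : B s by case: hs => gs sg; exact: BV gs sg.
have Bv : B (cayley s).
  by rewrite /cayley -scaleN1r addrC; apply: Bl => //; exact: BZ.
have V := cayley_unitary hh hs.
have bv : beta (cayley s) = cayley (beta s).
  by rewrite /cayley uautB // uautZ // uaut1.
have hs' : cayley_inverse (beta h) (beta s).
  by case: hs => a b; split;
    rewrite -(uaut1 Nf f) -uautZ // -uautB // -uautM // ?a ?b.
apply: (cayley_intertwine hs hs'); rewrite -bv.
set v := cayley s in bv Bv V vb *.
have e : v * z * star (beta v) = z.
  apply: (@uvec_inj _ _ _ _ _ L); apply: zuniq.
    by exists (v * z * star (beta v)) => //; exact: Cinv.
  apply: le_trans (uvec_ball_ler _ _ _) _.
    by apply: uball_star; exact: uaut_uball.
  exact: uvec_ball_le.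
rewrite -{2}e -mulrA -uaut_star // -uautM // V.1 uaut1 //.
by rewrite mulr1.
Qed.

End Averaging.

(** * Unitary intertwiners *)

Section Contractions.
Variables (R : realType) (H : hilbert R) (N : vNalg H).
Implicit Types (a y : N).
Let hp : psd_form (@inner R H) := inner_psd H.

Lemma contraction_sqr a xi : op_bound 1 a -> hnorm (a xi) ^+ 2 <= hnorm xi ^+ 2.
Proof.
by move=> a1; rewrite ler_pXn2r ?nnegrE ?hnorm_ge0 //; have := a1 xi; rewrite mul1r.
Qed.

(** For [e = 1 - star a * a] this is the operator inequality $e^2\le e$, evaluated at [xi]. *)
Lemma defect_ge a xi : op_bound 1 a ->
  hnorm ((1 - star a * a) xi) ^+ 2 <= hnorm xi ^+ 2 - hnorm (a xi) ^+ 2.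
Proof.
move=> a1; have := contraction_sqr (a xi) (op_bound_star ler01 a1).
rewrite !vN_actE [X in _ -> X <= _](sqr_form_normD hp) -!/(hnorm _) hnormN.
by rewrite (psdNr hp) inner_starr cReN -sqr_hnorm; lra.
Qed.

Lemma op_bound_defect a : op_bound 1 a -> op_bound 1 (1 - star a * a).
Proof.
move=> a1 xi; rewrite mul1r -(ler_pXn2r (n := 2)) ?nnegrE ?hnorm_ge0 //.
by apply: le_trans (defect_ge xi a1) _; rewrite gerBl sqr_ge0.
Qed.

Lemma op_bound_sqr a : (forall xi, hnorm (a xi) ^+ 2 <= hnorm xi ^+ 2) ->
  op_bound 1 a.
Proof.
by move=> h xi; rewrite mul1r -(ler_pXn2r (n := 2)) ?nnegrE ?hnorm_ge0.
Qed.

(** The scalar inequality $|r+tr(1-r^2)|\le 1$ for $0\le r\le 1$ and $|t|\le 1/2$, carried out on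
    vectors. It forces an extreme contraction to be a partial isometry. *)
Lemma contraction_defect_perturb a (t : R) : op_bound 1 a -> -1 <= 2 * t <= 1 ->
  op_bound 1 (a + t%:C%C *: (a * (1 - star a * a))).
Proof.
move=> a1 /andP[t1 t2]; apply: op_bound_sqr => xi.
have d1 := defect_ge xi a1.
rewrite vN_addE vN_scaleE vN_mulE; set eta := (1 - star a * a) xi in d1 *.
rewrite [leLHS](sqr_form_normD hp) -!/(hnorm _) hnormZr exprMn.
rewrite real_normK ?num_real // (psdZr hp).
have -> : (t%:C%C : R[i])^* = t%:C%C by exact: conjc_real.
have e1 : complex.Re (inner (a xi) (a eta)) =
    complex.Re (inner xi eta) - hnorm eta ^+ 2.
  rewrite -[inner (a xi) (a eta)]inner_starl -vN_mulE.
  have -> : (star a * a) xi = xi - eta by rewrite /eta !vN_actE subKr.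
  by rewrite (psdDl hp) (psdNl hp) cReB sqr_hnorm.
have e2 : hnorm (a xi) ^+ 2 = hnorm xi ^+ 2 - complex.Re (inner xi eta).
  rewrite !sqr_hnorm -inner_starl -vN_mulE.
  have -> : (star a * a) xi = xi - eta by rewrite /eta !vN_actE subKr.
  by rewrite (psdDl hp) (psdNl hp) cReB [in X in _ = _ - X](psd_ReC hp).
rewrite Defs.ReMr e1 e2.
have d2 := contraction_sqr eta a1.
have d3 : hnorm eta ^+ 2 <= complex.Re (inner xi eta) by lra.
move: (hnorm_ge0 eta) d2 d3; rewrite -/(hnorm (a eta)).
set A := hnorm (a eta); set E := hnorm eta; set r := complex.Re _.
move=> E0 d2 d3.
have t4 : t ^+ 2 * A ^+ 2 <= 1 / 4 * E ^+ 2.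
  apply: ler_pM; rewrite ?sqr_ge0 //; nra.
have : 2 * (t * (r - E ^+ 2)) <= r - E ^+ 2 by nra.
have := sqr_ge0 E; lra.
Qed.

(** Moving [1 - a * star a] across [a] turns it into [1 - star a * a], so the cross term is at most
    a multiple of $|\eta|^2$, which [defect_ge] bounds by $|\xi|^2-|a\xi|^2$. The bound 1/4 on $|t|$
    absorbs the cross and square terms together. *)
Lemma contraction_corner_perturb a y (t : R) :
  op_bound 1 a -> op_bound 1 y -> -1 <= 4 * t <= 1 ->
  op_bound 1 (a + t%:C%C *: ((1 - a * star a) * y * (1 - star a * a))).
Proof.
move=> a1 y1 /andP[t1 t2]; apply: op_bound_sqr => xi.
have d1 := defect_ge xi a1.
rewrite vN_addE vN_scaleE !vN_mulE; set eta := (1 - star a * a) xi in d1 *.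
rewrite [leLHS](sqr_form_normD hp) -!/(hnorm _) hnormZr exprMn.
rewrite real_normK ?num_real // (psdZr hp).
have -> : (t%:C%C : R[i])^* = t%:C%C by exact: conjc_real.
set z := (1 - a * star a) (y eta).
have zb : hnorm z ^+ 2 <= hnorm eta ^+ 2.
  have as1 := op_bound_star ler01 a1.
  have := contraction_sqr (y eta) (op_bound_defect as1); rewrite starK => h.
  exact: le_trans h (contraction_sqr eta y1).
have e1 : inner (a xi) z = inner (a eta) (y eta).
  rewrite /z -[in LHS](_ : star (1 - a * star a) = 1 - a * star a).
    rewrite inner_starr -[in RHS]vN_mulE -[in LHS]vN_mulE; congr (inner (vN_op _ _) _).
    by rewrite mulrBr mulrBl mulr1 mul1r mulrA.
  by rewrite starB star1 starM starK.
rewrite Defs.ReMr e1.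
have h := le_trans (Re_inner_le (a eta) (y eta))
  (ler_pM (hnorm_ge0 _) (hnorm_ge0 _) (a1 eta) (y1 eta)).
rewrite !mul1r -expr2 ler_norml in h; move: h => /andP[h1 h2].
move: zb d1 h1 h2; have := hnorm_ge0 eta.
set Z := hnorm z; set E := hnorm eta; set r := complex.Re _ => E0 zb d1 h1 h2.
have z4 : t ^+ 2 * Z ^+ 2 <= 1 / 4 * E ^+ 2.
  apply: ler_pM; rewrite ?sqr_ge0 //; nra.
have : 2 * (t * r) <= 1 / 2 * E ^+ 2 by nra.
have := sqr_ge0 E; lra.
Qed.

End Contractions.

(** * Relative commutants with trivial center and intertwiners *)

Section RelativeCommutants.
Variables (R : realType) (I : Type) (U : set_system I).
Context {FU : ProperFilter U}.
Variable (N : I -> tracialvN R).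
Hypothesis Nf : forall i, Defs.factor (N i).
Variable L : L2_rep (U := U) N.
Local Notation Q := (uprod U N).
Local Notation vec := (uvec L).
Let hp : psd_form (@inner R L) := inner_psd L.
Implicit Types (x y z v e g : Q) (C B S : set Q).

Lemma uvec_mul_bound b c : exists K : R, forall x,
  hnorm (vec (b * x * c)) <= K * hnorm (vec x).
Proof.
have [k k0 kb] := uball_absorb b; have [m m0 mc] := uball_absorb c.
have km0 : 0 < k * m by rewrite mulr_gt0.
exists (k * m)^-1 => x; rewrite ler_pdivlMl //.
have h := le_trans (uvec_ball_ler L ((k%:C%C *: b) * x) mc) (uvec_ball_le L x kb).
rewrite -!scalerAl -!scalerAr scalerA -rmorphM /= uvecZ hnormZr in h.
by rewrite gtr0_norm in h.
Qed.

Lemma ucvg_equation (u : nat -> Q) x a b c d :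
  (forall n, a * u n * b = c * u n * d) -> hcvg \oo (vec \o u) (vec x) ->
  a * x * b = c * x * d.
Proof.
move=> e ux; apply: (@uvec_inj _ _ _ _ _ L).
have cv p q : hcvg \oo (fun n => vec (p * u n * q)) (vec (p * x * q)).
  have [K hK] := uvec_mul_bound p q; apply: dist_le_cvg ux => n.
  rewrite subr0 ger0_norm ?hnorm_ge0 // -[X in hnorm X]uvecB -mulrBl -mulrBr.
  by rewrite /= -uvecB; exact: hK.
have := cv a b; rewrite (_ : (fun n => _) = fun n => vec (c * u n * d)).
  by move=> h; exact: hcvg_unique h (cv c d).
by apply/funext => n; rewrite e.
Qed.

Definition id_family : forall i, aut (N i) := fun i => id_aut (N i).

Lemma uaut_id x : uaut id_family x = x.
Proof.
by have [a ->] := uclass_ex x; rewrite uautE //; congr uclass; exact: linf_ext.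
Qed.

(* The scalars are the only candidates for the average of [g * star g] over the
   unitaries of a relative commutant with trivial center. *)
Lemma rel_commutant_prime S e g : (forall x, S x -> S (star x)) ->
  trivial_center (rel_commutant S) -> rel_commutant S g ->
  (forall x, rel_commutant S x -> e * x * g = 0) -> e = 0 \/ g = 0.
Proof.
move=> Ss Sf Pg eg; set P := rel_commutant S.
have PI : inverse_closed_star P by exact: rel_commutant_inverse_closed.
have [P1 Pl Ps PV] := PI.
have PM x y : P x -> P y -> P (x * y).
  by move=> Px Py z Sz; rewrite -mulrA Py // mulrA Px // mulrA.
have [k k0 kg] := uball_absorb g.
set h := k%:C%C *: g in kg.
have Ph : P h.
  have P0 : P 0 by move=> y _; rewrite mul0r mulr0.
  by rewrite /h -[_ *: _]addr0; exact: Pl.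
have eh x : P x -> e * x * h = 0 by move=> Px; rewrite /h -scalerAr eg // scaler0.
pose y0 := h * star h.
(* The conditions are those preserved by conjugation with unitaries of [P]: membership in [P],
   annihilation by all [e * x], and the trace of [h * star h]. *)
pose C : set Q := [set y | [/\ uball y, P y, forall x, P x -> e * x * y = 0
  & inner (vec y) (L2_vec L) = inner (vec y0) (L2_vec L)]].
have [|||||z [zb Pz ez zt] zc] := @uaverage _ _ _ _ _ Nf L id_family P C PI.
- exists y0; split=> //.
  + by apply: uballM => //; exact: uball_star.
  + by apply: PM => //; exact: Ps.
  + by move=> x Px; rewrite /y0 mulrA eh // mul0r.
- by move=> y [].
- move=> x y [xb Px ex xt] [yb Py ey yt]; split.
  + exact: uball_midpoint.
  + have Pxy : P (x + y) by rewrite -[x]scale1r; exact: Pl.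
    have P0 : P 0 by move=> ? _; rewrite mul0r mulr0.
    by rewrite -[_ *: _]addr0; exact: Pl.
  + by move=> s Psx; rewrite -scalerAr mulrDr ex // ey // addr0 scaler0.
  + rewrite uvecZ uvecD (psdZl hp) (psdDl hp) xt yt.
    exact: (@chalf_double _ R[i]^o).
- move=> u x Cu xb ux; split=> //.
  + move=> y Sy; have := @ucvg_equation u x 1 y y 1.
    rewrite !mul1r !mulr1; apply=> // n; rewrite !mul1r !mulr1.
    by have [_ Pu _ _] := Cu n; exact: Pu.
  + move=> y Py; have := @ucvg_equation u x (e * y) 1 0 1.
    rewrite !mul0r !mulr1; apply=> // n; rewrite !mul0r !mulr1.
    by have [_ _ eu _] := Cu n; exact: eu.
  + by apply: (inner_limit ux) => n; have [] := Cu n.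
- move=> v y Pv [vv vv'] vb [yb Py ey yt]; rewrite uaut_id; split.
  + by apply: uballM; [exact: uballM|exact: uball_star].
  + exact: (PM _ _ (PM _ _ Pv Py) (Ps _ Pv)).
  + by move=> x Px; rewrite !mulrA -[e * x * v]mulrA ey ?mul0r //; exact: PM.
  + by rewrite uvec_trC mulrA vv mul1r.
(* The average is central in [P], hence a scalar, and [e] annihilates it. Its trace is that of
   [h * star h], so the scalar vanishes only if [h] does. *)
have [a za] : exists a : R[i], z = a *: 1.
  by apply: Sf => // y Py; rewrite zc // uaut_id.
have := ez 1 P1; rewrite mulr1 za -scalerAr mulr1 => /eqP.
rewrite scaler_eq0 => /orP[/eqP a0|/eqP ->]; last by left.
right; have : h = 0.
  rewrite -[h]starK -(star0 Q); congr star.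
  apply: (@uvec_inj _ _ _ _ _ L).
  have -> : vec 0 = 0 by exact: L2_act0.
  apply: inner_eq0; rewrite inner_uvec starK -/y0 -zt za a0 scale0r.
  by rewrite /uvec L2_act0 (psd0l hp).
move=> /eqP; rewrite scaler_eq0 => /orP[/eqP /(congr1 (@complex.Re R)) /= kk|/eqP //].
by move: k0; rewrite kk ltxx.
Qed.

Variable f : forall i, aut (N i).
Local Notation beta := (@uaut R I U FU N f).

Definition intertwiner B w := forall x, B x -> x * w = w * beta x.

Lemma intertwiner_star B w x : (forall y, B y -> B (star y)) ->
  intertwiner B w -> B x -> star w * x = beta x * star w.
Proof.
move=> Bs wi Bx; rewrite -[x in LHS]starK -starM wi ?starM; last exact: Bs.
by rewrite uaut_star // starK.
Qed.

Lemma rel_commutant_uaut_factor B : trivial_center (rel_commutant B) ->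
  trivial_center (rel_commutant (beta @` B)).
Proof.
move=> Bf z Pz Pc; have [g [bg gb]] := uaut_inverse (U := U) Nf f.
have gi : injective beta by exact: can_inj bg.
have [|y Py|a e] := Bf (uaut g z).
- move=> x Bx; apply: gi; rewrite !uautM // gb; apply: Pz; exact: imageP.
- apply: gi; rewrite !uautM // gb; apply: Pc => _ [x Bx <-].
  by rewrite -!uautM // Py.
- by exists a; rewrite -[z]gb e uautZ // uaut1.
Qed.

Lemma intertwiner_unitary B w0 : (forall x, B x -> B (star x)) ->
  trivial_center (rel_commutant B) ->
  uball w0 -> intertwiner B w0 -> w0 != 0 ->
  exists w, [/\ uball w, intertwiner B w & unitary w].
Proof.
move=> Bs Bf w0b w0i w00.
pose X : set Q := [set w | uball w /\ intertwiner B w].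
have [|_ [x [xb _] <-]||_ [w [wb wi] <-] wext] :=
  @hilbert_extreme_point _ L (vec @` X) 1.
- by exists (vec w0), w0.
- exact: hnorm_uball.
- apply: uclosed_hclosed; first by move=> x [].
  move=> u x Xu xb ux; split=> // y By.
  have := @ucvg_equation u x y 1 1 (beta y).
  rewrite !mul1r !mulr1; apply=> // n; rewrite !mul1r !mulr1.
  by have [_] := Xu n; exact.
have ext d : X (w + d) -> X (w - d) -> d = 0.
  move=> Xp Xm; apply: (@uvec_inj _ _ _ _ _ L).
  have -> : vec 0 = 0 by exact: L2_act0.
  apply: wext; first by exists (w + d); rewrite ?uvecD.
  by exists (w - d); rewrite ?uvecB.
have [a a1 wa] := wb.
have ws x : B x -> star w * x = beta x * star w by exact: intertwiner_star.
have iD x y : intertwiner B x -> intertwiner B y -> intertwiner B (x + y).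
  by move=> xi yi s Bx; rewrite mulrDl mulrDr xi // yi.
have iZ k x : intertwiner B x -> intertwiner B (k *: x).
  by move=> xi s Bx; rewrite -scalerAl -scalerAr xi.
have qc : rel_commutant B (w * star w).
  by move=> x Bx; rewrite -[LHS]mulrA ws // mulrA -wi // [RHS]mulrA.
have pc : rel_commutant (beta @` B) (star w * w).
  by move=> _ [x Bx <-]; rewrite -[LHS]mulrA -wi // !mulrA ws.
pose e := 1 - w * star w; pose e' := 1 - star w * w.
have ec : rel_commutant B e.
  by move=> x Bx; rewrite /e mulrBl mulrBr mul1r mulr1 qc.
have ec' : rel_commutant (beta @` B) e'.
  by move=> x Bx; rewrite /e' mulrBl mulrBr mul1r mulr1 pc.
have iM x s t : rel_commutant B s -> rel_commutant (beta @` B) t ->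
    intertwiner B x -> intertwiner B (s * x * t).
  move=> sc tc xi y By; rewrite !mulrA -sc // -[s * y * x]mulrA xi //.
  by rewrite -!mulrA tc //; exact: imageP.
(* Adding or subtracting half of [w * e'] stays among the contractive intertwiners, so extremality
   kills it: [w] is a partial isometry. *)
have we' : w * e' = 0.
  have we'i : intertwiner B (w * e').
    have c1 : rel_commutant B 1 by move=> x _; rewrite mul1r mulr1.
    by have := iM w 1 e' c1 ec' wi; rewrite mul1r.
  have lift (t : R) : -1 <= 2 * t <= 1 -> uball (w + t%:C%C *: (w * e')).
    move=> t1; exists (a + t%:C%C *: (a * (1 - linf_star a * a))).
      by move=> i; exact: contraction_defect_perturb.
    by rewrite /e' wa uclassD uclassZ uclassM uclassB uclassM uclass_star.
  have /eqP : (2^-1 : R)%:C%C *: (w * e') = 0.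
    apply: ext; split.
    - by apply: lift; rewrite mulfV // lexx andbT; lra.
    - by apply: iD => //; exact: iZ.
    - rewrite -scaleNr -rmorphN /=; apply: lift.
      by rewrite mulrN mulfV // lexx /=; lra.
    - by rewrite -scaleNr; apply: iD => //; exact: iZ.
  rewrite scaler_eq0 => /orP[/eqP /(congr1 (@complex.Re R)) /= /eqP|/eqP //].
  by rewrite invr_eq0 pnatr_eq0.
(* Extremality again, now for the corner perturbations with [t] equal to 1/4 and -1/4; [y] is first
   scaled into the ball. *)
have corner y : intertwiner B y -> e * y * e' = 0.
  move=> yi; have [k k0 [b b1 kb]] := uball_absorb y.
  have lift (t : R) : -1 <= 4 * t <= 1 ->
      uball (w + t%:C%C *: (e * (k%:C%C *: y) * e')).
    move=> t1; exists (a + t%:C%C *: ((1 - a * linf_star a) * b * (1 - linf_star a * a))).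
      by move=> i; exact: contraction_corner_perturb.
    by rewrite /e /e' kb wa uclassD uclassZ !uclassM !uclassB !uclassM uclass_star.
  have int : intertwiner B (e * (k%:C%C *: y) * e') by apply: iM => //; exact: iZ.
  have /eqP : (4^-1 : R)%:C%C *: (e * (k%:C%C *: y) * e') = 0.
    apply: ext; split.
    - by apply: lift; rewrite mulfV // lexx andbT; lra.
    - by apply: iD => //; exact: iZ.
    - rewrite -scaleNr -rmorphN /=; apply: lift.
      by rewrite mulrN mulfV // lexx /=; lra.
    - by rewrite -scaleNr; apply: iD => //; exact: iZ.
  rewrite -scalerAr -scalerAl scalerA scaler_eq0 mulf_eq0 -orbA.
  case/or3P=> [/eqP /(congr1 (@complex.Re R)) /= /eqP|
    /eqP /(congr1 (@complex.Re R)) /= /eqP|/eqP //].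
    by rewrite invr_eq0 pnatr_eq0.
  by rewrite gt_eqF.
(* The two defect projections have the same trace, so one vanishes as soon as the other does. *)
have tre : inner (vec e) (L2_vec L) = inner (vec e') (L2_vec L).
  by rewrite /e /e' !uvecB !(psdDl hp) !(psdNl hp) uvec_trC.
have proj0 x : star x = x -> x * x = x -> inner (vec x) (L2_vec L) = 0 -> x = 0.
  move=> xs xx x0; apply: (@uvec_inj _ _ _ _ _ L).
  have -> : vec 0 = 0 by exact: L2_act0.
  by apply: inner_eq0; rewrite inner_uvec xs xx.
have es : star e = e by rewrite /e starB star1 starM starK.
have es' : star e' = e' by rewrite /e' starB star1 starM starK.
have ee : e * e = e.
  have ew : e * w = 0.
    by rewrite /e mulrBl mul1r -mulrA -[w in w - _]mulr1 -mulrBr.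
  by rewrite {2}/e mulrBr mulr1 mulrA ew mul0r subr0.
have ee' : e' * e' = e'.
  by rewrite {1}/e' mulrBl mul1r -mulrA we' mulr0 subr0.
have vec0 : inner (vec 0) (L2_vec L) = 0.
  by rewrite /uvec L2_act0 (psd0l hp).
have : e = 0 /\ e' = 0.
  have B's x : (beta @` B) x -> (beta @` B) (star x).
    by move=> [y By <-]; exists (star y); [exact: Bs|rewrite uaut_star].
  have [e'0|e'0] := eqVneq e' 0.
    by split=> //; apply: proj0 => //; rewrite tre e'0.
  have e0 : e = 0.
    (* If [e'] is nonzero, two uses of primeness give [e = 0]. In the relative commutant of the
       image of [B], the corner identity for [x * w0 * y] yields [e * x * w0 = 0]; then, after
       taking adjoints, the relative commutant of [B] and [w0 != 0] yield [e = 0]. *)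
    have eaw x : rel_commutant B x -> e * x * w0 = 0.
      move=> Px; have [//|/eqP] : e * x * w0 = 0 \/ e' = 0.
        apply: (@rel_commutant_prime (beta @` B)) => // [|y Py].
          exact: rel_commutant_uaut_factor.
        rewrite -[e * x * w0]mulrA -[e * (x * w0) * y]mulrA.
        by apply: corner; exact: iM.
      by rewrite (negbTE e'0).
    have [|//] : star w0 = 0 \/ e = 0.
      apply: (@rel_commutant_prime B) => // s Ps.
      suff h : star (star w0 * s * e) = 0 by rewrite -[LHS]starK h star0.
      rewrite starM es starM starK mulrA eaw //.
      by have [_ _ h _] := rel_commutant_inverse_closed Bs; exact: h.
    by move=> /(congr1 star); rewrite starK star0 => /eqP; rewrite (negbTE w00).
  by split=> //; apply: proj0 => //; rewrite -tre e0.
move=> [/eqP]; rewrite subr_eq0 => /eqP ww /eqP; rewrite subr_eq0 => /eqP ww'.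
by exists w; split.
Qed.

End RelativeCommutants.

(** * Bimodules and property (T) *)

Lemma series_single (K : numFieldType) (V : normedModType K) (u : nat -> V) :
  (forall n, u n.+1 = 0) -> series u @ \oo --> u 0%N.
Proof.
move=> u0; apply: cvg_near_cst; exists 1%N => // -[//|n] _.
by rewrite /series /= big_nat_recl // big1 ?addr0.
Qed.

Lemma normal_vector_functional (R : realType) (H : hilbert R) (N : vNalg H)
    (xi eta : H) : normal_functional (fun x : N => inner (x xi) eta).
Proof.
have hp := inner_psd H.
pose s (z : H) n : H := if n is 0%N then z else 0.
have sq z : cvgn (series (fun n => hnorm (s z n) ^+ 2)).
  apply/cvg_ex; exists (hnorm (s z 0%N) ^+ 2).
  by apply: (@series_single R R^o) => n; rewrite /= hnorm0 expr0n.
exists (s xi), (s eta); split=> // x.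
apply: (@series_single R[i] R[i]^o) => n.
by rewrite /= vN_act0 (psd0l hp).
Qed.

(** * Twisted conjugations of the standard representation *)

Section ConjugateIsometry.
Variables (R : realType) (I : Type) (U : set_system I).
Context {FU : ProperFilter U}.
Variable (N : I -> tracialvN R).
Hypothesis Nf : forall i, Defs.factor (N i).
Variable L : L2_rep (U := U) N.
Local Notation vec := (uvec L).
Let hp : psd_form (@inner R L) := inner_psd L.

Lemma uvec_dense_ext (S T : L -> L) (c : R) :
  (forall x y, hnorm (S x - S y) <= c * hnorm (x - y)) ->
  (forall x y, hnorm (T x - T y) <= c * hnorm (x - y)) ->
  (forall a, S (vec a) = T (vec a)) -> S = T.
Proof.
move=> Sc Tc e; apply/funext => xi; apply/eqP; rewrite -subr_eq0.
apply/eqP/hnorm_eq0/eqP; rewrite eq_le hnorm_ge0 andbT.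
apply/ler_addgt0Pr => d d0; rewrite add0r.
have k0 : 0 < 2 * `|c| + 1 by have := normr_ge0 c; lra.
have [a ha] := L2_cyclic xi (divr_gt0 d0 k0); rewrite -/(vec a) in ha.
apply: le_trans (form_norm_triangle hp _ (S (vec a)) _) _.
rewrite {2}e -!/(hnorm _); apply: le_trans (lerD (Sc _ _) (Tc _ _)) _.
rewrite [hnorm (vec a - xi)]hnormBC.
rewrite ltr_pdivlMr // in ha.
have := ler_norm c; have := hnorm_ge0 (xi - vec a); nra.
Qed.

Section OneFamily.
Variable f : forall i, aut (N i).
Local Notation beta := (@uaut R I U FU N f).

(** The canonical conjugation of L^2 followed by [beta]: it is isometric on the dense set of vectors
    [vec a] because the star and [beta] preserve the 2-norm, and extends by continuity. It exchanges
    left and twisted right multiplications. *)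
Lemma conjugate_isometry : exists J : L -> L,
  [/\ forall a, J (vec a) = vec (beta (star a)),
      forall x y, hnorm (J x - J y) = hnorm (x - y)
    & forall (k : R[i]) x y, J (k *: x + y) = k^* *: J x + J y].
Proof.
have iso a b : hnorm (vec (beta (star a)) - vec (beta (star b))) =
    hnorm (vec a - vec b).
  by rewrite -!uvecB -uautB // hnorm_uvec_uaut // -starB hnorm_uvec_star.
have ex (t : L * nat) : exists a, hnorm (t.1 - vec a) < 2^-1 ^+ t.2.
  exact: L2_cyclic (half_expr_gt0 R t.2).
have [A hA] := choice ex.
have Acv x : hcvg \oo (fun n => vec (A (x, n))) x.
  apply: (dist_le_cvg (K := 1) _ (@half_expr_cvg0 R)) => n.
  rewrite subr0 ger0_norm ?hnorm_ge0 // mul1r hnormBC ltW //.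
  exact: (hA (x, n)).
have exJ x : exists z, hcvg \oo (fun n => vec (beta (star (A (x, n))))) z.
  apply: hcauchy_cvg => e e0; have [n hn] := hcvg_cauchy (Acv x) e0.
  by exists n => p q np nq; rewrite iso; exact: hn.
have [J hJ] := choice exJ.
have Jiso x y : hnorm (J x - J y) = hnorm (x - y).
  have c1 : hnorm (vec (A (x, n)) - vec (A (y, n))) @[n --> \oo] --> hnorm (x - y).
    by apply: hcvg_norm; apply: hcvgD => //; exact: hcvgN.
  apply: (Rcvg_unique _ c1).
  rewrite (_ : (fun n => _) = fun n => hnorm (vec (beta (star (A (x, n)))) -
    vec (beta (star (A (y, n)))))); last by apply/funext => n; rewrite iso.
  by apply: hcvg_norm; apply: hcvgD => //; exact: hcvgN.
have JE a : J (vec a) = vec (beta (star a)).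
  apply: hcvg_unique (hJ (vec a)) _.
  have := Acv (vec a); rewrite /hcvg.
  rewrite (_ : (fun n => _) = fun n => hnorm (vec (beta (star (A (vec a, n)))) -
    vec (beta (star a)))) //.
  by apply/funext => n; rewrite iso.
exists J; split=> // k x y.
have cv : hcvg \oo (fun n => vec (k *: A (x, n) + A (y, n))) (k *: x + y).
  rewrite (_ : (fun n => _) = fun n => k *: vec (A (x, n)) + vec (A (y, n))).
    by apply: hcvgD => //; exact: hcvgZ.
  by apply/funext => n; rewrite uvecD uvecZ.
have cvJ : hcvg \oo (J \o (fun n => vec (k *: A (x, n) + A (y, n)))) (J (k *: x + y)).
  by apply: (hcvg_bounded (c := 1)) cv => s t; rewrite Jiso mul1r.
apply: hcvg_unique cvJ _.
rewrite (_ : _ \o _ = fun n => k^* *: vec (beta (star (A (x, n)))) +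
  vec (beta (star (A (y, n))))); first by apply: hcvgD => //; exact: hcvgZ.
apply/funext => n /=.
by rewrite JE starD starZ uaut_linear // uvecD uvecZ.
Qed.

End OneFamily.

(** Polarisation: norms determine the real parts, and replacing [x] by ['i *: x] gives the imaginary
    parts. *)
Lemma conjugate_inner (J : L -> L) :
  (forall x y, hnorm (J x - J y) = hnorm (x - y)) ->
  (forall (k : R[i]) x y, J (k *: x + y) = k^* *: J x + J y) ->
  forall x y, inner (J x) (J y) = inner y x.
Proof.
move=> Jiso Jl.
have JD x y : J (x + y) = J x + J y by have := Jl 1 x y; rewrite conjC1 !scale1r.
have J0 : J 0 = 0 by apply: (addrI (J 0)); rewrite -JD !addr0.
have JZ k x : J (k *: x) = k^* *: J x by have := Jl k x 0; rewrite J0 !addr0.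
have Jn x : hnorm (J x) = hnorm x by have := Jiso x 0; rewrite J0 !subr0.
have JR x y : complex.Re (inner (J x) (J y)) = complex.Re (inner x y).
  have := sqr_form_normD hp (J x) (J y); have := sqr_form_normD hp x y.
  by rewrite -JD -!/(hnorm _) !Jn; lra.
move=> x y; have h1 := JR x y; have h2 := JR ('i *: x) y.
move: h1 h2; rewrite JZ conjCi !(psdZl hp) (psd_conj hp x y) -complexiE.
case: (inner (J x) (J y)) => a b; case: (inner x y) => c d /=.
move=> -> h; rewrite -[RHS]/(c -i* d)%C; congr (_ +i* _)%C; move: h; lra.
Qed.

End ConjugateIsometry.

(** * The subfactor and its twisted bimodule *)

Section SubfactorTheory.
Variables (R : realType) (I : Type) (U : set_system I).
Context {FU : ProperFilter U}.
Variable (N : I -> tracialvN R).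
Hypothesis Nf : forall i, Defs.factor (N i).
Variable M : subfactor U N.
Local Notation L := (sf_L2 M).
Local Notation Q := (uprod U N).
Local Notation vec := (uvec L).
Let hp : psd_form (@inner R L) := inner_psd L.
Let rP := L2_star_rep L.
Implicit Types (x y : M) (q : Q).

Lemma sf_lift_subproof x : exists q, L2_act q = vN_op x :> (L -> L).
Proof. by have [q _ e] := sf_sub (vN_eltP x); exists q. Qed.

Definition sf_lift x : Q := projT1 (cid (sf_lift_subproof x)).

Lemma sf_liftE x (xi : L) : L2_act (sf_lift x) xi = x xi.
Proof. by have /= -> := projT2 (cid (sf_lift_subproof x)). Qed.

Lemma L2_act_inj q q' : (forall xi : L, L2_act q xi = L2_act q' xi) -> q = q'.
Proof. by move=> h; apply: (@uvec_inj _ _ _ _ _ L); exact: h. Qed.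

Lemma sf_setP q : sf_set M q <-> exists x, q = sf_lift x.
Proof.
split=> [qM|[x ->]].
  have Pq : vN_pred M (L2_act q) by apply/asboolP.
  by exists (VNElt Pq); apply: L2_act_inj => xi; rewrite sf_liftE.
rewrite /sf_set /= (_ : L2_act _ = vN_op x); first exact: vN_eltP.
by apply/funext => xi; exact: sf_liftE.
Qed.

Lemma sf_lift_linear k x y : sf_lift (k *: x + y) = k *: sf_lift x + sf_lift y.
Proof.
by apply: L2_act_inj => xi; rewrite (rep_linear rP) !sf_liftE.
Qed.

Lemma sf_liftM x y : sf_lift (x * y) = sf_lift x * sf_lift y.
Proof. by apply: L2_act_inj => xi; rewrite (repM rP) !sf_liftE. Qed.

Lemma sf_lift1 : sf_lift 1 = 1.
Proof. by apply: L2_act_inj => xi; rewrite (rep1 rP) sf_liftE. Qed.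

Lemma sf_lift_star x : sf_lift (star x) = star (sf_lift x).
Proof.
apply: L2_act_inj => xi; rewrite sf_liftE; apply: inner_ext => z.
by rewrite inner_starl L2_act_star sf_liftE.
Qed.

Lemma sf_set_inverse_closed : inverse_closed_star (sf_set M).
Proof.
split=> [|k x y|x|x s].
- by apply/sf_setP; exists 1; rewrite sf_lift1.
- move=> /sf_setP[a ->] /sf_setP[b ->]; apply/sf_setP.
  by exists (k *: a + b); rewrite sf_lift_linear.
- by move=> /sf_setP[a ->]; apply/sf_setP; exists (star a); rewrite sf_lift_star.
(* An inverse formed in the ultraproduct still commutes with the commutant of [M], so by the
   bicommutant condition it acts as an element of [M]. *)
- move=> /sf_setP[a ->] as1 sa1.
  have [||m mE] := @vN_intro _ _ M (L2_act s : L -> L).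
  + exact: rep_bounded rP s.
  + move=> S [_ hS]; apply/funext => xi /=.
    have hSa z : vN_op a (S z) = S (vN_op a z).
      by have := congr1 (@^~ z) (hS _ (vN_eltP a)).
    rewrite -[LHS](rep1 rP) -sa1 (repM rP) sf_liftE hSa -sf_liftE -(repM rP).
    by rewrite as1 (rep1 rP).
  + by apply/sf_setP; exists m; apply: L2_act_inj => xi; rewrite sf_liftE mE.
Qed.

Section Bimodule.
Variable f : forall i, aut (N i).
Local Notation beta := (@uaut R I U FU N f).

Lemma twisted_right_action : exists ra : M -> L -> L,
  [/\ star_antirep ra, forall x y xi, vN_op x (ra y xi) = ra y (vN_op x xi),
      normal_action ra
    & forall x a, ra x (vec a) = vec (a * beta (sf_lift x))].
Proof.
have [g [bg gb]] := uaut_inverse (U := U) Nf f.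
have [J [JE Jiso Jl]] := conjugate_isometry Nf L f.
have [K [KE Kiso Kl]] := conjugate_isometry Nf L g.
have JK : J \o K = id.
  apply: (@uvec_dense_ext _ _ _ _ _ L _ _ 1) => [x y|x y|a] /=.
  - by rewrite Jiso Kiso mul1r.
  - by rewrite mul1r.
  - by rewrite KE JE -uaut_star // starK gb.
have KJ : K \o J = id.
  apply: (@uvec_dense_ext _ _ _ _ _ L _ _ 1) => [x y|x y|a] /=.
  - by rewrite Kiso Jiso mul1r.
  - by rewrite mul1r.
  - by rewrite JE KE -uaut_star // starK bg.
have JKE (x : L) : J (K x) = x by have /= := congr1 (@^~ x) JK.
have KJE (x : L) : K (J x) = x by have /= := congr1 (@^~ x) KJ.
have Jin (x y : L) : inner (J x) y = inner (K y) x.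
  by rewrite -{1}[y]JKE (conjugate_inner Jiso Jl).
(* Since [K] is inverse to [J], this is $Jx^*J^{-1}$, which is right multiplication by
   [beta (sf_lift x)] on the vectors [vec a]. *)
pose ra (x : M) (xi : L) : L := J (star x (K xi)).
have JD (x y : L) : J (x + y) = J x + J y by have := Jl 1 x y; rewrite conjC1 !scale1r.
have J0 : J 0 = 0 by apply: (addrI (J 0)); rewrite -JD !addr0.
have JZ k (x : L) : J (k *: x) = k^* *: J x by have := Jl k x 0; rewrite J0 !addr0.
have K0 : K 0 = 0 by rewrite -[0 in LHS]J0 KJE.
have rab x : exists2 c, 0 <= c &
    forall xi eta, hnorm (ra x xi - ra x eta) <= c * hnorm (xi - eta).
  have [c c0 xc] := vN_op_bound (star x); exists c => // xi eta.
  by rewrite /ra Jiso -vN_actB; apply: le_trans (xc _) _; rewrite Kiso.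
have rE x a : ra x (vec a) = vec (a * beta (sf_lift x)).
  rewrite /ra KE -sf_liftE sf_lift_star -uvecM JE starM starK uautM //.
  by rewrite -uaut_star // starK gb.
have rlin x : linear (ra x).
  by move=> k s t; rewrite /ra Kl vN_linear Jl conjCK.
have rrep : star_antirep ra.
  split=> [x|k x y xi|xi|x y xi|x].
  - split; first exact: rlin.
    have [c _ h] := rab x; exists c => xi; have := h xi 0.
    by rewrite /ra K0 vN_act0 J0 !subr0.
  - by rewrite /ra starD starZ vN_addE vN_scaleE JD JZ conjCK.
  - by rewrite /ra star1 vN_oneE JKE.
  - by rewrite /ra starM vN_mulE KJE.
  - move=> xi eta; rewrite /ra starK Jin (psd_conj hp _ xi) Jin.
    by rewrite -(psd_conj hp) inner_starr.
have lr x y xi : vN_op x (ra y xi) = ra y (vN_op x xi).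
  have [c c0 xc] := vN_op_bound x; have [d d0 yd] := rab y.
  suff e : vN_op x \o ra y = ra y \o vN_op x by have /= := congr1 (@^~ xi) e.
  apply: (@uvec_dense_ext _ _ _ _ _ L _ _ (c * d)) => [s t|s t|a] /=.
  - by rewrite -vN_actB; apply: le_trans (xc _) _; rewrite -mulrA ler_wpM2l.
  - apply: le_trans (yd _ _) _; rewrite [c * d]mulrC -mulrA ler_wpM2l //.
    by rewrite -vN_actB; exact: xc.
  - by rewrite rE -!sf_liftE -!uvecM rE mulrA.
exists ra; split=> // xi eta.
(* Moving [J] across the inner product turns a coefficient of the right action into a vector
   functional of [M], which gives normality. *)
rewrite (_ : (fun x => _) = fun x : M => inner (x (K eta)) (K xi)).
  exact: normal_vector_functional.
by apply/funext => x; rewrite /ra Jin inner_starr.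
Qed.

(** Property (T) gives a nearby central vector in L^2 only. Averaging over unitaries of [M]
    identifies the projection of [vec w] as [vec z] for a contraction [z], and centrality of [vec z]
    is the intertwining relation. *)
Lemma property_T_intertwiner (S : {fset M}) (c : R) (w : Q) :
  (forall (E : bimodule M) (P : E -> E),
      orthogonal_projection (@central_vectors _ _ M E) P -> forall xi : E,
      hnorm (xi - P xi) <=
        c * Num.sqrt (\sum_(x <- S) hnorm (lact x xi - ract x xi) ^+ 2)) ->
  uball w ->
  exists2 z, uball z /\ intertwiner f (sf_set M) z &
    hnorm (vec w - vec z) <= c * Num.sqrt (\sum_(x <- S)
      hnorm (vec (sf_lift x * w - w * beta (sf_lift x))) ^+ 2).
Proof.
move=> T wb.
have [ra [rrep lr rn rE]] := twisted_right_action.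
have lrep : star_rep (fun x : M => vN_op x).
  by split=> // [x|x]; [exact: vN_bounded|exact: vN_adjoint].
have ln : normal_action (fun x : M => vN_op x).
  by move=> xi eta; exact: normal_vector_functional.
pose E := Bimodule lrep rrep lr ln rn.
pose V : set L := [set xi | forall x : M, vN_op x xi = ra x xi].
have raD x xi eta : ra x (xi + eta) = ra x xi + ra x eta.
  by have [h _] := antirep_bounded rrep x; have := h 1 xi eta; rewrite !scale1r.
have ra0 x : ra x 0 = 0 by apply: (addrI (ra x 0)); rewrite -raD !addr0.
have raN x xi : ra x (- xi) = - ra x xi.
  by apply/eqP; rewrite -addr_eq0 -raD addNr ra0.
have Vs : hsubspace V.
  split=> [x|k s t Vs Vt x]; first by rewrite vN_act0 ra0.
  by have [h _] := antirep_bounded rrep x; rewrite h vN_linear Vs Vt.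
have Vc : hclosed V.
  move=> u l Vu ul x.
  have [d _ xd] := vN_op_bound x; have [_ [d' rd]] := antirep_bounded rrep x.
  have c1 : hcvg \oo (vN_op x \o u) (vN_op x l).
    by apply: (hcvg_bounded (c := d)) ul => s t; rewrite -vN_actB; exact: xd.
  have c2 : hcvg \oo (ra x \o u) (ra x l).
    by apply: (hcvg_bounded (c := d')) ul => s t; rewrite -raN -raD; exact: rd.
  apply: hcvg_unique c1 _.
  by rewrite (_ : _ \o _ = ra x \o u) //; apply/funext => n /=; exact: Vu.
have [P hP] := hprojection Vs Vc.
(* The contractions whose vectors have the same projection onto [V] as [vec w]. The averaged element
   also has its vector in [V], so this vector is that projection. *)
pose C : set Q := [set y | uball y /\
  forall v, V v -> inner (vec y) v = inner (vec w) v].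
have [|||||z [zb zw] zi] :=
  @uaverage _ _ _ _ _ Nf L f (sf_set M) C sf_set_inverse_closed.
- by exists w.
- by move=> y [].
- move=> x y [xb xw] [yb yw]; split; first exact: uball_midpoint.
  move=> v Vv; rewrite uvecZ uvecD (psdZl hp) (psdDl hp) xw // yw //.
  exact: (@chalf_double _ R[i]^o).
- move=> u x Cu xb ux; split=> // v Vv.
  by apply: (inner_limit ux) => n; have [_] := Cu n; exact.
- move=> v y /sf_setP[m ->] vu vb [yb yw]; split.
    apply: uballM; first exact: uballM.
    by apply: uball_star; exact: uaut_uball.
  (* Both actions are moved onto [s]; as [s] is central, they combine into the right action of
     [star m * m], which is 1. *)
  move=> s Vsv; rewrite -(yw _ Vsv) -uaut_star // -sf_lift_star.
  rewrite -rE uvecM sf_liftE -lr (vN_adjoint m) (antirep_star rrep) starK.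
  rewrite Vsv -(antirepM rrep) (_ : star m * m = 1) ?(antirep1 rrep) //.
  apply: vN_ext => xi; rewrite -sf_liftE sf_liftM sf_lift_star vu.1.
  by rewrite (rep1 rP).
have Vz : V (vec z).
  move=> x; rewrite rE -sf_liftE -uvecM zi //.
  by apply/sf_setP; exists x.
have [VP Po] := hP (vec w).
have zP : vec z = P (vec w).
  apply/eqP; rewrite -subr_eq0; apply/eqP; apply: inner_eq0.
  have Vd : V (vec z - P (vec w)).
    by rewrite addrC -scaleN1r; apply: Vs.2.
  have := Po _ Vd; rewrite (psdDl hp) -(zw _ Vd) -(psdDl hp).
  by [].
exists z; first by split.
rewrite zP; apply: le_trans (T E P hP (vec w)) _.
rewrite le_eqVlt; apply/orP; left; apply/eqP; congr (_ * Num.sqrt _).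
apply: eq_bigr => x _; congr (_ ^+ 2); congr hnorm.
by rewrite uvecB uvecM sf_liftE -rE.
Qed.

End Bimodule.

End SubfactorTheory.

(** * Near intertwiners *)

Lemma filter_seq_forall (T : Type) (F : set_system T) {FF : Filter F}
    (J : eqType) (s : seq J) (P : J -> T -> Prop) :
  (forall j, j \in s -> \forall t \near F, P j t) ->
  \forall t \near F, forall j, j \in s -> P j t.
Proof.
elim: s => [|j s IH] h; first by apply: nearW.
have h1 : \forall t \near F, P j t by apply: h; rewrite mem_head.
have h2 : \forall t \near F, forall k, k \in s -> P k t.
  by apply: IH => k ks; apply: h; rewrite in_cons ks orbT.
apply: filterS (filterI h1 h2) => t [Pj Ps] k.
by rewrite in_cons => /orP[/eqP ->//|]; exact: Ps.
Qed.

Lemma connected_component_clopen (T : topologicalType) (W : set T) (x y : T) :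
  open W -> open (~` W) -> W x -> connected_component [set: T] x y -> W y.
Proof.
move=> oW oW' Wx [C [Cx _ Cc] Cy].
suff e : C `&` W = C by move: Cy; rewrite -e => -[].
apply: Cc; [by exists x|by exists W|exists W => //].
by rewrite -(setCK W); exact: open_closedC.
Qed.

Section NearIntertwiners.
Variables (R : realType) (I : Type) (U : set_system I).
Context {FU : ProperFilter U}.
Variable (N : I -> tracialvN R).
Hypothesis Nf : forall i, Defs.factor (N i).
Variable M : subfactor U N.
Local Notation L := (sf_L2 M).
Local Notation Q := (uprod U N).
Local Notation vec := (uvec L).
Variable S : {fset M}.
Let a (x : M) : linf N := urepr (sf_lift x).

(** The bound 1/2 does not depend on [d]: an exact unitary intertwiner has 2-norm 1, so its lifts
    exceed 1/2 at U-many indices, whatever the required error. *)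
Definition near_intertwined (i : I) (d : R) (b : aut (N i)) :=
  exists w : N i, [/\ op_bound 1 w, 1 / 2 < nrm2 w
    & forall x, x \in S -> nrm2 (a x i * w - w * b (a x i)) < d].

Lemma near_intertwined_id i (d : R) : 0 < d -> near_intertwined d (id_aut (N i)).
Proof.
move=> d0; exists 1; split; first exact: op_bound1.
  by rewrite nrm2_1; lra.
by move=> x _; rewrite mul1r mulr1 subrr nrm2_0.
Qed.

Lemma near_intertwined_perturb i (d : R) (b g : aut (N i)) :
  near_intertwined (d / 2) b ->
  (forall x, x \in S -> nrm2 (g (a x i) - b (a x i)) < d / 2) ->
  near_intertwined d g.
Proof.
move=> [w [w1 wn wb]] bg; exists w; split=> // x xS.
apply: le_lt_trans (nrm2_triangle _ (w * b (a x i)) _) _.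
rewrite -mulrBr; have := nrm2_mull (b (a x i) - g (a x i)) ler01 w1.
by rewrite mul1r nrm2BC; have := bg x xS; have := wb x xS; lra.
Qed.

(** An automorphism with error [d / 2] gives error [d] to all automorphisms close to it on the lifts
    of [S]. By self-improvement this applies at every point of the set, and the symmetry of
    closeness makes the complement open too. *)
Lemma near_intertwined_clopen i (d : R) (b : aut (N i)) : 0 < d ->
  (forall g : aut (N i), near_intertwined d g -> near_intertwined (d / 2) g) ->
  connected_component [set: aut (N i)] (id_aut (N i)) b -> near_intertwined d b.
Proof.
move=> d0 imp.
have d2 : 0 < d / 2 by lra.
apply: (@connected_component_clopen _ [set g | near_intertwined d g]).
- move=> g /imp hg; exists [seq a x i | x <- S], (d / 2); split=> // g' hg'.
  by apply: near_intertwined_perturb hg _ => x xS; apply: hg'; exact: map_f.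
- move=> g hg; exists [seq a x i | x <- S], (d / 2); split=> // g' hg' hg''.
  apply: hg; apply: (near_intertwined_perturb (imp _ hg'')) => x xS.
  by rewrite nrm2BC; apply: hg'; exact: map_f.
- exact: near_intertwined_id.
Qed.

Section OneFamily.
Variable f : forall i, aut (N i).

Lemma intertwiner_near (z : Q) (d : R) : 0 < d -> uball z -> unitary z ->
  intertwiner f (sf_set M) z -> \forall i \near U, near_intertwined d (f i).
Proof.
move=> d0 [b b1 zb] [zz _] zi.
have n1 : hnorm (vec z) = 1.
  apply/eqP; rewrite -(eqrXn2 (n := 2)) ?hnorm_ge0 // sqr_hnorm inner_uvec zz.
  by rewrite uvec1 -sqr_hnorm hnorm_Omega.
have near1 : \forall i \near U, 1 / 2 < nrm2 (b i).
  apply: cvgr_gt (cvg_nrm2_uvec L b) _ _.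
  by rewrite -zb n1; lra.
have near2 : \forall i \near U, forall x, x \in enum_fset S ->
    nrm2 (a x i * b i - b i * f i (a x i)) < d.
  apply: filter_seq_forall => x _.
  have := cvg_nrm2_uvec L (a x * b - b * linf_aut f (a x)).
  rewrite uclassB !uclassM -uautE // ureprK -zb zi; last by apply/sf_setP; exists x.
  rewrite subrr /uvec L2_act0 hnorm0 => cv.
  exact: cvgr_lt cv _ d0.
by apply: filterS (filterI near1 near2) => i [h1 h2]; exists (b i).
Qed.

(** The condition on [d] caps the property (T) estimate at 1/4, below the 2-norm 1/2 of the
    approximate intertwiner, so the central vector is nonzero. The [.+1] keeps the factor positive
    when [S] is empty. *)
Lemma near_intertwiner (c d : R) : 0 < c ->
  c * ((size (enum_fset S)).+1%:R * d) <= 1 / 4 -> 0 < d ->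
  trivial_center (rel_commutant (sf_set M)) ->
  (forall (E : bimodule M) (P : E -> E),
      orthogonal_projection (@central_vectors _ _ M E) P -> forall xi : E,
      hnorm (xi - P xi) <=
        c * Num.sqrt (\sum_(x <- S) hnorm (lact x xi - ract x xi) ^+ 2)) ->
  (\forall i \near U, near_intertwined d (f i)) ->
  exists z : Q, [/\ uball z, intertwiner f (sf_set M) z & unitary z].
Proof.
move=> c0 cd d0 Mf T nf.
(* At indices without an approximate intertwiner the value 1 is used; these do not affect limits
   along [U]. *)
have ex i : exists w : N i, op_bound 1 w /\ (near_intertwined d (f i) ->
    1 / 2 < nrm2 w /\
    forall x, x \in S -> nrm2 (a x i * w - w * f i (a x i)) < d).
  have [[w [w1 wn wd]]|h] := pselect (near_intertwined d (f i)).
    by exists w; split.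
  by exists 1; split=> //; exact: op_bound1.
pose W i := projT1 (cid (ex i)).
have hW i := projT2 (cid (ex i)).
have Wb : bounded_family W by exists 1 => i; exact: (hW i).1.
pose w := linf_mk Wb.
have wb : uball (uclass w : Q) by exists w => // i; exact: (hW i).1.
have w12 : 1 / 2 <= hnorm (vec (uclass w)).
  apply: (cvgr_to_ge (cvg_nrm2_uvec L w)); apply: filterS nf => i hi.
  by rewrite ltW //; have [h _] := (hW i).2 hi.
have wd x : x \in S -> hnorm (vec (sf_lift x * uclass w -
    uclass w * uaut f (sf_lift x))) <= d.
  move=> xS; have := cvg_nrm2_uvec L (a x * w - w * linf_aut f (a x)).
  rewrite uclassB !uclassM -uautE // ureprK => cv.
  apply: (cvgr_to_le cv); apply: filterS nf => i hi.
  by rewrite ltW //; have [_ h] := (hW i).2 hi; exact: h.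
have [z [zb zi] wz] := property_T_intertwiner Nf f T wb.
apply: (@intertwiner_unitary _ _ _ _ _ Nf L f (sf_set M) z) => //.
  by have [_ _ h _] := sf_set_inverse_closed M.
apply/eqP => z0.
have : hnorm (vec (uclass w)) <= 1 / 4.
  have -> : vec (uclass w) = vec (uclass w) - vec z.
    by rewrite z0 [uvec L 0]L2_act0 subr0.
  apply: le_trans wz _; apply: le_trans cd; rewrite ler_wpM2l ?(ltW c0) //.
  set n := size _.
  have nd0 : 0 <= n.+1%:R * d by rewrite mulr_ge0 // ltW.
  rewrite -(ger0_norm nd0) -sqrtr_sqr; apply: ler_wsqrtr.
  apply: (@le_trans _ _ (\sum_(x <- S) d ^+ 2)).
    rewrite big_seq [leRHS]big_seq; apply: ler_sum => x xS.
    by rewrite ler_pXn2r ?nnegrE ?hnorm_ge0 ?(ltW d0) //; exact: wd.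
  rewrite big_const_seq count_predT iter_addr_0 -/n -[leLHS]mulr_natl exprMn.
  rewrite ler_wpM2r ?sqr_ge0 // -natrX ler_nat.
  by rewrite expnS expn1 mulnS leqW // leq_addr.
lra.
Qed.

End OneFamily.

End NearIntertwiners.

(** * Self-improvement of approximate intertwiners along connected components *)

Theorem theorem5p2 (R : realType) (I : Type) (U : set_system I)
  (U_ultra : UltraFilter U) (U_nonprincipal : forall i : I, ~ U [set i])
  (N : I -> tracialvN R) (N_II1 : forall i : I, II1_factor (N i))
  (M : subfactor U N) (M_T : property_T M)
  (M'_factor : trivial_center (rel_commutant (sf_set M)))
  (alpha : forall i : I, aut (N i))
  (alpha_conn : forall i : I,
     connected_component [set: aut (N i)] (id_aut (N i)) (alpha i)) :
  exists u : uprod U N, unitary u /\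
    forall x : uprod U N, sf_set M x ->
      uprod_map (fun i : I => alpha i) x = u * x * star u.
Proof.
have Nf i : Defs.factor (N i) := (N_II1 i).1.
have [S [c [c0 T]]] := M_T.
have [d d0 cd] : exists2 d : R, 0 < d &
    c * ((size (enum_fset S)).+1%:R * d) <= 1 / 4.
  set n : R := _.+1%:R; have n0 : 0 < n by rewrite /n ltr0n.
  exists (4 * c * n)^-1; first by rewrite invr_gt0 !mulr_gt0.
  rewrite le_eqVlt; apply/orP; left; apply/eqP; field.
  by rewrite !gt_eqF.
pose G i e (b : aut (N i)) := near_intertwined S e b.
have d2 : 0 < d / 2 by lra.
(* Otherwise counterexamples [b i] occur at U-many indices. They form a family with approximate
   intertwiners, whose exact unitary intertwiner gives error [d / 2] at U-many indices, a
   contradiction. *)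
have self_improving : \forall i \near U,
    forall b : aut (N i), G i d b -> G i (d / 2) b.
  have [//|bad] := in_ultra_setVsetC
    [set i | forall b : aut (N i), G i d b -> G i (d / 2) b] U_ultra.
  exfalso.
  (* Where there is no counterexample the identity is chosen, so that the family has error [d] at
     every index. *)
  have ex i : exists b : aut (N i), G i d b /\
      (~ (forall b : aut (N i), G i d b -> G i (d / 2) b) -> ~ G i (d / 2) b).
    have [h|/existsNP[b /not_implyP[h1 h2]]] :=
      pselect (forall b : aut (N i), G i d b -> G i (d / 2) b).
      by exists (id_aut (N i)); split=> //; exact: near_intertwined_id.
    by exists b.
  pose b i := projT1 (cid (ex i)).
  have hb i := projT2 (cid (ex i)).
  have [|z [zb zi zu]] := near_intertwiner Nf (f := b) c0 cd d0 M'_factor T.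
    by apply: nearW => i; exact: (hb i).1.
  have near2 := intertwiner_near Nf S d2 zb zu zi.
  have [i [h1 h2]] := filter_ex (filterI bad near2).
  exact: (hb i).2 h1 h2.
have [|z [zb zi [zz zz']]] := near_intertwiner Nf (f := alpha) c0 cd d0 M'_factor T.
  apply: filterS self_improving => i h.
  exact: near_intertwined_clopen d0 h (alpha_conn i).
(* The intertwiner satisfies [x * z = z * alpha x], so [alpha] is conjugation by the adjoint of
   [z]. *)
exists (star z); rewrite /unitary starK; split=> // x Mx.
by rewrite -[LHS]mul1r -zz -[star z * z * _]mulrA -zi // mulrA.
Qed.
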